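(* There is an integer $r_0$ such that for every integer $r\ge r_0$, the maximum number of nonzero, pairwise non-parallel rows of a rank-$r$ $2$-modular matrix is $\binom{r+2}{2}-2$.
   Context: For a positive integer $\Delta$, an integer matrix $A$ is $\Delta$-modular if the determinant of every $\operatorname{rank}(A)\times\operatorname{rank}(A)$ submatrix of $A$ has absolute value at most $\Delta$. Two rows are parallel if one is a nonzero scalar multiple of the other. *)

(* Defs.v *)
From mathcomp Require Import all_boot all_order all_algebra.
Set Implicit Arguments. Unset Strict Implicit. Unset Printing Implicit Defensive.
Import GRing.Theory Num.Theory.
Local Open Scope ring_scope.

Definition ratmx m n (A : 'M[int]_(m, n)) : 'M[rat]_(m, n) :=
  map_mx (fun x : int => x%:~R) A.

Definition rankZ m n (A : 'M[int]_(m, n)) : nat := \rank (ratmx A).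

(* Delta-modular: every rank(A) x rank(A) submatrix has |det| <= Delta.
   Row/column selections are arbitrary maps; non-injective selections give
   determinant 0 and reorderings only change the sign, so this is the same as
   ranging over all rank x rank submatrices. *)
Definition Delta_modular (D : nat) m n (A : 'M[int]_(m, n)) : Prop :=
  forall (f : 'I_(rankZ A) -> 'I_m) (g : 'I_(rankZ A) -> 'I_n),
    `|\det (\matrix_(i, j) A (f i) (g j))| <= D%:Z.

Definition parallel n (u v : 'rV[int]_n) : Prop :=
  exists c : rat, c != 0 /\ ratmx u = c *: ratmx v.

Definition nonzero_nonparallel_rows m n (A : 'M[int]_(m, n)) : Prop :=
  (forall i, row i A != 0) /\
  (forall i j, i != j -> ~ parallel (row i A) (row j A) /\ ~ parallel (row j A) (row i A)).

(* Main.v *)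
(** Choose r rows of maximal absolute determinant (1 or 2) and take coordinates with respect to
    them: the rows become vectors with entries in {0, +-1/2, +-1}, and so are all minors (the
    predicate [tm]), which is preserved by pivoting.  Over a set T of columns where all entries are
    integral, the vectors are grouped in fibres; there are at most C(|T|+1, 2) classes up to sign
    (Heller), and for each column u outside T the widths of the fibres in direction u add up to at
    most |T|.  The columns where a vector is half-integral form an odd set S, the same one for all
    half-integral vectors.  Change basis so that |S| is minimal.  If S is empty or has one or two
    elements, counting fibres over the complement of S suffices (for |S| = 2 a fibre containing a
    square and its centre needs three more linear functionals as directions).  If |S| >= 3,
    contract some e in S: two vectors become parallel only when they differ by the unit vector of
    e, and the number of such pairs is at most r for |S| = 3, 4, apart from one configuration on
    five columns that is counted directly, and at most r - 1 for |S| >= 5, because by minimality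
    of |S| the pairs are then linearly independent.  Hence the excess over the bound drops with
    each contraction and vanishes for large r.  The extremal matrix has the rows e_i, e_i - e_j
    (i < j) and e_0 + e_j. *)
From HB Require Import structures.
Require Import Defs.
From mathcomp Require Import all_boot all_order all_algebra.
From mathcomp Require Import zify ring lra.
Set Implicit Arguments. Unset Strict Implicit. Unset Printing Implicit Defensive.
Import Order.TTheory GRing.Theory Num.Theory.
Local Open Scope ring_scope.


(** * Half-integral minors and pivoting *)

(** A contraction from rank r + 1 to rank r has the budget [phi r.+1 - phi r] = r + 2, where [phi]
    is the bound. One unit pays for the contracted element, so r + 1 pairs just fit. For |S| = 3, 4
    nothing is lost, but nothing is gained either: the exact bound for smaller odd sets must be
    available, down to direct counts for |S| <= 2. For |S| >= 5 there are only r pairs and each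
    contraction gains one unit, which makes an initially poor bound improve. In rank N that bound is
    the crude 5^N (an entry takes five values), so the excess is gone in rank N + 5^N; N = 5^5 + 5
    is a rank from which |S| <= 4 causes no excess. Minimality of |S| need not survive a
    contraction, so a minimal odd set is chosen anew in each rank.

    A direct count over the complement of s columns, with t = r - s, compares [phi r] with C(t+1, 2)
    classes; the difference is (s+1)t plus a constant. For s = 1, 2 the widths use up (s+1)t
    completely; the counts with s = 3, 5 leave t/4 and t, which absorb the vectors supported on the
    s columns once r is large. *)

Lemma det_add1_mulC (R : comNzRingType) n k (A : 'M[R]_(n, k)) (B : 'M[R]_(k, n)) :
  \det (1%:M + A *m B) = \det (1%:M + B *m A).
Proof.
(* Sylvester's identity: [M *m U] and [U *m M] are both block triangular, and their determinants are
   the two sides. *)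
pose M := block_mx (1%:M : 'M[R]_n) (- A) B (1%:M : 'M[R]_k).
pose U := block_mx (1%:M : 'M[R]_n) A 0 (1%:M : 'M[R]_k).
have U1 : \det U = 1 by rewrite det_ublock !det1 mulr1.
have MU : M *m U = block_mx 1%:M 0 B (1%:M + B *m A).
  by rewrite mulmx_block !mulmx1 !mul1mx !mulmx0 !addr0 subrr addrC.
have UM : U *m M = block_mx (1%:M + A *m B) 0 B 1%:M.
  by rewrite mulmx_block !mulmx1 !mul1mx !mul0mx !add0r addNr.
have := congr1 determinant MU; have := congr1 determinant UM.
by rewrite !det_mulmx !det_lblock !det1 U1 !mul1r !mulr1 => <- <-.
Qed.

Lemma det_mx22 (R : comNzRingType) (M : 'M[R]_2) :
  \det M = M 0 0 * M 1 1 - M 0 1 * M 1 0.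
Proof.
rewrite (expand_det_row _ 0) !big_ord_recl big_ord0 /cofactor !det_mx11 !mxE /=.
rewrite addn0 expr0 !mul1r expr1 mulN1r addr0 mulrN.
by congr (M 0 _ * M _ _ - M 0 _ * M _ _); apply/val_inj.
Qed.


Section Vectors.
Variable R : realFieldType.
Implicit Types a b : R.

(** [iv], [hf] and [hv] stand for integral value, half-integral value and either of them. *)
Definition iv a := [|| a == 0, a == 1 | a == -1].
Definition hf a := (a == 2^-1) || (a == - 2^-1).
Definition hv a := iv a || hf a.

Variant iv_spec a : Prop := IvZ of a = 0 | IvP of a = 1 | IvN of a = -1.
Variant hf_spec a : Prop := HfP of a = 2^-1 | HfN of a = - 2^-1.
Variant hv_spec a : Prop :=
  HvZ of a = 0 | HvP of a = 1 | HvN of a = -1 | HvHP of a = 2^-1 | HvHN of a = - 2^-1.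

Lemma ivP a : iv a -> iv_spec a.
Proof. by case/or3P=> /eqP; constructor. Qed.

Lemma hfP a : hf a -> hf_spec a.
Proof. by case/orP=> /eqP; constructor. Qed.

Lemma hvP a : hv a -> hv_spec a.
Proof. by case/orP=> [/ivP|/hfP] []; constructor. Qed.

Lemma hf_hv a : hf a -> hv a. Proof. by rewrite /hv orbC => ->. Qed.

Lemma hvN a : hv (- a) = hv a.
Proof. by rewrite /hv /iv /hf !eqr_oppLR !opprK oppr0 (orbC (a == -1)) (orbC (a == - _)). Qed.

Lemma hv_le1 a : hv a -> -1 <= a <= 1.
Proof. by move/hvP=> []->; lra. Qed.

Lemma hf_neq0 a : hf a -> a != 0.
Proof. by move/hfP=> []->; apply/eqP; lra. Qed.

Lemma ivNhf a : iv a -> ~~ hf a.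
Proof. by move/ivP=> []->; apply/negP=> /hfP[]; lra. Qed.

Lemma hv_norm a b : `|b| = 1 -> hv (a * b) -> hv a.
Proof.
move/eqP; rewrite eqr_norml ler01 andbT => /orP[]/eqP->; first by rewrite mulr1.
by rewrite mulrN1 hvN.
Qed.

Definition ux n (j : 'I_n) : 'rV[R]_n := \row_k (k == j)%:R.

Lemma uxE n (j k : 'I_n) : ux j 0 k = (k == j)%:R.
Proof. by rewrite mxE. Qed.

Lemma mul_uxmx n m (j : 'I_n) (g : 'M[R]_(n, m)) : ux j *m g = row j g.
Proof.
apply/rowP=> k; rewrite !mxE (bigD1 j) //= big1 => [|i /negPf ij]; rewrite uxE.
  by rewrite eqxx mul1r addr0.
by rewrite ij mul0r.
Qed.

(* [X] is a family of vectors written in coordinates with respect to a basis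
   of maximal determinant. *)
Record tm n (X : 'rV[R]_n -> Prop) : Prop := Tm {
  tmU : forall j, X (ux j);
  tmN : forall x, X x -> X (- x);
  tmD : forall A : 'M[R]_n, (forall i, X (row i A)) -> hv (\det A) }.

(** [g] is the identity with the rows [f c] replaced by the vectors [x c]. By Sylvester's identity
    its determinant is the k by k minor, so the full-size determinants in [tm] control all minors;
    and if the minor is +-1, the rows of [g] are a new basis inside X. *)
Lemma tm_minor n (X : 'rV[R]_n -> Prop) k (x : 'I_k -> 'rV[R]_n) (f : 'I_k -> 'I_n) :
  tm X -> injective f -> (forall c, X (x c)) ->
  exists g : 'M[R]_n,
  [/\ forall i, X (row i g), forall c, row (f c) g = x c,
      forall i, i \notin codom f -> row i g = ux i
    & \det g = \det (\matrix_(c, d) x c 0 (f d))].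
Proof.
move=> tX fi xX.
pose E : 'M[R]_(n, k) := \matrix_(j, c) (j == f c)%:R.
pose M : 'M[R]_(k, n) := \matrix_c x c.
pose g := 1%:M + E *m (M - E^T).
have gE i j : g i j = (i == j)%:R + \sum_c (i == f c)%:R * (x c 0 j - (j == f c)%:R).
  by rewrite !mxE; congr (_ + _); apply: eq_bigr => c _; rewrite !mxE.
have g1 c : row (f c) g = x c.
  apply/rowP=> j; rewrite mxE gE (bigD1 c) //= big1 => [|d dc].
    by rewrite eqxx mul1r addr0 eq_sym addrC subrK.
  by rewrite (inj_eq fi) eq_sym (negPf dc) mul0r.
have g2 i : i \notin codom f -> row i g = ux i.
  move=> fi'; apply/rowP=> j; rewrite mxE gE uxE big1 ?addr0 1?eq_sym // => c _.
  case: eqP => [ifc|_]; last by rewrite mul0r.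
  by rewrite ifc codom_f in fi'.
exists g; split=> // [i|].
  have [/codomP[c ->]|/g2->] := boolP (i \in codom f); first by rewrite g1.
  exact: tmU.
rewrite det_add1_mulC mulmxBl.
have -> : E^T *m E = 1%:M.
  apply/matrixP=> c d; rewrite !mxE (bigD1 (f c)) //= big1 => [|j /negPf jc].
    by rewrite !mxE eqxx mul1r addr0 (inj_eq fi).
  by rewrite !mxE jc mul0r.
rewrite addrC subrK; congr determinant; apply/matrixP=> c d.
rewrite !mxE (bigD1 (f d)) //= big1 => [|j /negPf jd]; rewrite !mxE ?eqxx ?mulr1 ?addr0 //.
by rewrite jd mulr0.
Qed.

Lemma tm_det n (X : 'rV[R]_n -> Prop) k (x : 'I_k -> 'rV[R]_n) (f : 'I_k -> 'I_n) :
  tm X -> injective f -> (forall c, X (x c)) -> hv (\det (\matrix_(c, d) x c 0 (f d))).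
Proof. by move=> tX fi /(tm_minor tX fi)[g [gX _ _ <-]]; apply: tmD tX _ _. Qed.

Lemma tm_entry n (X : 'rV[R]_n -> Prop) x j : tm X -> X x -> hv (x 0 j).
Proof.
move=> tX xX; have := @tm_det _ X 1 (fun=> x) (fun=> j) tX _ (fun=> xX).
rewrite det_mx11 mxE; apply=> a b _; by rewrite !ord1.
Qed.

Lemma tm_det2 n (X : 'rV[R]_n -> Prop) x y i j :
  tm X -> X x -> X y -> i != j -> hv (x 0 i * y 0 j - x 0 j * y 0 i).
Proof.
move=> tX xX yX ij.
pose z (c : 'I_2) := if c == 0 then x else y.
pose f (c : 'I_2) := if c == 0 then i else j.
have fi : injective f.
  rewrite /f => a b.
  case: (a =P 0) (b =P 0) => [->|a0] [->|b0] // h.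
  - by move/eqP: ij.
  - by move/eqP: ij => /(_ (esym h)).
  have H (d : 'I_2) : d <> 0 -> d = lift 0 0.
    by case: (unliftP 0 d) => [k ->|->] //; rewrite (ord1 k).
  by rewrite (H _ a0) (H _ b0).
have zX c : X (z c) by rewrite /z; case: ifP.
have := tm_det tX fi zX.
by rewrite det_mx22 !mxE.
Qed.

(** The rows of [g] are a new basis and [y] is a coordinate vector in it; determinants change by the
    sign [\det g] only. *)
Lemma tm_chg n (X : 'rV[R]_n -> Prop) g :
  tm X -> (forall i, X (row i g)) -> `|\det g| = 1 -> tm (fun y => X (y *m g)).
Proof.
move=> tX gX dg; split=> [j|x|A AX]; first by rewrite mul_uxmx.
  by rewrite mulNmx; apply: tmN.
apply: hv_norm dg _; rewrite -det_mulmx; apply: tmD tX _ _ => i.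
by rewrite row_mul.
Qed.

(** Coordinates of [v] after [x] has replaced the unit vector [ux j] in the basis. The formula is
    meant for [x 0 j] = +-1, where multiplying by [x 0 j] is the same as dividing by it. *)
Definition piv n (x : 'rV[R]_n) j (v : 'rV[R]_n) : 'rV[R]_n := v - (x 0 j * v 0 j) *: (x - ux j).

Lemma pivE n (x v : 'rV[R]_n) j k : k != j -> piv x j v 0 k = v 0 k - x 0 j * v 0 j * x 0 k.
Proof. by move=> kj; rewrite !mxE (negPf kj) subr0. Qed.

Lemma piv_is_linear n (x : 'rV[R]_n) j : linear (piv x j).
Proof.
move=> a u v; apply/rowP=> k; rewrite /piv !mxE; ring.
Qed.

HB.instance Definition _ n (x : 'rV[R]_n) j :=
  GRing.isLinear.Build R _ _ _ (piv x j) (piv_is_linear x j).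

Definition pimg n (X : 'rV[R]_n -> Prop) x j z := exists2 v, X v & z = piv x j v.

Lemma iv_sqr a : iv a -> a != 0 -> a * a = 1.
Proof. by move/ivP=> []->; rewrite ?eqxx // => _; lra. Qed.

Lemma piv_row n (x : 'rV[R]_n) j : x 0 j * x 0 j = 1 -> piv x j x = ux j.
Proof. by move=> xj; rewrite /piv xj scale1r opprB addrC subrK. Qed.

Lemma piv_id n (x v : 'rV[R]_n) j : v 0 j = 0 -> piv x j v = v.
Proof. by move=> vj; rewrite /piv vj mulr0 scale0r subr0. Qed.

(** A pivot is the change of basis by the identity matrix with row j replaced by [x]. In this form
    statements about all bases, such as the minimality of odd sets, pass to pivots. *)
Lemma pimg_chg n (X : 'rV[R]_n -> Prop) x j : tm X -> X x -> x 0 j * x 0 j = 1 ->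
  exists g : 'M[R]_n, [/\ forall i, X (row i g), `|\det g| = 1
    & forall z, pimg X x j z <-> X (z *m g)].
Proof.
move=> tX xX xj.
have fi : injective (fun _ : 'I_1 => j) by move=> a b _; rewrite !ord1.
have [g [gX g1 g2 dg]] := tm_minor tX fi (fun _ : 'I_1 => xX).
rewrite det_mx11 mxE in dg.
have dg1 : `|\det g| = 1.
  by apply/eqP; rewrite -(@eqrXn2 _ 2) // expr1n dg real_normK ?num_real ?expr2 ?xj.
have gE : g = 1%:M + (ux j)^T *m (x - ux j).
  apply/matrixP=> i k; have -> : g i k = row i g 0 k by rewrite mxE.
  rewrite [RHS]mxE [X in _ = _ + X]mxE big_ord1.
  have [->|ij] := eqVneq i j; first by rewrite (g1 0) !mxE eqxx mul1r (eq_sym j) addrCA subrr addr0.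
  rewrite g2; last by apply/codomP=> -[c]; apply/eqP.
  by rewrite !mxE (negPf ij) mul0r addr0 eq_sym.
have vgE v : v *m g = v + v 0 j *: (x - ux j).
  rewrite gE mulmxDr mulmx1 mulmxA; congr (_ + _).
  have -> : v *m (ux j)^T = (v 0 j)%:M.
    apply/rowP=> k; rewrite !ord1 !mxE (bigD1 j) //= big1 => [|i /negPf ij].
      by rewrite !mxE eqxx mulr1 addr0.
    by rewrite !mxE ij mulr0.
  by rewrite mul_scalar_mx.
exists g; split=> // z; rewrite vgE; split=> [[v vX ->]|zX].
    suff -> : piv x j v + piv x j v 0 j *: (x - ux j) = v by [].
    apply/rowP=> k; rewrite !mxE eqxx.
    have -> : v 0 j - x 0 j * v 0 j * (x 0 j - 1) = x 0 j * v 0 j.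
      rewrite mulrBr mulr1 mulrAC xj; ring.
    ring.
  exists (z + z 0 j *: (x - ux j)) => //; apply/rowP=> k; rewrite !mxE eqxx.
  have -> : x 0 j * (z 0 j + z 0 j * (x 0 j - 1)) = z 0 j.
    by rewrite mulrBr mulr1 addrC subrK mulrCA xj mulr1.
  ring.
Qed.

Lemma tm_piv n (X : 'rV[R]_n -> Prop) x j :
  tm X -> X x -> x 0 j * x 0 j = 1 -> tm (pimg X x j).
Proof.
move=> tX xX xj; have [g [gX dg pX]] := pimg_chg tX xX xj.
have tX' := tm_chg tX gX dg.
split=> [i|z|A AX]; first by apply/pX/(tmU tX').
  by move/pX/(tmN tX')/pX.
by apply: (tmD tX') => i; apply/pX.
Qed.

End Vectors.

(** * Vectors compared on a set T of integral columns *)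

Section Widths.
Variable R : realFieldType.
Variable n : nat.
Implicit Types (x y z l h : 'rV[R]_n) (X : 'rV[R]_n -> Prop) (T : {set 'I_n}) (u t : 'I_n).
Implicit Types (a b s e : R).

Definition eqT T x y := [forall j in T, x 0 j == y 0 j].

Lemma eqTP T x y : reflect (forall j, j \in T -> x 0 j = y 0 j) (eqT T x y).
Proof. by apply: (iffP 'forall_in_eqP). Qed.

Lemma neqTP T x y : ~~ eqT T x y -> exists2 j, j \in T & x 0 j != y 0 j.
Proof.
rewrite /eqT negb_forall => /existsP[j]; rewrite negb_imply => /andP[jT xy].
by exists j.
Qed.

Definition intT T X := forall x, X x -> forall j, j \in T -> iv (x 0 j).

Definition sim T x y := eqT T x y || eqT T x (- y).

Lemma simP T x y : reflect (exists2 s, s * s = 1 & eqT T x (s *: y)) (sim T x y).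
Proof.
apply: (iffP orP) => [[] H|[s s1 H]].
- by exists 1; rewrite ?mulr1 ?scale1r.
- by exists (-1); rewrite ?mulrNN ?mulr1 ?scaleN1r.
have : (s - 1) * (s + 1) = 0 by rewrite mulrBl mul1r mulrDr mulr1 s1; ring.
move/eqP; rewrite mulf_eq0 subr_eq0 addr_eq0 => /orP[]/eqP sE; rewrite sE in H.
  by left; rewrite scale1r in H.
by right; rewrite scaleN1r in H.
Qed.

Lemma eqT_sub T T' x y : T' \subset T -> eqT T x y -> eqT T' x y.
Proof. by move/subsetP=> TT /eqTP H; apply/eqTP=> j /TT/H. Qed.

Lemma sign_cases s : s * s = 1 -> s = 1 \/ s = -1.
Proof.
move=> s1; have : (s - 1) * (s + 1) = 0 by rewrite mulrBl mul1r mulrDr mulr1 s1; ring.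
move/eqP; rewrite mulf_eq0 subr_eq0 addr_eq0 => /orP[]/eqP; by [left|right].
Qed.

Lemma tm_sign X x s : tm X -> X x -> s * s = 1 -> X (s *: x).
Proof.
by move=> tX xX /sign_cases[]->; rewrite ?scale1r ?scaleN1r //; apply: tmN.
Qed.

(** At a column of T where [x] is non-zero both vectors have the entry 1 or -1, so the factor is a
    sign. *)
Lemma sim_mul T X x y a : intT T X -> X x -> X y -> ~~ eqT T x 0 ->
  eqT T x (a *: y) -> sim T x y.
Proof.
move=> iT xX yX /neqTP[j jT xj] /eqTP H; apply/simP; exists a; last by apply/eqTP.
move: xj; have := iT _ xX _ jT; have := iT _ yX _ jT; rewrite H // !mxE.
by move=> /ivP[]-> /ivP[] h; rewrite h ?eqxx // => _; nra.
Qed.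

Lemma iv_subM a b e : iv a -> iv b -> iv e -> hv (a - b * e) -> iv (a - b * e).
Proof.
by move=> /ivP[]-> /ivP[]-> /ivP[]-> /orP[] // /hfP[]; lra.
Qed.

Lemma intT_piv T X x j : tm X -> intT T X -> X x -> j \in T -> x 0 j * x 0 j = 1 ->
  intT (T :\ j) (pimg X x j).
Proof.
move=> tX iT xX jT xj z [v vX ->] k; rewrite !inE => /andP[kj kT].
have := tm_entry k (tm_piv tX xX xj) (ex_intro2 _ _ v vX erefl).
rewrite pivE //; apply: iv_subM; rewrite ?(iT _ _ _ kT) //.
by have := iT _ xX _ jT; have := iT _ vX _ jT => /ivP[]-> /ivP[]->;
  rewrite ?(mulr0, mul0r, mulr1, mul1r, mulN1r, opprK) /iv ?eqxx ?orbT.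
Qed.

Lemma intT_neq0 T X x : intT T X -> X x -> ~~ eqT T x 0 ->
  exists2 j, j \in T & x 0 j * x 0 j = 1.
Proof.
move=> iT xX /neqTP[j jT xj]; exists j => //; rewrite mxE in xj.
exact: iv_sqr (iT _ xX _ jT) xj.
Qed.

Lemma piv_eq0 T x j z : j \in T -> x 0 j * x 0 j = 1 ->
  eqT (T :\ j) (piv x j z) 0 -> eqT T z ((x 0 j * z 0 j) *: x).
Proof.
move=> jT xj /eqTP H; apply/eqTP=> k kT; rewrite mxE.
have [->|kj] := eqVneq k j; first by rewrite mulrAC xj mul1r.
have := H k; rewrite !inE kj kT pivE // mxE => /(_ isT)/eqP.
by rewrite subr_eq0 => /eqP.
Qed.

(** The factor [x 0 j * z 0 j] of the pivot equals [a], so [a] times [x] is subtracted in the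
    columns outside T as well. Thus relations on T turn combinations of entries outside T into
    single entries. *)
Lemma piv_coord T x j z a : j \in T -> x 0 j * x 0 j = 1 -> eqT T z (a *: x) ->
  forall k, k != j -> piv x j z 0 k = z 0 k - a * x 0 k.
Proof.
move=> jT xj /eqTP H k kj; rewrite pivE // (H j jT) mxE; congr (_ - _ * _).
by rewrite mulrCA xj mulr1.
Qed.

Lemma piv_eqT T x j z a : j \in T -> x 0 j * x 0 j = 1 -> eqT T z (a *: x) ->
  eqT (T :\ j) (piv x j z) 0.
Proof.
move=> jT xj H; apply/eqTP=> k; rewrite !inE => /andP[kj kT].
by rewrite (piv_coord jT xj H) // (eqTP _ _ _ H) // !mxE subrr.
Qed.

Lemma eqT_subr0 T x y : eqT T (x - y) 0 = eqT T x y.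
Proof.
by apply/eqTP/eqTP=> H j jT; have := H j jT; rewrite !mxE; [move/eqP; rewrite subr_eq0=> /eqP|move=>->; rewrite subrr].
Qed.

(** After a pivot at [x] the difference of the two entries in column u is the entry of the image of
    [y] there. *)
Lemma two_term T X u x y : tm X -> intT T X -> u \notin T -> X x -> X y ->
  ~~ eqT T x 0 -> eqT T y x -> hv (y 0 u - x 0 u).
Proof.
move=> tX iT uT xX yX /(intT_neq0 iT xX)[j jT xj] yx.
have uj : u != j by apply: contraNneq uT => ->.
have := tm_entry u (tm_piv tX xX xj) (ex_intro2 _ _ y yX erefl).
by rewrite (@piv_coord T x j y 1) ?scale1r // mul1r.
Qed.

(** A pivot at [x1] removes its multiple from the relation and leaves the situation of [two_term]
    with one column less. [comb3] is reduced to [comb2] in the same way; the hypotheses of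
    independence keep the remaining vectors independent. *)
Lemma comb2 T X u x x1 x2 a : tm X -> intT T X -> u \notin T -> X x -> X x1 -> X x2 ->
  ~~ eqT T x1 0 -> (forall c, ~~ eqT T x2 (c *: x1)) ->
  eqT T x (a *: x1 + x2) -> hv (x 0 u - a * x1 0 u - x2 0 u).
Proof.
move=> tX iT uT xX x1X x2X /(intT_neq0 iT x1X)[j jT xj] x2n xE.
have uj : u != j by apply: contraNneq uT => ->.
have xE' : eqT T (x - x2) (a *: x1).
  by apply/eqTP=> k kT; have := eqTP _ _ _ xE k kT; rewrite !mxE; lra.
have tX' := tm_piv tX x1X xj.
have iT' := intT_piv tX iT x1X jT xj.
have inX v : X v -> pimg X x1 j (piv x1 j v) by exists v.
have H := @two_term (T :\ j) _ u (piv x1 j x2) (piv x1 j x) tX' iT' _ (inX _ x2X) (inX _ xX).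
have -> : x 0 u - a * x1 0 u - x2 0 u = piv x1 j x 0 u - piv x1 j x2 0 u.
  have := piv_coord jT xj xE' uj; rewrite linearB !mxE; lra.
apply: H; first by rewrite !inE negb_and uT orbT.
  by apply/negP=> /(piv_eq0 jT xj); apply/negP.
by rewrite -eqT_subr0 -linearB; apply: piv_eqT xE'.
Qed.


Lemma comb3 T X u x x1 x2 x3 a b : tm X -> intT T X -> u \notin T ->
  X x -> X x1 -> X x2 -> X x3 ->
  ~~ eqT T x1 0 -> (forall c, ~~ eqT T x2 (c *: x1)) ->
  (forall c d, ~~ eqT T x3 (c *: x1 + d *: x2)) ->
  eqT T x (a *: x1 + b *: x2 + x3) ->
  hv (x 0 u - a * x1 0 u - b * x2 0 u - x3 0 u).
Proof.
move=> tX iT uT xX x1X x2X x3X /(intT_neq0 iT x1X)[j jT xj] x2n x3n xE.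
have uj : u != j by apply: contraNneq uT => ->.
have xE' : eqT T (x - b *: x2 - x3) (a *: x1).
  by apply/eqTP=> k kT; have := eqTP _ _ _ xE k kT; rewrite !mxE; lra.
have tX' := tm_piv tX x1X xj.
have iT' := intT_piv tX iT x1X jT xj.
have inX v : X v -> pimg X x1 j (piv x1 j v) by exists v.
have uT' : u \notin T :\ j by rewrite !inE negb_and uT orbT.
have H := @comb2 (T :\ j) _ u (piv x1 j x) (piv x1 j x2) (piv x1 j x3) b tX' iT' uT'
  (inX _ xX) (inX _ x2X) (inX _ x3X).
have -> : x 0 u - a * x1 0 u - b * x2 0 u - x3 0 u =
  piv x1 j x 0 u - b * piv x1 j x2 0 u - piv x1 j x3 0 u.
  by have := piv_coord jT xj xE' uj; rewrite 2!linearB linearZ !mxE; lra.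
apply: H.
- by apply/negP=> /(piv_eq0 jT xj); apply/negP.
- move=> c; apply/negP; rewrite -eqT_subr0 -linearZ -linearB => /(piv_eq0 jT xj) H.
  move/negP: (x3n (x1 0 j * (x3 - c *: x2) 0 j) c); apply.
  by apply/eqTP=> k kT; have := eqTP _ _ _ H k kT; rewrite !mxE; lra.
rewrite -eqT_subr0 opprD addrA -linearZ -!linearB; exact: piv_eqT xE'.
Qed.

(** A pivot at [x'] leaves [x] = [a] times [y] on the rest of T, where both are integral and [y]
    does not vanish. *)
Lemma comb_coef T X x x' y s a : tm X -> intT T X -> X x -> X x' -> X y ->
  ~~ eqT T x' 0 -> ~~ eqT T y 0 -> ~~ sim T x x' -> ~~ sim T y x' ->
  s * s = 1 -> eqT T x (s *: x' + a *: y) -> a * a = 1.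
Proof.
move=> tX iT xX x'X yX x'n yn xx' yx' s1 xE.
have [j jT xj] := intT_neq0 iT x'X x'n.
have tX' := tm_piv tX x'X xj.
have iT' := intT_piv tX iT x'X jT xj.
have inX v : X v -> pimg X x' j (piv x' j v) by exists v.
have yn' : ~~ eqT (T :\ j) (piv x' j y) 0.
  by apply/negP=> /(piv_eq0 jT xj) /(sim_mul iT yX x'X yn); apply/negP.
have [k kT yk] := intT_neq0 iT' (inX _ yX) yn'.
have xE' : eqT T (x - a *: y) (s *: x').
  by apply/eqTP=> i iT0; have := eqTP _ _ _ xE i iT0; rewrite !mxE; lra.
have E : piv x' j x 0 k - a * piv x' j y 0 k = 0.
  by have := eqTP _ _ _ (piv_eqT jT xj xE') k kT; rewrite linearB linearZ !mxE.
have a0 : a != 0.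
  apply: contraNneq xx' => a0; apply/simP; exists s => //.
  by move: xE; rewrite a0 scale0r addr0.
have := iT' _ (inX _ xX) _ kT; have := iT' _ (inX _ yX) _ kT.
move: E yk; set p := piv x' j x 0 k; set q := piv x' j y 0 k => E yk.
by move=> /ivP[] qE /ivP[] pE; rewrite qE pE in E yk; move: a0 => /eqP; nra.
Qed.

(** A segment in direction u whose ends lie in one fibre over T. *)
Record itv X T u l h : Prop := Itv {
  itvl : X l; itvh : X h; itvE : eqT T h l; itv0 : ~~ eqT T l 0; itvd : l 0 u < h 0 u }.

Lemma itv_width X T u l h : tm X -> intT T X -> u \notin T -> itv X T u l h ->
  h 0 u - l 0 u = 1 \/ h 0 u - l 0 u = 2^-1.
Proof.
move=> tX iT uT [lX hX lh l0 d].
by have /hvP[] := two_term tX iT uT lX hX l0 lh; [lra|left|lra|right|lra].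
Qed.

Lemma itv_flip X T u l h : tm X -> itv X T u l h -> itv X T u (- h) (- l).
Proof.
move=> tX [lX hX /eqTP lh l0 d]; split.
- exact: tmN.
- exact: tmN.
- by apply/eqTP=> j jT; rewrite !mxE lh.
- apply: contra l0 => /eqTP H; apply/eqTP=> j jT; have := H j jT; rewrite !mxE lh //; lra.
by rewrite !mxE ltrN2.
Qed.

Lemma itv_signed X T u l h s : tm X -> itv X T u l h -> s * s = 1 ->
  exists l', exists2 h', itv X T u l' h' &
   [/\ eqT T l' (s *: l), l' 0 u + h' 0 u = s * (l 0 u + h 0 u) & h' 0 u - l' 0 u = h 0 u - l 0 u].
Proof.
move=> tX i /sign_cases[]->.
  by exists l; exists h => //; rewrite scale1r mul1r; split=> //; apply/eqTP.
exists (- h); exists (- l); first exact: itv_flip.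
rewrite scaleN1r !mxE; split; [|lra|lra].
by apply/eqTP=> j jT; rewrite !mxE (eqTP _ _ _ (itvE i)).
Qed.

Section Merge.
Variables (X : 'rV[R]_n -> Prop) (T : {set 'I_n}) (u : 'I_n) (I : finType).
Hypothesis tX : tm X.

Definition wsum (V : {set I}) (lo hi : I -> 'rV[R]_n) := \sum_(i in V) (hi i 0 u - lo i 0 u).

Hypothesis IH : forall (V : {set I}) lo hi,
  (forall i, i \in V -> itv X T u (lo i) (hi i)) ->
  (forall i j, i \in V -> j \in V -> i != j -> ~~ sim T (lo i) (lo j)) ->
  wsum V lo hi <= #|T|%:R.

(** The second hypothesis says that two intervals of one class, brought to the same sign, do not
    overlap. The interval that spans both is then at least as long as the two together and replaces
    them. As no class contains three intervals, the process ends with pairwise different classes,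
    where [IH] applies. *)
Lemma merge (V : {set I}) lo hi :
  (forall i, i \in V -> itv X T u (lo i) (hi i)) ->
  (forall i j s, i \in V -> j \in V -> i != j -> s * s = 1 -> eqT T (lo i) (s *: lo j) ->
    (hi i 0 u - lo i 0 u) + (hi j 0 u - lo j 0 u) <=
    `|(lo i 0 u + hi i 0 u) - s * (lo j 0 u + hi j 0 u)|) ->
  (forall i j k, i \in V -> j \in V -> k \in V -> i != j -> i != k -> j != k ->
     sim T (lo i) (lo j) -> ~~ sim T (lo i) (lo k)) ->
  wsum V lo hi <= #|T|%:R.
Proof.
have [m] := ubnP #|V|; elim: m => // m IHm in V lo hi * => ltV vi vn v3.
have [/existsP[i /existsP[j /and4P[iV jV ij sij]]]|nos] :=
  boolP [exists i, exists j, [&& i \in V, j \in V, i != j & sim T (lo i) (lo j)]]; last first.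
  apply: IH => // i j iV jV ij; apply: contra nos => sij.
  by apply/existsP; exists i; apply/existsP; exists j; rewrite iV jV ij.
have [s s1 sE] := simP _ _ _ sij.
have [lj [hj ijv [ljE sjE djE]]] := itv_signed tX (vi _ jV) s1.
have := vn _ _ _ iV jV ij s1 sE; rewrite -sjE => gap.
have ljE' : eqT T (lo i) lj.
  by apply/eqTP=> k kT; rewrite (eqTP _ _ _ sE) // (eqTP _ _ _ ljE).
have [l [h lh [lE dE]]] : exists l, exists2 h, itv X T u l h & eqT T l (lo i) /\
   (hi i 0 u - lo i 0 u) + (hi j 0 u - lo j 0 u) <= h 0 u - l 0 u.
  have iiv := vi _ iV.
  have [P|N] := lerP 0 ((lo i 0 u + hi i 0 u) - (lj 0 u + hj 0 u)).
    rewrite ger0_norm // in gap.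
    exists lj; exists (hi i); last first.
      by split; [apply/eqTP=> k kT; rewrite (eqTP _ _ _ ljE')|lra].
    have := itvd iiv; have := itvd ijv => d1 d2.
    split; [exact: itvl ijv|exact: itvh iiv| |exact: itv0 ijv|lra].
    by apply/eqTP=> k kT; rewrite (eqTP _ _ _ (itvE iiv)) // (eqTP _ _ _ ljE').
  rewrite ltr0_norm // in gap.
  exists (lo i); exists hj; last by split; [apply/eqTP|lra].
  have := itvd iiv; have := itvd ijv => d1 d2.
  split; [exact: itvl iiv|exact: itvh ijv| |exact: itv0 iiv|lra].
  by apply/eqTP=> k kT; rewrite (eqTP _ _ _ (itvE ijv)) // -(eqTP _ _ _ ljE').
pose lo' k := if k == i then l else lo k.
pose hi' k := if k == i then h else hi k.
have loE k : eqT T (lo' k) (lo k).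
  by rewrite /lo'; case: eqP => [->|_] //; apply/eqTP.
have simE k k' : sim T (lo' k) (lo' k') = sim T (lo k) (lo k').
  by apply/simP/simP=> -[a a1 /eqTP aE]; exists a => //; apply/eqTP=> q qT;
     have := aE q qT; rewrite !mxE !(eqTP _ _ _ (loE _)).
have noti k : k \in V -> k != i -> k != j -> ~~ sim T (lo i) (lo k).
  by move=> kV ki kj; apply: (v3 i j k) => //; rewrite eq_sym.
suff le1 : wsum V lo hi <= wsum (V :\ j) lo' hi'.
  apply: le_trans le1 _; apply: IHm.
  - by move: ltV; rewrite (cardsD1 j V) jV.
  - move=> k; rewrite !inE /lo' /hi' => /andP[_ kV]; case: eqP => [_|_] //; exact: vi.
  - move=> k k' a; rewrite !inE => /andP[kj kV] /andP[k'j k'V] kk' a1 aE.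
    have sk : sim T (lo k) (lo k') by rewrite -simE; apply/simP; exists a.
    have ki : k != i.
      by apply: contraTneq sk => ki; rewrite ki; apply: noti; rewrite // -ki eq_sym.
    have k'i : k' != i.
      apply: contraTneq sk => k'i; rewrite k'i.
      apply: contra (noti k kV ki kj) => /simP[b b1 /eqTP bE]; apply/simP; exists b => //.
      by apply/eqTP=> q qT; rewrite mxE bE // mxE mulrA b1 mul1r.
    by move: aE; rewrite /lo' /hi' (negPf ki) (negPf k'i); apply: vn.
  - move=> a b c; rewrite !inE !simE => /andP[_ aV] /andP[_ bV] /andP[_ cV].
    exact: v3.
rewrite /wsum (big_setD1 j) //= (big_setD1 i) ?inE ?ij //= [leRHS](big_setD1 i) ?inE ?ij //=.
rewrite addrA lerD //; first by rewrite /lo' /hi' eqxx addrC.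
rewrite le_eqVlt; apply/orP; left; apply/eqP; apply: eq_bigr => k.
by rewrite !inE /lo' /hi' => /andP[/negPf->].
Qed.

End Merge.

End Widths.

(** * The sum of widths *)

Section WidthSum.
Variable R : realFieldType.
Variable n : nat.
Implicit Types (x y z l h : 'rV[R]_n) (X : 'rV[R]_n -> Prop) (T : {set 'I_n}) (u t : 'I_n).
Implicit Types (s e : R).

Lemma sqr_sign s : s * s = 1 -> exists p : bool, s = (-1) ^+ p.
Proof. by case/sign_cases=> ->; [exists false|exists true]. Qed.

Lemma sign_sqr (p : bool) : (-1) ^+ p * (-1) ^+ p = 1 :> R.
Proof. by rewrite -signr_addb addbb. Qed.

(** Contradiction behind [bad_excl]: a signed sum over four intervals of width 1/2 ranges over a
    segment of length 2 with midpoint [e * (lo0 - hi0)] = +-1/2, so it leaves [-1, 1]. The [x]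
    variables are the ends that give its two extreme values. *)
Lemma four_arith (lo hi lo0 hi0 cj ck cl xj xj' xk xk' xl xl' s f g e : R) :
  s * s = 1 -> f * f = 1 -> g * g = 1 -> e = 1 \/ e = -1 ->
  hi - lo = 2^-1 -> hi0 - lo0 = 2^-1 ->
  xj = cj / 2 + - s / 4 -> xj' = cj / 2 + s / 4 ->
  xk = ck / 2 + - f / 4 -> xk' = ck / 2 + f / 4 ->
  xl = cl / 2 + g / 4 -> xl' = cl / 2 + - g / 4 ->
  lo + hi - s * cj - 2 * e * lo0 = 0 -> f * ck - g * cl - 2 * e * hi0 = 0 ->
  -1 <= hi - s * xj - f * xk + g * xl <= 1 ->
  -1 <= lo - s * xj' - f * xk' + g * xl' <= 1 -> False.
Proof.
move=> s1 f1 g1 eE d d0 -> -> -> -> -> -> E1 E2.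
have mE (a b c : R) : a * (b / 2 + c / 4) = a * b / 2 + a * c / 4 by ring.
rewrite !mE !mulrN s1 f1 g1.
by case: eE E1 E2 => ->; lra.
Qed.

Section Step.
Variables (X : 'rV[R]_n -> Prop) (T : {set 'I_n}) (u : 'I_n) (I : finType).
Variables (V : {set I}) (lo hi : I -> 'rV[R]_n) (i0 : I).
Hypotheses (tX : tm X) (iT : intT T X) (uT : u \notin T).
Hypothesis vi : forall i, i \in V -> itv X T u (lo i) (hi i).
Hypothesis vn : forall i j, i \in V -> j \in V -> i != j -> ~~ sim T (lo i) (lo j).
Hypothesis i0V : i0 \in V.
Hypothesis i0max : forall i, i \in V -> hi i 0 u - lo i 0 u <= hi i0 0 u - lo i0 0 u.

Let W := V :\ i0.
Let y0 := lo i0.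
Let wd i := hi i 0 u - lo i 0 u.
Let cc i := lo i 0 u + hi i 0 u.
(** How two of the other intervals can fall into one class after a pivot at an end of i0; [isy]
    describes the two candidates for that end. *)
Let rel i j (s e : R) := [/\ i \in W, j \in W, i != j, s * s = 1
  & eqT T (lo i) (s *: lo j + e *: y0)].
Let isy y := y = lo i0 \/ y = hi i0.

Let WV i : i \in W -> i \in V. Proof. by rewrite inE => /andP[]. Qed.
Let Wi0 i : i \in W -> i != i0. Proof. by rewrite !inE => /andP[]. Qed.

Let isyX y : isy y -> X y.
Proof. by case=> ->; [apply: itvl (vi i0V)|apply: itvh (vi i0V)]. Qed.

Let isyE y : isy y -> eqT T y y0.
Proof. by case=> ->; [apply/eqTP|apply: itvE (vi i0V)]. Qed.

Let lX i : i \in W -> X (lo i). Proof. by move/WV/vi/itvl. Qed.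
Let hX i : i \in W -> X (hi i). Proof. by move/WV/vi/itvh. Qed.
Let l0 i : i \in W -> ~~ eqT T (lo i) 0. Proof. by move/WV/vi/itv0. Qed.
Let y0X : X y0. Proof. exact: itvl (vi i0V). Qed.
Let y00 : ~~ eqT T y0 0. Proof. exact: itv0 (vi i0V). Qed.

Let notmul i c : i \in W -> ~~ eqT T (lo i) (c *: y0).
Proof.
move=> iW; apply/negP=> /(sim_mul iT (lX iW) y0X (l0 iW)); apply/negP.
exact: vn (WV iW) i0V (Wi0 iW).
Qed.

Let rel_sqr i j s e : rel i j s e -> e * e = 1.
Proof.
case=> iW jW ij s1 E.
apply: (comb_coef tX iT (lX iW) (lX jW) y0X (l0 jW) y00 _ _ s1 E).
  exact: vn (WV iW) (WV jW) ij.
by apply: vn i0V (WV jW) _; rewrite eq_sym Wi0.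
Qed.

Let liftP i x : i \in W -> x = lo i \/ x = hi i -> X x /\ eqT T x (lo i).
Proof.
move=> iW [] ->; first by split; [exact: lX|apply/eqTP].
by split; [exact: hX|exact: itvE (vi (WV iW))].
Qed.

Let rel_hv i j s e y x x' : rel i j s e -> isy y ->
  x = lo i \/ x = hi i -> x' = lo j \/ x' = hi j -> hv (x 0 u - e * y 0 u - s * x' 0 u).
Proof.
case=> iW jW ij s1 E yy xi xj.
have [xX xE] := liftP iW xi; have [x'X x'E] := liftP jW xj.
have -> : s * x' 0 u = (s *: x') 0 u by rewrite mxE.
apply: (comb2 tX iT uT) => //.
- exact: isyX.
- exact: tm_sign.
- by apply: contra y00 => /eqTP H; apply/eqTP=> k kT; rewrite -(eqTP _ _ _ (isyE yy)) ?H.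
- move=> c; apply/negP=> H; move/negP: (notmul (s * c) jW); apply.
  apply/eqTP=> k kT; have := eqTP _ _ _ H k kT; rewrite !mxE (eqTP _ _ _ x'E) //.
  by rewrite (eqTP _ _ _ (isyE yy)) // -mulrA => <-; rewrite mulrA s1 mul1r.
apply/eqTP=> k kT; rewrite !mxE (eqTP _ _ _ xE) // (eqTP _ _ _ x'E) // (eqTP _ _ _ (isyE yy)) //.
by rewrite (eqTP _ _ _ E) // !mxE addrC.
Qed.

Let wdP i : i \in V -> wd i = 1 \/ wd i = 2^-1.
Proof. by move/vi/(itv_width tX iT uT). Qed.

(** Intervals i and j do not overlap after the pivot at [y], in the form required by [merge]. *)
Let gap i j s e y := wd i + wd j <= `|cc i - s * cc j - 2 * e * y 0 u|.

(** Over all ends of the two intervals, the largest and the smallest value of x - e y - s x' in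
    column u lie in [-1, 1], and they differ by [wd i + wd j]. *)
Let rel_le i j s e y : rel i j s e -> isy y ->
  `|cc i - s * cc j - 2 * e * y 0 u| <= 2 - (wd i + wd j).
Proof.
move=> r yy; have [_ _ _ s1 _] := r.
have H x x' := @rel_hv i j s e y x x' r yy.
rewrite ler_norml /cc /wd; have [sE|sE] := sign_cases s1; subst s.
  have := hv_le1 (H _ _ (or_introl erefl) (or_intror erefl)).
  have := hv_le1 (H _ _ (or_intror erefl) (or_introl erefl)); lra.
have := hv_le1 (H _ _ (or_introl erefl) (or_introl erefl)).
have := hv_le1 (H _ _ (or_intror erefl) (or_intror erefl)); lra.
Qed.

(** The tested quantity changes by 2 from one end of i0 to the other, and at both ends it is at most
    2 - ([wd i + wd j]) in absolute value by [rel_le]; hence it is at least [wd i + wd j] at each of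
    them. *)
Let gap1 i j s e y : wd i0 = 1 -> rel i j s e -> isy y -> gap i j s e y.
Proof.
move=> d1 r yy; have e1 := rel_sqr r; have [iW jW _ s1 _] := r.
have := rel_le r (or_introl erefl : isy (lo i0)).
have := rel_le r (or_intror erefl : isy (hi i0)).
rewrite /gap; set D := cc i - _; move: d1; rewrite /wd => d1.
have /orP wi : (wd i == 1) || (wd i == 2^-1) by case: (wdP (WV iW)) => ->; rewrite eqxx ?orbT.
have /orP wj : (wd j == 1) || (wd j == 2^-1) by case: (wdP (WV jW)) => ->; rewrite eqxx ?orbT.
rewrite !ler_norml !ler_normr -!/(wd _).
by case: (sign_cases e1) => ->; case: yy => ->; case: wi => /eqP->; case: wj => /eqP->; lra.
Qed.

(** When all widths are 1/2, the tested quantity is an integer, so the only obstruction to [gap] is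
    that it vanishes: two intervals coincide after the pivot. *)
Let bad y := [exists i in W, exists j in W, exists p : bool, exists q : bool,
  [&& i != j, eqT T (lo i) ((-1) ^+ p *: lo j + (-1) ^+ q *: y0)
    & cc i - (-1) ^+ p * cc j - 2 * (-1) ^+ q * y 0 u == 0]].

Let badP y : reflect (exists i j s e, rel i j s e /\ cc i - s * cc j - 2 * e * y 0 u = 0) (bad y).
Proof.
apply: (iffP idP).
  case/exists_inP=> i iW /exists_inP[j jW /existsP[p /existsP[q /and3P[ij H /eqP H']]]].
  by exists i, j, ((-1) ^+ p), ((-1) ^+ q); split=> //; split=> //; apply: sign_sqr.
case=> i [j [s [e [r E]]]]; have e1 := rel_sqr r; case: r => iW jW ij s1 r.
have [p sp] := sqr_sign s1; have [q eq] := sqr_sign e1; subst s e.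
apply/exists_inP; exists i => //; apply/exists_inP; exists j => //.
by apply/existsP; exists p; apply/existsP; exists q; rewrite ij r E eqxx.
Qed.

Let gap2 i j s e y : wd i0 = 2^-1 -> ~~ bad y -> rel i j s e -> isy y -> gap i j s e y.
Proof.
move=> d0 nb r yy; have e1 := rel_sqr r; have [iW jW _ s1 _] := r.
have : cc i - s * cc j - 2 * e * y 0 u != 0.
  by apply: contra nb => /eqP E; apply/badP; exists i, j, s, e.
have H x x' := @rel_hv i j s e y x x' r yy.
have Hlh := H _ _ (or_introl erefl) (or_intror erefl).
have Hhl := H _ _ (or_intror erefl) (or_introl erefl).
have Hll := H _ _ (or_introl erefl) (or_introl erefl).
have Hhh := H _ _ (or_intror erefl) (or_intror erefl).
have := i0max (WV iW); have := i0max (WV jW); rewrite -!/(wd _) d0 => lj li.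
have dj : wd j = 2^-1 by case: (wdP (WV jW)) lj => // ->; lra.
have di : wd i = 2^-1 by case: (wdP (WV iW)) li => // ->; lra.
rewrite /gap dj di; move: di dj; rewrite /cc /wd => di dj /eqP nz.
rewrite ler_normr; have [sE|sE] := sign_cases s1; subst s.
  by have /hvP[] := Hll; lra.
by have /hvP[] := Hlh; lra.
Qed.

Let rel_uniq i j s e s' e' : rel i j s e -> rel i j s' e' -> s = s' /\ e = e'.
Proof.
move=> r r'; have [iW jW ij s1 E] := r; have [_ _ _ s1' E'] := r'.
have [k kT yk] := neqTP y00; rewrite mxE in yk.
have ss : s = s'.
  have [//|ss] := eqVneq s s'; have ds : s - s' != 0 by rewrite subr_eq0.
  case/negP: (notmul ((e' - e) / (s - s')) jW); apply/eqTP=> q qT.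
  have := eqTP _ _ _ E q qT; rewrite (eqTP _ _ _ E') // !mxE => H.
  apply: (mulfI ds); rewrite mulrA mulrCA divff // mulr1; lra.
split=> //; subst s'; have := eqTP _ _ _ E k kT; rewrite (eqTP _ _ _ E') // !mxE.
by move/addrI/(mulIf yk).
Qed.

Let rel_sym i j s e : rel i j s e -> rel j i s (- s * e).
Proof.
case=> iW jW ij s1 E; split; rewrite // 1?eq_sym //.
apply/eqTP=> q qT; rewrite !mxE (eqTP _ _ _ E) // !mxE mulrDr mulrA s1; ring.
Qed.

(** Eliminating [lo i] would relate [lo j] and [lo k] with an even coefficient at [y0], whereas
    [rel_sqr] makes it a sign. So no three intervals meet in one class. *)
Let rel_tri i j k s e s' e' : rel j i s e -> rel k i s' e' -> j = k.
Proof.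
move=> r r'; have [//|jk] := eqVneq j k.
have [jW iW ji s1 E] := r; have [kW _ ki s1' E'] := r'.
have r2 : rel j k (s * s') (e - s * s' * e').
  split=> //; first by rewrite mulrACA s1 s1' mulr1.
  apply/eqTP=> q qT; rewrite !mxE (eqTP _ _ _ E) // (eqTP _ _ _ E') // !mxE.
  by rewrite mulrDr -!mulrA (mulrA s' s') s1'; ring.
exfalso; have := rel_sqr r2; have := rel_sqr r; have := rel_sqr r'.
by move=> /sign_cases[]-> /sign_cases[]->; case: (sign_cases s1) => ->;
  case: (sign_cases s1') => ->; lra.
Qed.

(** Bad pairs for the two ends of i0 that share an interval are equal by [rel_tri], and the quantity
    cannot vanish at both ends as it changes by 1. For disjoint pairs, eliminating [y0] writes
    [lo i] as a signed sum of three other vectors on T; then [comb3] contradicts [four_arith]. *)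
Let bad_excl : wd i0 = 2^-1 -> bad (lo i0) -> ~~ bad (hi i0).
Proof.
move=> d0 /badP[i [j [s [e [r E]]]]]; apply/negP=> /badP[k [l [s' [e' [r' E']]]]].
have e1 := rel_sqr r; have e1' := rel_sqr r'.
have [iW jW ij s1 rE] := r; have [kW lW kl s1' rE'] := r'.
have same a b : rel i j a b -> cc i - a * cc j - 2 * b * hi i0 0 u != 0.
  move=> rab; have [<- <-] := rel_uniq r rab; apply/eqP; move: E d0; rewrite /wd.
  by case: (sign_cases e1) => ->; lra.
have [ik|ik] := eqVneq i k.
  subst k; have jl : j = l.
    by apply: (rel_tri (rel_sym r) (rel_sym r')).
  by subst l; move/eqP: (same _ _ r').
have [il|il] := eqVneq i l.
  subst l; have jk : j = k by apply: (rel_tri (rel_sym r) r').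
  subst k; move/eqP: (same _ _ (rel_sym r')); apply; move: E'.
  by case: (sign_cases s1') => ->; lra.
have [jk|jk] := eqVneq j k.
  by subst k; rewrite (rel_tri r (rel_sym r')) eqxx in il.
have [jl|jl] := eqVneq j l.
  by subst l; rewrite (rel_tri r r') eqxx in ik.
pose f := e * e'.
have f1 : f * f = 1 by rewrite /f mulrACA e1 e1' mulr1.
have ff : f * e' = e by rewrite /f -mulrA e1' mulr1.
have Hall x xj xk xl : x = lo i \/ x = hi i -> xj = lo j \/ xj = hi j ->
   xk = lo k \/ xk = hi k -> xl = lo l \/ xl = hi l ->
   hv (x 0 u - s * xj 0 u - f * xk 0 u + f * s' * xl 0 u).
  move=> /(liftP iW)[xX xE] /(liftP jW)[xjX xjE] /(liftP kW)[xkX xkE] /(liftP lW)[xlX xlE].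
  have -> : x 0 u - s * xj 0 u - f * xk 0 u + f * s' * xl 0 u =
      x 0 u - s * xj 0 u - f * xk 0 u - ((- (f * s')) *: xl) 0 u by rewrite mxE; ring.
  apply: (comb3 tX iT uT) => //.
  - by apply: tm_sign => //; rewrite mulrNN mulrACA f1 s1' mulr1.
  - by apply: contra (l0 jW) => /eqTP H; apply/eqTP=> q qT; rewrite -(eqTP _ _ _ xjE) // H.
  - move=> c; apply/negP=> H.
    have : eqT T (lo k) (c *: lo j).
      apply/eqTP=> q qT; have := eqTP _ _ _ H q qT.
      by rewrite !mxE (eqTP _ _ _ xkE) // (eqTP _ _ _ xjE).
    move/(sim_mul iT (lX kW) (lX jW) (l0 kW)); apply/negP.
    by apply: vn (WV kW) (WV jW) _; rewrite eq_sym.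
  (* A dependence among [lo j], [lo k], [lo l] and the relation for k and l would make [lo j] and
     [lo k] proportional modulo [y0]. Then [rel] holds for j and k, which together with the pair i,
     j contradicts [rel_tri]. *)
  - move=> c d; apply/negP=> H.
    have {}H q : q \in T -> - (f * s') * lo l 0 q = c * lo j 0 q + d * lo k 0 q.
      move=> qT; have := eqTP _ _ _ H q qT.
      by rewrite !mxE (eqTP _ _ _ xlE) // (eqTP _ _ _ xkE) // (eqTP _ _ _ xjE).
    have H2 q : q \in T -> c * lo j 0 q = - (f + d) * lo k 0 q + e * y0 0 q.
      move=> qT; have := H q qT; have := eqTP _ _ _ rE' q qT; rewrite !mxE => kE lE.
      have : f * lo k 0 q = f * s' * lo l 0 q + e * y0 0 q.
        by rewrite kE mulrDr !mulrA ff.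
      lra.
    have [c0|c0] := eqVneq c 0.
      have [fd|fd] := eqVneq (f + d) 0.
        case/neqTP: y00 => q qT; rewrite mxE; apply/negP; rewrite negbK; apply/eqP.
        have := H2 q qT; rewrite c0 fd oppr0 !mul0r add0r => /esym.
        by case: (sign_cases e1) => ->; lra.
      case/negP: (notmul (e / (f + d)) kW); apply/eqTP=> q qT; rewrite mxE.
      by apply: (mulfI fd); have := H2 q qT; rewrite c0 mulrA mulrCA divff // mulr1; lra.
    have rjk : eqT T (lo j) (- ((f + d) / c) *: lo k + (e / c) *: y0).
      apply/eqTP=> q qT; apply: (mulfI c0); rewrite H2 // !mxE; field.
      by [].
    have [fd|fd] := eqVneq (f + d) 0.
      by case/negP: (notmul (e / c) jW); move: rjk; rewrite fd mul0r oppr0 scale0r add0r.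
    pose g := - ((f + d) / c).
    pose X' := pimg X.
    have [t tT yt] := intT_neq0 iT y0X y00.
    have iT' := intT_piv tX iT y0X tT yt.
    have jX : pimg X y0 t (piv y0 t (lo j)) by exists (lo j) => //; apply: lX.
    have kX : pimg X y0 t (piv y0 t (lo k)) by exists (lo k) => //; apply: lX.
    have jn : ~~ eqT (T :\ t) (piv y0 t (lo j)) 0.
      by apply/negP=> /(piv_eq0 tT yt); apply/negP; apply: notmul.
    have jk' : eqT (T :\ t) (piv y0 t (lo j)) (g *: piv y0 t (lo k)).
      rewrite -eqT_subr0 -linearZ -linearB; apply: (piv_eqT (a := e / c)) => //.
      apply/eqTP=> q qT; have := eqTP _ _ _ rjk q qT; rewrite !mxE /g; lra.
    have /simP[v v1 vE] := sim_mul iT' jX kX jn jk'.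
    have rv : rel j k v (y0 0 t * (lo j - v *: lo k) 0 t).
      split=> //; move: vE; rewrite -eqT_subr0 -linearZ -linearB => /(piv_eq0 tT yt) vE.
      by apply/eqTP=> q qT; have := eqTP _ _ _ vE q qT; rewrite !mxE; lra.
    by move: il ik; rewrite (rel_tri r (rel_sym rv)) eqxx.
  apply/eqTP=> q qT; rewrite !mxE (eqTP _ _ _ xE) // (eqTP _ _ _ xjE) // (eqTP _ _ _ xkE) //.
  rewrite (eqTP _ _ _ xlE) // (eqTP _ _ _ rE) // (eqTP _ _ _ rE') // !mxE -ff; ring.
have := i0max (WV iW); have := i0max (WV jW); have := i0max (WV kW); have := i0max (WV lW).
rewrite -!/(wd _) d0 => ml mk mj mi.
have di : wd i = 2^-1 by case: (wdP (WV iW)) mi => // ->; lra.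
have dj : wd j = 2^-1 by case: (wdP (WV jW)) mj => // ->; lra.
have dk : wd k = 2^-1 by case: (wdP (WV kW)) mk => // ->; lra.
have dl : wd l = 2^-1 by case: (wdP (WV lW)) ml => // ->; lra.
have lowi := or_introl erefl : lo i = lo i \/ lo i = hi i.
have highi := or_intror erefl : hi i = lo i \/ hi i = hi i.
have lift2 q a : wd q = 2^-1 -> a * a = 1 ->
    exists2 x, x = lo q \/ x = hi q & x 0 u = cc q / 2 + a / 4.
  rewrite /wd /cc => dq /sign_cases[]->; [exists (hi q)|exists (lo q)].
  - by right.
  - lra.
  - by left.
  - lra.
have g1 : (f * s') * (f * s') = 1 by rewrite mulrACA f1 s1' mulr1.
have Ns1 : (- s) * (- s) = 1 by rewrite mulrNN.
have Nf1 : (- f) * (- f) = 1 by rewrite mulrNN.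
have Ng1 : (- (f * s')) * (- (f * s')) = 1 by rewrite mulrNN.
have [xj jj xjE] := lift2 _ _ dj Ns1; have [xj' jj' xjE'] := lift2 _ _ dj s1.
have [xk kk xkE] := lift2 _ _ dk Nf1; have [xk' kk' xkE'] := lift2 _ _ dk f1.
have [xl ll xlE] := lift2 _ _ dl g1; have [xl' ll' xlE'] := lift2 _ _ dl Ng1.
have Ek : f * cc k - f * s' * cc l - 2 * e * hi i0 0 u = 0.
  have := congr1 (fun a => f * a) E'; rewrite mulr0 !mulrBr mulrA => <-.
  by rewrite -ff; ring.
exact: (four_arith s1 f1 g1 (sign_cases e1) di d0 xjE xjE' xkE xkE' xlE xlE' E Ek
  (hv_le1 (Hall _ _ _ _ highi jj kk ll)) (hv_le1 (Hall _ _ _ _ lowi jj' kk' ll'))).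
Qed.

(** A pivot at an end of a widest interval removes one column from T and that interval from V; its
    width, at most 1, pays for the column. The other intervals keep their widths. Those that fall
    together do so in pairs and, for the right choice of the end, without overlap, so [merge]
    applies. *)
Lemma width_step : (forall (X' : 'rV[R]_n -> Prop) T', tm X' -> intT T' X' -> u \notin T' ->
    (#|T'| < #|T|)%N -> forall (V' : {set I}) lo' hi',
    (forall i, i \in V' -> itv X' T' u (lo' i) (hi' i)) ->
    (forall i j, i \in V' -> j \in V' -> i != j -> ~~ sim T' (lo' i) (lo' j)) ->
    wsum u V' lo' hi' <= #|T'|%:R) ->
  wsum u V lo hi <= #|T|%:R.
Proof.
move=> IH.
have [y yy gy] : exists2 y, isy y & forall i j s e, rel i j s e -> gap i j s e y.
  have [d0|d0] := wdP i0V; first by exists (lo i0); [left|move=> *; apply: gap1 => //; left].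
  have [b|nb] := boolP (bad (lo i0)).
    exists (hi i0); first by right.
    by move=> *; apply: gap2 => //; [apply: bad_excl|right].
  by exists (lo i0); [left|move=> *; apply: gap2 => //; left].
have yX := isyX yy; have yE := isyE yy.
have yn : ~~ eqT T y 0.
  by apply: contra y00 => /eqTP H; apply/eqTP=> k kT; rewrite -(eqTP _ _ _ yE) ?H.
have [t tT yt] := intT_neq0 iT yX yn.
have tX' := tm_piv tX yX yt; have iT' := intT_piv tX iT yX tT yt.
have ut : u != t by apply: contraNneq uT => ->.
have uT' : u \notin T :\ t by rewrite !inE negb_and uT orbT.
have ltT : (#|T :\ t| < #|T|)%N by rewrite [ltnRHS](cardsD1 t) tT.
pose lo' i := piv y t (lo i); pose hi' i := piv y t (hi i).
have inX v : X v -> pimg X y t (piv y t v) by exists v.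
have relP i j s : i \in W -> j \in W -> i != j -> s * s = 1 ->
    eqT (T :\ t) (lo' i) (s *: lo' j) ->
    exists e, rel i j s e /\ eqT T (lo i - s *: lo j) (e *: y).
  move=> iW jW ij s1; rewrite -eqT_subr0 -linearZ -linearB => /(piv_eq0 tT yt) H.
  eexists; split; last exact: H.
  split=> //; apply/eqTP=> k kT; have := eqTP _ _ _ H k kT.
  by rewrite !mxE (eqTP _ _ _ yE k kT); lra.
have hlE i : i \in W -> eqT T (hi i - lo i) (0 *: y).
  move=> iW; apply/eqTP=> k kT.
  by rewrite !mxE (eqTP _ _ _ (itvE (vi (WV iW)))) // subrr mul0r.
have hlu i : i \in W -> hi' i 0 u - lo' i 0 u = hi i 0 u - lo i 0 u.
  move=> iW; have := piv_coord tT yt (hlE _ iW) ut.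
  by rewrite linearB mxE [X in _ + X]mxE => ->; rewrite !mxE; ring.
have mrg : wsum u W lo' hi' <= #|T :\ t|%:R.
  apply: (merge tX').
  - move=> V' lo1 hi1; exact: IH.
  - move=> i iW; split.
    + by apply: inX; apply: lX.
    + by apply: inX; apply: hX.
    + by rewrite -eqT_subr0 -linearB; apply: piv_eqT (hlE _ iW).
    + apply/negP=> /(piv_eq0 tT yt) H.
      case/negP: (notmul (y 0 t * lo i 0 t) iW); apply/eqTP=> k kT.
      by rewrite (eqTP _ _ _ H k kT) !mxE (eqTP _ _ _ yE k kT).
    + by rewrite -subr_gt0 hlu // subr_gt0; apply: itvd (vi (WV iW)).
  - move=> i j s iW jW ij s1 /(relP _ _ _ iW jW ij s1)[e [r E]].
    have := gy _ _ _ _ r; rewrite /gap /cc /wd !hlu //.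
    suff -> : lo' i 0 u + hi' i 0 u - s * (lo' j 0 u + hi' j 0 u) =
      lo i 0 u + hi i 0 u - s * (lo j 0 u + hi j 0 u) - 2 * e * y 0 u by [].
    have E' : eqT T (hi i - s *: hi j) (e *: y).
      apply/eqTP=> k kT; have := eqTP _ _ _ E k kT.
      by rewrite !mxE (eqTP _ _ _ (itvE (vi (WV iW)))) // (eqTP _ _ _ (itvE (vi (WV jW)))).
    have := piv_coord tT yt E ut; have := piv_coord tT yt E' ut.
    rewrite !linearB !linearZ -!/(lo' _) -!/(hi' _).
    set a := lo' i; set b := lo' j; set c := hi' i; set d := hi' j.
    by rewrite !mxE; lra.
  - move=> i j k iW jW kW ij ik jk /simP[s s1 sE]; apply/negP=> /simP[s' s1' sE'].
    have [e [r _]] := relP _ _ _ iW jW ij s1 sE.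
    have [e' [r' _]] := relP _ _ _ iW kW ik s1' sE'.
    by rewrite (rel_tri (rel_sym r) (rel_sym r')) eqxx in jk.
have -> : wsum u V lo hi = wd i0 + wsum u W lo hi.
  by rewrite /wsum (big_setD1 i0).
have -> : wsum u W lo hi = wsum u W lo' hi'.
  by apply: eq_bigr => i iW; rewrite hlu.
rewrite (cardsD1 t T) tT natrD lerD //=.
by case: (wdP i0V) => ->; lra.
Qed.

End Step.

(* A generalisation of Heller's bound on the number of three point lines through an element. *)
Theorem width_sum X T u (I : finType) (V : {set I}) (lo hi : I -> 'rV[R]_n) :
  tm X -> intT T X -> u \notin T ->
  (forall i, i \in V -> itv X T u (lo i) (hi i)) ->
  (forall i j, i \in V -> j \in V -> i != j -> ~~ sim T (lo i) (lo j)) ->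
  wsum u V lo hi <= #|T|%:R.
Proof.
have [m] := ubnP #|T|; elim: m => // m IH in X T V lo hi * => ltT tX iT uT vi vn.
have [->|[i iV]] := set_0Vmem V; first by rewrite /wsum big_set0.
have [i0 i0V i0m] := arg_maxP (fun i => hi i 0 u - lo i 0 u) iV.
apply: (@width_step X T u I V lo hi i0) => // X' T' tX' iT' uT' ltT' V' lo' hi'.
by apply: IH => //; apply: leq_trans ltT' _.
Qed.

End WidthSum.

(** * Fibres and Heller's bound *)

Section Fibers.
Variable R : realFieldType.
Variable n : nat.
Variable I : finType.
Implicit Types (X : 'rV[R]_n -> Prop) (T G : {set 'I_n}) (u t : 'I_n) (x : I -> 'rV[R]_n).
Implicit Types (L P : {set I}).

Lemma sim_refl T (v : 'rV[R]_n) : sim T v v.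
Proof. by apply/orP; left; apply/eqTP. Qed.

Lemma sim_sym T (v w : 'rV[R]_n) : sim T v w = sim T w v.
Proof.
by apply/simP/simP=> -[s s1 /eqTP E]; exists s => //; apply/eqTP=> k kT;
   rewrite mxE E // mxE mulrA s1 mul1r.
Qed.

Lemma sim_trans T (v w z : 'rV[R]_n) : sim T v w -> sim T w z -> sim T v z.
Proof.
move=> /simP[s s1 /eqTP E] /simP[e e1 /eqTP E']; apply/simP; exists (s * e).
  by rewrite mulrACA s1 e1 mulr1.
by apply/eqTP=> k kT; rewrite E // !mxE E' // mxE mulrA.
Qed.

Lemma leq_card_inj (F : finType) (A : {set I}) (f : I -> F) :
  {in A &, injective f} -> (#|A| <= #|F|)%N.
Proof. by move/card_in_imset<-; apply: max_card. Qed.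

(** [P] holds one index for each class, up to sign, of non-zero restrictions to T; [z q i] is [x i]
    with the sign that makes the members of [fib q] agree on T. Vectors that vanish on T are counted
    separately in [fibC]. *)
Record fibered X x L T P (fib : I -> {set I}) (z : I -> I -> 'rV[R]_n) : Prop := Fibered {
  fibPL : {subset P <= L};
  fib_sub : forall q i, i \in fib q -> i \in L;
  fib_pm : forall q i, i \in fib q -> z q i = x i \/ z q i = - x i;
  fib0 : forall q, q \in P -> fib q != set0;
  fibX : forall q i, i \in fib q -> X (z q i);
  fibE : forall q i j, i \in fib q -> j \in fib q -> eqT T (z q i) (z q j);
  fibn : forall q i, i \in fib q -> ~~ eqT T (z q i) 0;
  fibs : forall q r i j, q \in P -> r \in P -> q != r -> i \in fib q -> j \in fib r ->
     ~~ sim T (z q i) (z r j);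
  fibP : forall q r, q \in P -> r \in P -> q != r -> ~~ sim T (x q) (x r);
  fibPn : forall q, q \in P -> ~~ eqT T (x q) 0;
  fibC : (#|L| = #|[set i in L | eqT T (x i) 0]| + \sum_(q in P) #|fib q|)%N }.

Lemma fibered_exists X x L T : tm X -> (forall i, i \in L -> X (x i)) ->
  exists P fib z, fibered X x L T P fib z.
Proof.
move=> tX xX.
pose L1 := [set i in L | ~~ eqT T (x i) 0].
pose rep i := odflt i [pick j in L1 | sim T (x i) (x j)].
have L1L i : i \in L1 -> i \in L by rewrite inE => /andP[].
have repP i : i \in L1 -> rep i \in L1 /\ sim T (x i) (x (rep i)).
  move=> iL; rewrite /rep; case: pickP => [j /andP[] //|/(_ i)/=].
  by rewrite iL sim_refl.
have repE i j : sim T (x i) (x j) -> i \in L1 -> j \in L1 -> rep i = rep j.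
  move=> ij iL jL; rewrite /rep.
  have E : (fun k => (k \in L1) && sim T (x i) (x k)) =1
           (fun k => (k \in L1) && sim T (x j) (x k)).
    move=> k; congr (_ && _); apply/idP/idP; apply: sim_trans => //.
    by rewrite sim_sym.
  rewrite (eq_pick E); case: pickP => [//|/(_ j)/=]; by rewrite jL sim_refl.
pose P := rep @: L1.
pose fib q := [set i in L1 | rep i == q].
pose z q i := if eqT T (x i) (x q) then x i else - x i.
have fibL q i : i \in fib q -> i \in L1 by rewrite inE => /andP[].
have PP q : q \in P -> q \in L1.
  by case/imsetP=> i iL ->; case: (repP i iL).
have Prep q : q \in P -> rep q = q.
  by case/imsetP=> i iL ->; have [rL s] := repP i iL; rewrite -(repE i (rep i)).
have zq q i : i \in fib q -> eqT T (z q i) (x q).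
  rewrite inE => /andP[iL /eqP riq]; have [_ s] := repP i iL; rewrite riq in s.
  rewrite /z; case: ifP => // nE; move: s; rewrite /sim nE /= => /eqTP H.
  by apply/eqTP=> k kT; rewrite mxE H // mxE opprK.
have zpm q i : z q i = x i \/ z q i = - x i by rewrite /z; case: ifP; [left|right].
have qL q i : i \in fib q -> q \in L1.
  by rewrite inE => /andP[iL /eqP<-]; case: (repP i iL).
exists P, fib, z; split.
- by move=> q /PP/L1L.
- by move=> q i /fibL/L1L.
- by move=> q i _.
- move=> q qP; apply/set0Pn; exists q; rewrite inE (PP q qP) /=; exact/eqP/Prep.
- move=> q i /fibL/L1L/xX iX; case: (zpm q i) => -> //; exact: tmN.
- by move=> q i j /zq/eqTP H /zq/eqTP H'; apply/eqTP=> k kT; rewrite H ?H'.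
- move=> q i iq; have := qL _ _ iq; rewrite inE => /andP[_]; apply: contra => /eqTP H.
  by apply/eqTP=> k kT; rewrite -(eqTP _ _ _ (zq _ _ iq)) // H.
- move=> q r i j qP rP qr iq jr; apply: contra qr => s.
  rewrite -(Prep q qP) -(Prep r rP); apply/eqP/repE; rewrite ?PP //.
  apply: sim_trans (sim_trans _ s) _; last by apply/orP; left; apply: zq.
  by rewrite sim_sym; apply/orP; left; apply: zq.
- move=> q r qP rP; apply: contra => s.
  by rewrite -(Prep q qP) -(Prep r rP); apply/eqP/repE; rewrite ?PP.
- by move=> q /PP; rewrite inE => /andP[].
rewrite -(cardsID [set i | eqT T (x i) 0] L); congr (_ + _)%N.
  by apply: eq_card => i; rewrite !inE.
rewrite -[LHS]sum1_card (eq_bigl (mem L1)) => [|i]; last by rewrite !inE andbC.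
rewrite (partition_big_imset rep) /=; apply: eq_bigr => q _.
by rewrite -sum1_card; apply: eq_bigl => i; rewrite [RHS]inE.
Qed.

Lemma fiber_width X T u P (fib : I -> {set I}) (z : I -> I -> 'rV[R]_n) :
  tm X -> intT T X -> u \notin T ->
  (forall q, q \in P -> fib q != set0) ->
  (forall q i, i \in fib q -> X (z q i)) ->
  (forall q i j, i \in fib q -> j \in fib q -> eqT T (z q i) (z q j)) ->
  (forall q i, i \in fib q -> ~~ eqT T (z q i) 0) ->
  (forall q r i j, q \in P -> r \in P -> q != r -> i \in fib q -> j \in fib r ->
     ~~ sim T (z q i) (z r j)) ->
  exists lo hi : I -> I,
   (forall q, q \in P -> [/\ lo q \in fib q, hi q \in fib q
      & forall i, i \in fib q -> z q (lo q) 0 u <= z q i 0 u <= z q (hi q) 0 u]) /\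
   \sum_(q in P) (z q (hi q) 0 u - z q (lo q) 0 u) <= #|T|%:R.
Proof.
move=> tX iT uT f0 fX fE fn fs.
have /fin_all_exists2[lo loP loM] : forall q : I, exists2 l, q \in P -> l \in fib q &
    q \in P -> forall i, i \in fib q -> z q l 0 u <= z q i 0 u.
  move=> q; have [qP|qP] := boolP (q \in P); last by exists q.
  have /set0Pn[i ifq] := f0 q qP.
  by have [l lf lm] := arg_minP (fun i => z q i 0 u) ifq; exists l.
have /fin_all_exists2[hi hiP hiM] : forall q : I, exists2 l, q \in P -> l \in fib q &
    q \in P -> forall i, i \in fib q -> z q i 0 u <= z q l 0 u.
  move=> q; have [qP|qP] := boolP (q \in P); last by exists q.
  have /set0Pn[i ifq] := f0 q qP.
  by have [l lf lm] := arg_maxP (fun i => z q i 0 u) ifq; exists l.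
exists lo, hi; split.
  by move=> q qP; split; rewrite ?loP ?hiP // => i iq; rewrite loM ?hiM.
(* Fibres of width 0 form no interval; they contribute nothing to the sum. *)
pose V := [set q in P | z q (lo q) 0 u < z q (hi q) 0 u].
have VP q : q \in V -> q \in P by rewrite inE => /andP[].
have -> : \sum_(q in P) (z q (hi q) 0 u - z q (lo q) 0 u) =
   wsum u V (fun q => z q (lo q)) (fun q => z q (hi q)).
  rewrite /wsum (bigID (fun q => z q (lo q) 0 u < z q (hi q) 0 u)) /=.
  rewrite [X in _ + X]big1 ?addr0 => [|q /andP[qP]].
    by apply: eq_bigl => q; rewrite inE.
  by rewrite -leNgt => le; apply/eqP; rewrite subr_eq0 eq_le le loM ?hiP.
apply: (width_sum tX iT uT) => [q qV|q r qV rV qr].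
  have qP := VP q qV; split; rewrite ?fX ?fn ?fE ?loP ?hiP //.
  - by apply: fX; apply: loP.
  - by apply: fX; apply: hiP.
  - by move: qV; rewrite inE => /andP[].
exact: fs (VP _ qV) (VP _ rV) qr (loP _ (VP _ qV)) (loP _ (VP _ rV)).
Qed.

(** Without a column t of T the fibres have at most two members, hence at most 1 + width, and at
    most one vector vanishes on the rest. With m = |T| - 1 the induction closes by C(m+2, 2) =
    C(m+1, 2) + m + 1. *)
Lemma heller X T x L : tm X -> intT T X -> (forall i, i \in L -> X (x i)) ->
  (forall i, i \in L -> ~~ eqT T (x i) 0) ->
  (forall i j, i \in L -> j \in L -> i != j -> ~~ sim T (x i) (x j)) ->
  (#|L| <= 'C(#|T|.+1, 2))%N.
Proof.
have [m] := ubnP #|T|; elim: m => // m IH in T L * => ltT tX iT xX x0 xs.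
have [T0|[t tT]] := set_0Vmem T.
  suff -> : L = set0 by rewrite cards0.
  apply/setP=> i; rewrite inE; apply/negP=> /x0/negP; apply.
  by apply/eqTP=> k; rewrite T0 inE.
pose T' := T :\ t.
have cT : #|T| = #|T'|.+1 by rewrite (cardsD1 t) tT.
have iT' : intT T' X by move=> v vX j; rewrite !inE => /andP[_]; apply: iT.
have tT' : t \notin T' by rewrite !inE eqxx.
have [P [fib [z F]]] := fibered_exists T' tX xX.
have [lo [hi [lhP wle]]] := fiber_width tX iT' tT' (fib0 F) (fibX F) (fibE F) (fibn F) (fibs F).
have eqTt (v w : 'rV[R]_n) : eqT T' v w -> v 0 t = w 0 t -> eqT T v w.
  move=> /eqTP H Ht; apply/eqTP=> k kT; have [->//|kt] := eqVneq k t.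
  by apply: H; rewrite !inE kt.
have c0 : (#|[set i in L | eqT T' (x i) 0]| <= 1)%N.
  apply/card_le1_eqP => i j; rewrite !inE => /andP[iL i0] /andP[jL j0].
  have [//|ij] := eqVneq i j; case/negP: (xs _ _ iL jL ij).
  have vt v : v \in L -> eqT T' (x v) 0 -> x v 0 t * x v 0 t = 1.
    move=> vL v0; apply: iv_sqr; first exact: iT (xX v vL) _ tT.
    by apply: contra (x0 _ vL) => /eqP vt; apply: eqTt => //; rewrite vt mxE.
  apply/simP; exists (x i 0 t * x j 0 t).
    by rewrite mulrACA !vt ?mulr1.
  apply: eqTt; first by apply/eqTP=> k kT; rewrite (eqTP _ _ _ i0 k kT) !mxE (eqTP _ _ _ j0 k kT) mxE mulr0.
  by rewrite mxE -mulrA vt ?mulr1.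
have cP : (#|P| <= 'C(#|T'|.+1, 2))%N.
  apply: IH => //.
  - by rewrite cT ltnS in ltT.
  - by move=> q /(fibPL F)/xX.
  - exact: fibPn F.
  - exact: fibP F.
have cf q : q \in P -> #|fib q|%:R <= 1 + (z q (hi q) 0 t - z q (lo q) 0 t).
  move=> qP; have [lq hq lh] := lhP q qP.
  have inj : {in fib q &, forall i j, z q i 0 t = z q j 0 t -> i = j}.
    move=> i j iq jq zt; have [//|ij] := eqVneq i j.
    case/negP: (xs _ _ (fib_sub F iq) (fib_sub F jq) ij).
    have := eqTt _ _ (fibE F iq jq) zt => /eqTP E.
    case: (fib_pm F iq) => zi; case: (fib_pm F jq) => zj; rewrite zi zj in E; apply/orP.
    - by left; apply/eqTP=> k kT; rewrite E.
    - by right; apply/eqTP=> k kT; rewrite E.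
    - by right; apply/eqTP=> k kT; rewrite mxE -E // mxE opprK.
    - by left; apply/eqTP=> k kT; have := E k kT; rewrite !mxE => /oppr_inj.
  have izt i : i \in fib q -> iv (z q i 0 t) by move=> iq; apply: iT (fibX F iq) _ tT.
  have hvt i j : i \in fib q -> j \in fib q -> hv (z q j 0 t - z q i 0 t).
    move=> iq jq; apply: (two_term tX iT' tT' (fibX F iq) (fibX F jq) (fibn F iq)).
    exact: (fibE F jq iq).
  have le2 : (#|fib q| <= 2)%N.
    rewrite -card_bool; apply: (leq_card_inj (f := fun i => z q i 0 t == z q (lo q) 0 t)).
    have up i : i \in fib q -> z q i 0 t != z q (lo q) 0 t -> z q i 0 t = z q (lo q) 0 t + 1.
      move=> iq; have := lh i iq; have := hvt _ _ lq iq; move: (izt i iq) (izt _ lq).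
      by case/ivP=> ->; case/ivP=> -> /hv_le1 h1 h2 /eqP; lra.
    move=> i j iq jq /= E; apply: inj => //; move: E.
    case: eqP => [->|/eqP/up->//]; case: eqP => [->//|/eqP/up->//].
  have [zz|zz] := eqVneq (z q (hi q) 0 t) (z q (lo q) 0 t).
    rewrite zz subrr addr0 (ler_nat _ _ 1); apply/card_le1_eqP=> i j iq jq; apply: inj => //.
    by have := lh i iq; have := lh j jq; rewrite zz => /andP[? ?] /andP[? ?]; lra.
  apply: (@le_trans _ _ 2%:R); first by rewrite ler_nat.
  have := lh _ hq; move: (izt _ hq) (izt _ lq) zz.
  by case/ivP=> ->; case/ivP=> -> /eqP; lra.
have s1 : (\sum_(q in P) #|fib q|)%:R <= #|P|%:R + #|T'|%:R :> R.
  rewrite natr_sum -[#|P|]sum1_card natr_sum.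
  apply: le_trans (_ : _ <= \sum_(q in P) (1 + (z q (hi q) 0 t - z q (lo q) 0 t))) _.
    by apply: ler_sum => q; apply: cf.
  by rewrite big_split lerD.
rewrite -natrD ler_nat in s1.
rewrite (fibC F) cT binS bin1; move: cP c0 s1; lia.
Qed.

(** An entry has one of five values, whence the base 5. *)
Lemma crude X G x L : tm X -> (forall i, i \in L -> X (x i)) ->
  {in L &, forall i j, eqT G (x i) (x j) -> i = j} -> (#|L| <= 5 ^ #|G|)%N.
Proof.
move=> tX xX inj.
pose code (a : R) : 'I_5 :=
  if a == 0 then inord 0 else if a == 1 then inord 1 else if a == -1 then inord 2 else
  if a == 2^-1 then inord 3 else inord 4.
have codeI a b : hv a -> hv b -> code a = code b -> a = b.
  have E m : (m < 5)%N -> (inord m : 'I_5) = m :> nat by move=> ?; rewrite inordK.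
  have n1 : (1 : R) != 0 by apply: oner_neq0.
  have ne (c d : R) : (c < d) || (d < c) -> (c == d) = false by case/orP=> h; rewrite ?(lt_eqF h) ?(gt_eqF h).
  rewrite /code => /hvP[]-> /hvP[]->; rewrite ?eqxx;
  rewrite ?(ne 0 1) ?(ne 1 0) ?(ne 0 (-1)) ?(ne (-1) 0) ?(ne 1 (-1)) ?(ne (-1) 1)
    ?(ne 2^-1 0) ?(ne 2^-1 1) ?(ne 2^-1 (-1)) ?(ne (- 2^-1) 0) ?(ne (- 2^-1) 1)
    ?(ne (- 2^-1) (-1)) ?(ne (- 2^-1) 2^-1) //;
  try by [move/(congr1 val); rewrite /= !E]; apply/orP; lra.
pose f i : {ffun 'I_n -> 'I_5} := [ffun j => if j \in G then code (x i 0 j) else ord0].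
have fI : {in L &, injective f}.
  move=> i j iL jL /ffunP E; apply: inj => //; apply/eqTP=> k kG.
  have := E k; rewrite !ffunE kG; apply: codeI; exact: tm_entry tX (xX _ _).
rewrite -(card_in_imset fI) -[X in (X ^ _)%N](card_ord 5) -(card_pffun_on ord0).
apply: subset_leq_card; apply/subsetP=> _ /imsetP[i _ ->].
apply/pffun_onP; split=> [|y _ //].
by apply/subsetP=> j; rewrite inE ffunE; case: ifP => //; rewrite eqxx.
Qed.

End Fibers.

(** * Odd columns *)

Section OddColumns.
Variable R : realFieldType.
Implicit Types a b : R.

Definition zint a := exists k : int, a = k%:~R.

Lemma zintD a b : zint a -> zint b -> zint (a + b).
Proof. by case=> k -> [l ->]; exists (k + l); rewrite intrD. Qed.

Lemma zintN a : zint a -> zint (- a).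
Proof. by case=> k ->; exists (- k); rewrite mulrNz. Qed.

Lemma zintB a b : zint a -> zint b -> zint (a - b).
Proof. by move=> za /zintN; apply: zintD. Qed.

Lemma zintM a b : zint a -> zint b -> zint (a * b).
Proof. by case=> k -> [l ->]; exists (k * l); rewrite intrM. Qed.

Lemma zint0 : zint 0. Proof. by exists 0. Qed.

Lemma iv_zint a : iv a -> zint a.
Proof. by case/ivP=> ->; [exists 0|exists 1|exists (-1)]. Qed.

Lemma half_zintF : ~ zint 2^-1.
Proof.
case=> k kE; have : (k * 2)%:~R = 1%:~R :> R by rewrite intrM -kE mulVf // pnatr_eq0.
by move/intr_inj; lia.
Qed.

Lemma hv_zint a : hv a -> zint a -> iv a.
Proof.
case/orP=> // /hfP[]-> H; first by case: half_zintF.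
by case: half_zintF; rewrite -[2^-1]opprK; apply: zintN.
Qed.

Lemma zint_iv a b : hv b -> zint (a - b) -> iv a -> iv b.
Proof.
move=> hb zab /iv_zint za; apply: hv_zint => //.
have -> : b = a - (a - b) by ring.
exact: zintB.
Qed.

Lemma hv_zint2 a : hv a -> zint (2 * a).
Proof.
by case/hvP=> ->; [exists 0|exists 2|exists (-2)|exists 1|exists (-1)]; lra.
Qed.

Lemma hf_zint2 a b : hf a -> zint (2 * a * b) -> zint b.
Proof.
case/hfP=> ->; first by rewrite divff ?mul1r ?pnatr_eq0.
by move=> /zintN; rewrite mulrN divff ?pnatr_eq0 // mulNr mul1r opprK.
Qed.

Variable n : nat.
Implicit Types (X : 'rV[R]_n -> Prop) (S T : {set 'I_n}) (x v w : 'rV[R]_n).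

(** The second clause encodes that on S a vector is either integral or half-integral throughout. *)
Definition oddon X S :=
  (forall x, X x -> forall j, j \notin S -> iv (x 0 j)) /\
  (forall x, X x -> forall i j, i \in S -> j \in S -> zint (x 0 i - x 0 j)).

(** Twice a 2 by 2 minor of [w] and [x] is an integer. With one entry of [w] equal to +-1/2, this
    makes [x] integral where [w] is, and it makes differences of entries of [x] integral between two
    columns where [w] is half-integral. *)
Lemma odd_of X w (a : 'I_n) : tm X -> X w -> hf (w 0 a) -> oddon X [set j | hf (w 0 j)].
Proof.
move=> tX wX wa; split=> x xX.
  move=> j; rewrite inE => wj.
  have ja : a != j by apply: contraNneq wj => <-.
  have wji : iv (w 0 j) by have := tm_entry j tX wX; rewrite /hv (negPf wj) orbF.
  apply: hv_zint; first exact: (tm_entry _ tX xX).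
  apply: (hf_zint2 wa).
  have -> : 2 * w 0 a * x 0 j = 2 * (w 0 a * x 0 j - w 0 j * x 0 a) + w 0 j * (2 * x 0 a) by ring.
  apply: zintD; first by apply: hv_zint2; apply: (tm_det2 tX wX xX ja).
  by apply: zintM; [exact: iv_zint|apply: hv_zint2; exact: (tm_entry _ tX xX)].
move=> i j; rewrite !inE => wi wj.
have [->|ij] := eqVneq i j; first by rewrite subrr; apply: zint0.
have := hv_zint2 (tm_det2 tX wX xX ij).
have := hv_zint2 (tm_entry j tX xX).
case/hfP: wi => ->; case/hfP: wj => -> h1 h2.
- have -> : x 0 i - x 0 j = - (2 * (2^-1 * x 0 j - 2^-1 * x 0 i)) by lra.
  exact: zintN.
- have -> : x 0 i - x 0 j = 2 * (2^-1 * x 0 j - - 2^-1 * x 0 i) - 2 * x 0 j by lra.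
  exact: zintB.
- have -> : x 0 i - x 0 j = - (2 * (- 2^-1 * x 0 j - 2^-1 * x 0 i)) - 2 * x 0 j by lra.
  by apply: zintB => //; apply: zintN.
have -> : x 0 i - x 0 j = 2 * (- 2^-1 * x 0 j - - 2^-1 * x 0 i) by lra.
by [].
Qed.

Lemma odd_iv X S x i j : tm X -> oddon X S -> X x -> i \in S -> j \in S -> iv (x 0 i) = iv (x 0 j).
Proof.
move=> tX [_ oS] xX iS jS; apply/idP/idP; apply: zint_iv; try exact: (tm_entry _ tX xX); exact: oS.
Qed.

Lemma hf_iv a : hv a -> hf a = ~~ iv a.
Proof. by case/orP=> h; rewrite ?h ?(negPf (ivNhf h)) //; apply/esym; apply: contraL h => /ivNhf. Qed.

Lemma odd_hf X S x i j : tm X -> oddon X S -> X x -> i \in S -> j \in S -> hf (x 0 i) -> hf (x 0 j).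
Proof.
move=> tX oS xX iS jS; rewrite !hf_iv ?(tm_entry _ tX xX) //.
by rewrite (odd_iv tX oS xX iS jS).
Qed.

Variable I : finType.
Implicit Types (L P : {set I}).

Definition nonpar (x : I -> 'rV[R]_n) L :=
  (forall i, i \in L -> x i != 0) /\
  (forall i j, i \in L -> j \in L -> i != j -> forall c, x i != c *: x j).

Lemma fib_inj X (x : I -> 'rV[R]_n) L T P fib z q : fibered X x L T P fib z -> nonpar x L ->
  {in fib q &, injective (z q)}.
Proof.
move=> F [_ np] i j iq jq zE; have [//|ij] := eqVneq i j.
have := np _ _ (fib_sub F iq) (fib_sub F jq) ij.
case: (fib_pm F iq) => zi; case: (fib_pm F jq) => zj; rewrite zi zj in zE.
- by move=> /(_ 1); rewrite scale1r zE eqxx.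
- by move=> /(_ (-1)); rewrite scaleN1r zE eqxx.
- by move=> /(_ (-1)); rewrite scaleN1r -zE opprK eqxx.
- by move=> /(_ 1); rewrite scale1r -[x i]opprK zE opprK eqxx.
Qed.

Lemma nonpar_lin (f : {linear 'rV[R]_n -> 'rV[R]_n}) (x : I -> 'rV[R]_n) L :
  (forall v, f v = 0 -> v = 0) -> nonpar x L -> nonpar (fun i => f (x i)) L.
Proof.
move=> f0 [x0 np]; split=> [i iL|i j iL jL ij c].
  by apply: contra (x0 _ iL) => /eqP/f0->.
apply: contra (np _ _ iL jL ij c) => /eqP E; rewrite -subr_eq0; apply/eqP/f0.
by rewrite linearB linearZ E subrr.
Qed.

Lemma piv_inj0 x j v : x 0 j * x 0 j = 1 -> piv x j v = 0 -> v = 0.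
Proof.
move=> xj /rowP E; have vj : v 0 j = 0.
  have := E j; rewrite /piv !mxE eqxx mulrBr mulr1 mulrAC xj mul1r opprB addrCA subrr addr0.
  by move=> h; rewrite -[v 0 j]mul1r -xj -mulrA h mulr0.
by apply/rowP=> k; have := E k; rewrite piv_id.
Qed.

Definition phi m := ('C(m + 2, 2) - 2)%N.

(** Form without division; at m = 0 the subtraction in [phi] is truncated. *)
Lemma phiE m : ((phi m).*2 + 4 = m.+2 * m.+1 \/ m = 0)%N.
Proof.
have := mul_bin_left m.+2 1; rewrite !bin1 /= subn1 /phi addn2; nia.
Qed.

End OddColumns.

(** * Fibres as subsets of small grids and cubes *)

Section Counting.
Variable I : finType.
Implicit Types A : {set I}.

Definition occ (F : eqType) A (f : I -> F) c := [exists i in A, f i == c].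

Lemma occP (F : eqType) A (f : I -> F) c : reflect (exists2 i, i \in A & f i = c) (occ A f c).
Proof. exact: 'exists_in_eqP. Qed.

Lemma card_occ (F : finType) A (f : I -> F) :
  {in A &, injective f} -> #|A| = (\sum_c occ A f c)%N.
Proof.
move/card_in_imset<-; rewrite -sum1_card big_mkcond; apply: eq_bigr => c _.
suff -> : occ A f c = (c \in f @: A) by case: ifP.
by apply/occP/imsetP=> -[i iA E]; exists i => //; rewrite E.
Qed.

Lemma card_grid9 A (o1 o2 : I -> nat) : (forall i, i \in A -> o1 i < 3)%N ->
  (forall i, i \in A -> o2 i < 3)%N ->
  {in A &, forall i j, o1 i = o1 j -> o2 i = o2 j -> i = j} ->
  let p a b := occ A (fun i => (o1 i, o2 i)) (a, b) in
  (#|A| = p 0 0 + p 0 1 + p 0 2 + (p 1 0 + p 1 1 + p 1 2) + (p 2 0 + p 2 1 + p 2 2))%N.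
Proof.
move=> l1 l2 inj p.
pose f i : 'I_3 * 'I_3 := (inord (o1 i), inord (o2 i)).
have fI : {in A &, injective f}.
  move=> i j iA jA [/(congr1 val) E1 /(congr1 val) E2].
  by move: E1 E2; rewrite /= !inordK ?l1 ?l2 //; apply: inj.
rewrite (card_occ fI).
have E (c : 'I_3 * 'I_3) : occ A f c = p (val c.1) (val c.2).
  apply/occP/occP => -[i iA E]; exists i => //.
    by rewrite -E /= !inordK ?l1 ?l2.
  by case: E => E1 E2; rewrite /f E1 E2 !inord_val; case: (c).
rewrite (eq_bigr (fun c : 'I_3 * 'I_3 => p (val c.1) (val c.2) : nat)) => [|c _]; last by rewrite E.
rewrite -(pair_bigA _ (fun a b : 'I_3 => p (val a) (val b) : nat)) /=.
by rewrite !(big_ord_recr, big_ord0) /= !add0n.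
Qed.

(** The cells are offsets, in half steps, from the minima in two odd columns: the first row and the
    first column are met, and only cells of one parity occur. The right-hand side contains the
    widths in half steps. The inequality fails only for the four corners together with the centre,
    which the left alternative covers. *)
Lemma grid9 (p00 p01 p02 p10 p11 p12 p20 p21 p22 : bool) :
  [|| p00, p01 | p02] -> [|| p00, p10 | p20] ->
  ~~ ([|| p00, p02, p11, p20 | p22] && [|| p01, p10, p12 | p21]) ->
  [&& p00, p02, p20 & p22] \/
  (4 * (p00 + p01 + p02 + (p10 + p11 + p12) + (p20 + p21 + p22)) <=
   4 + 3 * ((if [|| p20, p21 | p22] then 2 else [|| p10, p11 | p12] : nat) +
            (if [|| p02, p12 | p22] then 2 else [|| p01, p11 | p21] : nat)))%N.
Proof.
by case: p00; case: p01; case: p02; case: p10; case: p11; case: p12;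
   case: p20; case: p21; case: p22 => //= _ _ _; first [by left|by right].
Qed.

Lemma card_cube A (f : I -> bool * bool * bool) : {in A &, injective f} ->
  let p a b c := occ A f (a, b, c) in
  (#|A| = p false false false + p false false true + (p false true false + p false true true) +
    (p true false false + p true false true + (p true true false + p true true true)))%N.
Proof.
move=> fI p; rewrite (card_occ fI).
rewrite (eq_bigr (fun c => p c.1.1 c.1.2 c.2 : nat)) => [|[[a b] c] _] //.
rewrite -(pair_bigA _ (fun ab c => p ab.1 ab.2 c : nat)) /=.
rewrite -(pair_bigA _ (fun a b => (\sum_c p a b c)%N)) /=.
by rewrite !big_bool /=; lia.
Qed.

(** No two antipodal vertices occur. [m] and [M] are the extreme coordinate sums; [M - m] accounts
    for a fourth direction, because the three coordinates used in [cube_bound] add up to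
    [2 * v 0 e]. *)
Lemma cube (p000 p001 p010 p011 p100 p101 p110 p111 : bool) :
  ~~ (p000 && p111) -> ~~ (p001 && p110) -> ~~ (p010 && p101) -> ~~ (p100 && p011) ->
  [|| p000, p001, p010 | p011] -> [|| p000, p001, p100 | p101] -> [|| p000, p010, p100 | p110] ->
  exists m M : nat, [/\
   [|| (m == 0) && p000, (m == 1) && [|| p001, p010 | p100],
      (m == 2) && [|| p011, p101 | p110] | (m == 3) && p111]%N,
   [|| (M == 0) && p000, (M == 1) && [|| p001, p010 | p100],
      (M == 2) && [|| p011, p101 | p110] | (M == 3) && p111]%N
   & (4 * (p000 + p001 + (p010 + p011) + (p100 + p101 + (p110 + p111))) <=
    4 + 3 * ([|| p100, p101, p110 | p111] + [|| p010, p011, p110 | p111] +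
             [|| p001, p011, p101 | p111] + (M - m)))%N].
Proof.
by case: p000; case: p001; case: p010; case: p011; case: p100; case: p101;
   case: p110; case: p111 => //= _ _ _ _ _ _ _;
   first [by exists 0%N, 0%N | by exists 0%N, 1%N | by exists 0%N, 2%N | by exists 0%N, 3%N
     | by exists 1%N, 1%N | by exists 1%N, 2%N | by exists 1%N, 3%N | by exists 2%N, 2%N
     | by exists 2%N, 3%N | by exists 3%N, 3%N].
Qed.

End Counting.

(** * One or two odd columns *)

Lemma bin2_double m : (('C(m.+1, 2)).*2 = m.+1 * m)%N.
Proof. by have := mul_bin_left m.+1 1; rewrite !bin1 /= subn1; nia. Qed.

(** There is no slack: [phi n] exceeds C(t+1, 2) by exactly 2t + 1 here, and by exactly 3t + 4 in
    [phi2_ge]. *)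
Lemma phi1_ge n t c p f : (n = t.+1 -> c <= 1 -> p <= 'C(t.+1, 2) -> f <= p + 2 * t ->
  c + f <= phi n)%N.
Proof. by move=> -> ? ? ?; have := bin2_double t; have := phiE t.+1; nia. Qed.

Lemma phi2_ge n t c p f : (n = t.+2 -> c <= 4 -> p <= 'C(t.+1, 2) -> f <= p + 3 * t ->
  c + f <= phi n)%N.
Proof. by move=> -> ? ? ?; have := bin2_double t; have := phiE t.+2; nia. Qed.

(** [phi n] exceeds C(t+1, 2) by 4t + 8, so a slack of t/4 + 8 has to absorb the 5^3 = 125 vectors
    that may be supported on three columns; n >= 500 is enough. *)
Lemma phi3_ge n t c p f : (n = t.+3 -> 500 <= n -> c <= 125 -> p <= 'C(t.+1, 2) ->
  4 * f <= 4 * p + 15 * t -> c + f <= phi n)%N.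
Proof. by move=> -> ? ? ? ?; have := bin2_double t; have := phiE t.+3; nia. Qed.

Section SmallOdd.
Variable R : realFieldType.
Variable n : nat.
Variable I : finType.
Implicit Types (X : 'rV[R]_n -> Prop) (T S : {set 'I_n}) (u t e b : 'I_n) (x : I -> 'rV[R]_n).
Implicit Types (L P : {set I}).

Lemma odd_intT X S : oddon X S -> intT (~: S) X.
Proof. by case=> oS _ x xX j; rewrite inE => /(oS _ xX). Qed.

(** [f] stands for a change of basis that fixes the coordinates in T. It lets a functional that is
    not a coordinate in X serve as a direction. *)
Lemma fib_width X X' x L T P fib z (f : 'rV[R]_n -> 'rV[R]_n) u :
  fibered X x L T P fib z -> tm X' -> intT T X' -> u \notin T ->
  (forall v, X v -> X' (f v)) -> (forall v k, k \in T -> f v 0 k = v 0 k) ->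
  (forall q i j, i \in fib q -> j \in fib q -> hv (f (z q i) 0 u - f (z q j) 0 u)) /\
  exists lo hi : I -> I,
   (forall q, q \in P -> [/\ lo q \in fib q, hi q \in fib q
      & forall i, i \in fib q -> f (z q (lo q)) 0 u <= f (z q i) 0 u <= f (z q (hi q)) 0 u]) /\
   \sum_(q in P) (f (z q (hi q)) 0 u - f (z q (lo q)) 0 u) <= #|T|%:R.
Proof.
move=> F tX' iT' uT fX fT.
have fE v w : eqT T (f v) (f w) = eqT T v w.
  by apply/eqTP/eqTP=> H k kT; have := H k kT; rewrite !fT.
have fE0 v : eqT T (f v) 0 = eqT T v 0.
  by apply/eqTP/eqTP=> H k kT; have := H k kT; rewrite !fT.
have fS v w : sim T (f v) (f w) = sim T v w.
  by apply/simP/simP=> -[s s1 /eqTP H]; exists s => //; apply/eqTP=> k kT;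
     have := H k kT; rewrite !mxE !fT.
split=> [q i j iq jq|].
  apply: (two_term tX' iT' uT); rewrite ?fE ?fE0 ?(fibn F jq) ?(fibE F iq jq) //.
    exact: fX (fibX F jq).
  exact: fX (fibX F iq).
apply: (@fiber_width _ _ _ X' T u P fib (fun q i => f (z q i)) tX' iT' uT (fib0 F)).
- by move=> q i /(fibX F)/fX.
- by move=> q i j iq jq; rewrite fE (fibE F iq jq).
- by move=> q i iq; rewrite fE0 (fibn F iq).
- by move=> q r i j qP rP qr iq jr; rewrite fS (fibs F qP rP qr iq jr).
Qed.

Lemma fib_reps X x L T P fib z : tm X -> intT T X -> (forall i, i \in L -> X (x i)) ->
  fibered X x L T P fib z -> (#|P| <= 'C(#|T|.+1, 2))%N.
Proof.
move=> tX iT xX F; apply: (heller (x := x) tX iT) => [q qP|q qP|q r qP rP qr].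
- by apply: xX; apply: (fibPL F).
- exact: (fibPn F qP).
- exact: (fibP F qP rP qr).
Qed.

(** Offset in half steps; the last branch is meant for the value 1. *)
Definition off (a : R) : nat := if a == 0 then 0 else if a == 2^-1 then 1 else 2.

Lemma offE a : hv a -> 0 <= a -> (off a)%:R = 2 * a.
Proof.
have h0 : (2^-1 == 0 :> R) = false by rewrite invr_eq0 pnatr_eq0.
have h1 : (1 == 2^-1 :> R) = false by apply/eqP; lra.
by rewrite /off; case/hvP=> ->; rewrite ?eqxx ?oner_eq0 ?h0 ?h1; lra.
Qed.

Lemma off_lt3 a : (off a < 3)%N.
Proof. by rewrite /off; do 2?case: ifP. Qed.

Lemma off_inj a c : hv a -> hv c -> 0 <= a -> 0 <= c -> off a = off c -> a = c.
Proof. by move=> ha hc a0 c0 /(congr1 (fun m => m%:R : R)); rewrite !offE //; lra. Qed.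

(** The members of a fibre over the complement of u have different entries at u, spaced in half
    steps, so a fibre of width w has at most 1 + 2w of them. *)
Lemma odd1_bound X u x L : tm X -> oddon X [set u] -> (forall i, i \in L -> X (x i)) ->
  nonpar x L -> (#|L| <= phi n)%N.
Proof.
move=> tX oX xX np; pose T := ~: [set u].
have iT : intT T X := odd_intT oX.
have uT : u \notin T by rewrite !inE eqxx.
have cT : (n = #|T|.+1)%N by have := cardsC1 u; rewrite card_ord /T; have := ltn_ord u; lia.
have [P [fib [z F]]] := fibered_exists T tX xX.
have [hvz [lo [hi [lhP wle]]]] := fib_width F tX iT uT (fun _ h => h) (fun _ _ _ => erefl).
have cP := fib_reps tX iT xX F.
have full (v w : 'rV[R]_n) : eqT T v w -> v 0 u = w 0 u -> v = w.
  move=> /eqTP H Hu; apply/rowP=> k; have [->//|ku] := eqVneq k u.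
  by apply: H; rewrite !inE.
have c0 : (#|[set i in L | eqT T (x i) 0]| <= 1)%N.
  apply/card_le1_eqP => i j; rewrite !inE => /andP[iL i0] /andP[jL j0].
  have [//|ij] := eqVneq i j; have [nz /(_ _ _ iL jL ij (x i 0 u / x j 0 u))/eqP[]] := np.
  apply: (full).
    apply/eqTP=> k kT; rewrite (eqTP _ _ _ i0 k kT) !mxE (eqTP _ _ _ j0 k kT) mxE mulr0 //.
  rewrite mxE divfK //; apply: contra (nz _ jL) => /eqP xj; apply/eqP; apply: (full) => //.
  by rewrite xj mxE.
have cf q : q \in P -> #|fib q|%:R <= 1 + 2 * (z q (hi q) 0 u - z q (lo q) 0 u).
  move=> qP; have [lq hq lh] := lhP q qP.
  pose d i := z q i 0 u - z q (lo q) 0 u.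
  have dP i : i \in fib q -> hv (d i) /\ 0 <= d i.
    by move=> iq; split; [apply: hvz|rewrite subr_ge0; case/andP: (lh i iq)].
  have inj : {in fib q &, injective (fun i => off (d i))}.
    move=> i j iq jq /= /off_inj E; apply: (fib_inj F np iq jq); apply: full.
      exact: (fibE F iq jq).
    have [h1 h2] := dP i iq; have [h3 h4] := dP j jq.
    by have := E h1 h3 h2 h4; rewrite /d; lra.
  have [hd hd0] := dP _ hq.
  rewrite -/(d (hi q)) -(offE hd hd0) addrC natr1 ler_nat.
  rewrite -[leqRHS]card_ord; pose g i : 'I_(off (d (hi q))).+1 := inord (off (d i)).
  apply: (leq_card_inj (f := g)) => i j iq jq.
  have bd k : k \in fib q -> (off (d k) < (off (d (hi q))).+1)%N.
    move=> kq; have [h1 h2] := dP k kq; rewrite ltnS -(ler_nat R) !offE //.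
    by have /andP[_] := lh k kq; rewrite /d; lra.
  by move/(congr1 val); rewrite /= !inordK ?bd //; apply: inj.
have s1 : (\sum_(q in P) #|fib q|)%:R <= #|P|%:R + 2 * #|T|%:R :> R.
  rewrite natr_sum -[#|P|]sum1_card natr_sum.
  apply: le_trans (_ : _ <= \sum_(q in P) (1 + 2 * (z q (hi q) 0 u - z q (lo q) 0 u))) _.
    by apply: ler_sum => q; apply: cf.
  by rewrite big_split -mulr_sumr lerD // ler_pM2l ?ltr0n.
rewrite -natrM -natrD ler_nat in s1.
rewrite (fibC F); exact: phi1_ge cT c0 cP s1.
Qed.

End SmallOdd.

Lemma parity4 (a b c d : nat) (m : int) :
  a%:Z - b%:Z - c%:Z + d%:Z = 2 * m -> odd (a + b) = odd (c + d).
Proof. by lia. Qed.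

Section OddPair.
Variable R : realFieldType.
Variable n : nat.
Variable I : finType.
Implicit Types (X : 'rV[R]_n -> Prop) (T S : {set 'I_n}) (u t e b : 'I_n) (x : I -> 'rV[R]_n).
Implicit Types (L P : {set I}).

(** Where the entries at e and b are both non-zero, they are both +-1 or both +-1/2. Up to scaling
    this leaves two axes and two diagonals, which [f] tells apart. *)
Lemma parallel_pair X e b x L : tm X -> oddon X [set e; b] -> e != b ->
  (forall i, i \in L -> X (x i)) -> nonpar x L ->
  (#|[set i in L | eqT (~: [set e; b]) (x i) 0]| <= 4)%N.
Proof.
move=> tX oX eb xX [nz np]; set A := [set i in L | _].
pose f i : bool * bool :=
  if x i 0 b == 0 then (false, false) else if x i 0 e == 0 then (false, true)
  else (true, x i 0 e == x i 0 b).
suff fI : {in A &, injective f} by have := leq_card_inj fI; rewrite card_prod card_bool.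
have full (v w : 'rV[R]_n) : eqT (~: [set e; b]) v 0 -> eqT (~: [set e; b]) w 0 ->
    v 0 e = w 0 e -> v 0 b = w 0 b -> v = w.
  move=> /eqTP v0 /eqTP w0 ve vb; apply/rowP=> k; have [->//|ke] := eqVneq k e.
  have [->//|kb] := eqVneq k b.
  have kT : k \in ~: [set e; b] by rewrite !inE negb_or ke.
  by rewrite v0 ?w0.
have fullZ (v w : 'rV[R]_n) c : eqT (~: [set e; b]) v 0 -> eqT (~: [set e; b]) w 0 ->
    v 0 e = c * w 0 e -> v 0 b = c * w 0 b -> v = c *: w.
  move=> v0 /eqTP w0 ve vb; apply: full; rewrite ?mxE //.
  by apply/eqTP=> k kT; rewrite mxE w0 // mxE mulr0.
move=> i j; rewrite !inE => /andP[iL i0] /andP[jL j0] E.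
have [//|ij] := eqVneq i j; have P c := np _ _ iL jL ij c.
have xn k : k \in L -> eqT (~: [set e; b]) (x k) 0 -> x k 0 e = 0 -> x k 0 b = 0 -> False.
  by move=> kL k0 ke kb; case/eqP: (nz _ kL); apply: full; rewrite ?mxE //; apply/eqTP.
have abs k : k \in L -> x k 0 e != 0 -> x k 0 b != 0 -> x k 0 e = x k 0 b \/ x k 0 e = - x k 0 b.
  move=> kL ke kb; have := odd_iv tX oX (xX k kL) (set21 e b) (set22 e b).
  have := tm_entry e tX (xX k kL); have := tm_entry b tX (xX k kL); rewrite /hv.
  case: (boolP (iv (x k 0 b))) => [/ivP h _ _ /ivP h'|_ /= /hfP h /orP[->//|/hfP h'] _].
    by case: h ke kb => ->; case: h' => -> /eqP ? /eqP ?; lra.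
  by case: h => ->; case: h' => ->; lra.
move: E; rewrite /f; case: (eqVneq (x i 0 b) 0) => [ib|ib]; case: (eqVneq (x j 0 b) 0) => [jb|jb];
  case: (eqVneq (x i 0 e) 0) => [ie|ie]; case: (eqVneq (x j 0 e) 0) => [je|je] //=;
  try by [case: (xn i)|case: (xn j)].
- move=> _; case/eqP: (P (x i 0 e / x j 0 e)); apply: fullZ => //; first by rewrite divfK.
  by rewrite ib jb mulr0.
- move=> _; case/eqP: (P (x i 0 b / x j 0 b)); apply: fullZ => //; last by rewrite divfK.
  by rewrite ie je mulr0.
case=> E; case/eqP: (P (x i 0 b / x j 0 b)); apply: fullZ => //; last by rewrite divfK.
have [Ei|Ei] := abs i iL ie ib; have [Ej|Ej] := abs j jL je jb; rewrite Ei Ej in E *.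
- by rewrite divfK.
- by move: E; rewrite eqxx => /esym/eqP; move/eqP: jb; lra.
- by move: E; rewrite eqxx => /eqP; move/eqP: ib; lra.
by rewrite mulrN divfK.
Qed.

Definition square X e b (y : 'rV[R]_n) :=
  [/\ X y, X (y + ux R e), X (y + ux R b) & X (y + ux R e + ux R b)].

(** A fibre is a subset of a 3 by 3 grid in the columns e and b. By [grid9] it has at most 1 + 3/2
    of the sum of its two widths as members, unless it contains four corners, which form a square.
    Summed over the fibres the widths give 3t, as [phi2_ge] demands. *)
Lemma odd2_bound X e b x L : tm X -> oddon X [set e; b] -> e != b ->
  (forall i, i \in L -> X (x i)) -> nonpar x L ->
  (#|L| <= phi n)%N \/ exists2 y, square X e b y & ~~ eqT (~: [set e; b]) y 0.
Proof.
move=> tX oX eb xX np; pose T := ~: [set e; b].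
have iT : intT T X := odd_intT oX.
have eT : e \notin T by rewrite !inE eqxx.
have bT : b \notin T by rewrite !inE eqxx orbT.
have cT : (n = #|T|.+2)%N.
  by have := cardsC [set e; b]; rewrite cards2 eb card_ord -/T; lia.
have [P [fib [z F]]] := fibered_exists T tX xX.
have [hve [lo [hi [lhP wle]]]] := fib_width F tX iT eT (fun _ h => h) (fun _ _ _ => erefl).
have [hvb [lo' [hi' [lhP' wle']]]] := fib_width F tX iT bT (fun _ h => h) (fun _ _ _ => erefl).
have cP := fib_reps tX iT xX F.
have full (v w : 'rV[R]_n) : eqT T v w -> v 0 e = w 0 e -> v 0 b = w 0 b -> v = w.
  move=> /eqTP H He Hb; apply/rowP=> k; have [->//|ke] := eqVneq k e.
  have [->//|kb] := eqVneq k b.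
  by apply: H; rewrite !inE negb_or ke.
pose d q i := z q i 0 e - z q (lo q) 0 e; pose d' q i := z q i 0 b - z q (lo' q) 0 b.
pose p q a c := occ (fib q) (fun i => (off (d q i), off (d' q i))) (a, c).
have [/existsP[q /and5P[qP p00 p02 p20 p22]]|no5] :=
  boolP [exists q, [&& q \in P, p q 0 0, p q 0 2, p q 2 0 & p q 2 2]]%N.
  right; have [lq hq lh] := lhP q qP; have [lq' hq' lh'] := lhP' q qP.
  have dv i a : i \in fib q -> off (d q i) = a -> z q i 0 e = z q (lo q) 0 e + a%:R / 2.
    move=> iq <-; rewrite offE; first by rewrite /d; lra.
      exact: hve.
    by rewrite subr_ge0; case/andP: (lh i iq).
  have dv' i a : i \in fib q -> off (d' q i) = a -> z q i 0 b = z q (lo' q) 0 b + a%:R / 2.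
    move=> iq <-; rewrite offE; first by rewrite /d'; lra.
      exact: hvb.
    by rewrite subr_ge0; case/andP: (lh' i iq).
  have [i iq [/(dv _ _ iq) ie /(dv' _ _ iq) ib]] := occP _ _ _ p00.
  have [j jq [/(dv _ _ jq) je /(dv' _ _ jq) jb]] := occP _ _ _ p02.
  have [k kq [/(dv _ _ kq) ke /(dv' _ _ kq) kb]] := occP _ _ _ p20.
  have [l lq0 [/(dv _ _ lq0) le /(dv' _ _ lq0) lb]] := occP _ _ _ p22.
  have eqS v c c' : v \in fib q -> z q v 0 e = z q i 0 e + c -> z q v 0 b = z q i 0 b + c' ->
      z q v = z q i + c *: ux R e + c' *: ux R b.
    move=> vq ve vb; apply: (full).
    - apply/eqTP=> m mT; rewrite (eqTP _ _ _ (fibE F vq iq) m mT) !mxE.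
      have /negPf-> : m != e by apply: contraNneq eT => <-.
      have /negPf-> : m != b by apply: contraNneq bT => <-.
      by rewrite !mulr0 !addr0.
    - by rewrite ve !mxE eqxx (negPf eb) mulr1 mulr0 addr0.
    - by rewrite vb !mxE eqxx (eq_sym b) (negPf eb) mulr1 mulr0 addr0.
  exists (z q i); last exact: (fibn F iq).
  split.
  - exact: (fibX F iq).
  - have := fibX F kq; rewrite (eqS k 1 0) //; first by rewrite scale1r scale0r addr0.
      by rewrite ke ie; lra.
    by rewrite kb ib; lra.
  - have := fibX F jq; rewrite (eqS j 0 1) //; first by rewrite scale1r scale0r addr0.
      by rewrite je ie; lra.
    by rewrite jb ib; lra.
  - have := fibX F lq0; rewrite (eqS l 1 1) //; first by rewrite !scale1r.
      by rewrite le ie; lra.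
    by rewrite lb ib; lra.
left.
have cf q : q \in P -> 4 * #|fib q|%:R <= 4 + 6 * (z q (hi q) 0 e - z q (lo q) 0 e) +
     6 * (z q (hi' q) 0 b - z q (lo' q) 0 b).
  move=> qP; have [lq hq lh] := lhP q qP; have [lq' hq' lh'] := lhP' q qP.
  have dP i : i \in fib q -> hv (d q i) /\ 0 <= d q i.
    by move=> iq; split; [apply: hve|rewrite subr_ge0; case/andP: (lh i iq)].
  have dP' i : i \in fib q -> hv (d' q i) /\ 0 <= d' q i.
    by move=> iq; split; [apply: hvb|rewrite subr_ge0; case/andP: (lh' i iq)].
  have inj : {in fib q &, forall i j, off (d q i) = off (d q j) -> off (d' q i) = off (d' q j) -> i = j}.
    move=> i j iq jq E E'; apply: (fib_inj F np iq jq); apply: full.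
    - exact: (fibE F iq jq).
    - have [h1 h2] := dP i iq; have [h3 h4] := dP j jq.
      by have := off_inj h1 h3 h2 h4 E; rewrite /d; lra.
    - have [h1 h2] := dP' i iq; have [h3 h4] := dP' j jq.
      by have := off_inj h1 h3 h2 h4 E'; rewrite /d'; lra.
  have C := card_grid9 (fun i _ => off_lt3 _) (fun i _ => off_lt3 _) inj.
  rewrite /= -!/(p q _ _) in C.
  (* The difference of the entries at e and b is integral, so all members lie in cells of the same
     parity. *)
  have par i j : i \in fib q -> j \in fib q ->
      odd (off (d q i) + off (d' q i)) = odd (off (d q j) + off (d' q j)).
    move=> iq jq; have [h1 h2] := dP i iq; have [h3 h4] := dP j jq.
    have [h1' h2'] := dP' i iq; have [h3' h4'] := dP' j jq.
    have [_ oz] := oX; have := oz _ (fibX F iq) _ _ (set21 e b) (set22 e b).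
    have := oz _ (fibX F jq) _ _ (set21 e b) (set22 e b) => zj zi.
    have [m mE] := zintB zi zj.
    have : ((off (d q i))%:Z - (off (d' q i))%:Z - (off (d q j))%:Z + (off (d' q j))%:Z)%:~R =
        (2 * m)%:~R :> R.
      rewrite !(intrD, intrM, mulrNz) -mE.
      have E (k : nat) : (k%:Z)%:~R = k%:R :> R by [].
      by rewrite !E !offE // /d /d'; lra.
    by move/intr_inj/parity4.
  have nopar a c a' c' : odd (a + c) != odd (a' + c') -> p q a c && p q a' c' = false.
    move=> H; apply/negP=> /andP[/occP[i iq [ia ic]] /occP[j jq [ja jc]]].
    by have := par i j iq jq; rewrite ia ic ja jc => /eqP; rewrite (negPf H).
  have r0 : [|| p q 0 0, p q 0 1 | p q 0 2]%N.
    have E : off (d q (lo q)) = 0%N by rewrite /d subrr /off eqxx.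
    have : (off (d' q (lo q)) < 3)%N := off_lt3 _.
    case E' : (off (d' q (lo q))) => [|[|[|m]]] // _; apply/or3P.
    - by apply: Or31; apply/occP; exists (lo q); rewrite ?E ?E'.
    - by apply: Or32; apply/occP; exists (lo q); rewrite ?E ?E'.
    - by apply: Or33; apply/occP; exists (lo q); rewrite ?E ?E'.
  have c0 : [|| p q 0 0, p q 1 0 | p q 2 0]%N.
    have E : off (d' q (lo' q)) = 0%N by rewrite /d' subrr /off eqxx.
    have : (off (d q (lo' q)) < 3)%N := off_lt3 _.
    case E' : (off (d q (lo' q))) => [|[|[|m]]] // _; apply/or3P.
    - by apply: Or31; apply/occP; exists (lo' q); rewrite ?E ?E'.
    - by apply: Or32; apply/occP; exists (lo' q); rewrite ?E ?E'.
    - by apply: Or33; apply/occP; exists (lo' q); rewrite ?E ?E'.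
  have wE a c : p q a c -> a%:R <= 2 * (z q (hi q) 0 e - z q (lo q) 0 e).
    case/occP=> i iq [<- _]; have [h1 h2] := dP i iq; rewrite offE //.
    by have /andP[_] := lh i iq; rewrite /d; lra.
  have wB a c : p q a c -> c%:R <= 2 * (z q (hi' q) 0 b - z q (lo' q) 0 b).
    case/occP=> i iq [_ <-]; have [h1 h2] := dP' i iq; rewrite offE //.
    by have /andP[_] := lh' i iq; rewrite /d'; lra.
  have wE0 : 0 <= z q (hi q) 0 e - z q (lo q) 0 e by rewrite subr_ge0; case/andP: (lh _ hq).
  have wB0 : 0 <= z q (hi' q) 0 b - z q (lo' q) 0 b by rewrite subr_ge0; case/andP: (lh' _ hq').
  have np5 : ~~ ([|| p q 0 0, p q 0 2, p q 1 1, p q 2 0 | p q 2 2] &&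
                 [|| p q 0 1, p q 1 0, p q 1 2 | p q 2 1])%N.
    by rewrite !andb_orl !andb_orr !nopar.
  have [five|] := grid9 r0 c0 np5.
    by case/negP: no5; apply/existsP; exists q; rewrite qP.
  rewrite -C => le4.
  have : (4 * #|fib q|)%:R <= (4 + 3 * ((if [|| p q 2 0, p q 2 1 | p q 2 2] then 2
     else [|| p q 1 0, p q 1 1 | p q 1 2] : nat) + (if [|| p q 0 2, p q 1 2 | p q 2 2] then 2
     else [|| p q 0 1, p q 1 1 | p q 2 1] : nat)))%N%:R :> R by rewrite ler_nat.
  rewrite natrM natrD natrM natrD.
  set w1 := (if _ then _ else _); set w2 := (if _ then _ else _).
  have w1le : w1%:R <= 2 * (z q (hi q) 0 e - z q (lo q) 0 e).
    rewrite /w1; case: ifP => [/or3P[]/wE //|_].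
    by case: orP => [[/wE//|/orP[]/wE//]|_]; rewrite mulr_ge0.
  have w2le : w2%:R <= 2 * (z q (hi' q) 0 b - z q (lo' q) 0 b).
    rewrite /w2; case: ifP => [/or3P[]/wB //|_].
    by case: orP => [[/wB//|/orP[]/wB//]|_]; rewrite mulr_ge0.
  move: w1le w2le; lra.
have s1 : 4 * (\sum_(q in P) #|fib q|)%:R <= 4 * #|P|%:R + 12 * #|T|%:R :> R.
  rewrite natr_sum -[#|P|]sum1_card natr_sum !mulr_sumr.
  apply: le_trans (_ : _ <= \sum_(q in P) (4 * 1%:R +
     6 * (z q (hi q) 0 e - z q (lo q) 0 e) + 6 * (z q (hi' q) 0 b - z q (lo' q) 0 b))) _.
    by apply: ler_sum => q qP; have := cf q qP; lra.
  rewrite !big_split -!mulr_sumr /=; move: wle wle'; lra.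
rewrite -!natrM -natrD ler_nat in s1.
rewrite (fibC F); apply: (phi2_ge cT) cP _; first exact: parallel_pair tX oX eb xX np.
by rewrite -(leq_pmul2l (isT : 0 < 4)%N) mulnDr mulnA.
Qed.

End OddPair.

(** * Two odd columns with a square *)

Section Cube.
Variable R : realFieldType.
Variable n : nat.
Variable I : finType.
Implicit Types (X : 'rV[R]_n -> Prop) (T S : {set 'I_n}) (u t e b : 'I_n) (x : I -> 'rV[R]_n).
Implicit Types (L P : {set I}) (v w y r : 'rV[R]_n).

Lemma odd_piv X S y t : tm X -> oddon X S -> X y -> t \notin S -> y 0 t * y 0 t = 1 ->
  oddon (pimg X y t) S.
Proof.
move=> tX oX yX tS yt; have [o1 o2] := oX.
have iT := odd_intT oX; have tT : t \in ~: S by rewrite inE.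
split=> w [v vX ->].
  move=> k kS; have [->|kt] := eqVneq k t.
    have -> : piv y t v 0 t = y 0 t * v 0 t.
      by rewrite /piv !mxE eqxx mulrBr mulr1 mulrAC yt mul1r opprB addrCA subrr addr0.
    case/ivP: (iT _ yX _ tT) yt => -> yt; case/ivP: (iT _ vX _ tT) => ->;
      by rewrite ?(mulr0, mul0r, mulr1, mul1r, mulN1r, opprK) /iv ?eqxx ?orbT.
  apply: (intT_piv tX iT yX tT yt); first by exists v.
  by rewrite !inE kt.
move=> i j iS jS; have it : i != t by apply: contraNneq tS => <-.
have jt : j != t by apply: contraNneq tS => <-.
rewrite !pivE //.
have -> : v 0 i - y 0 t * v 0 t * y 0 i - (v 0 j - y 0 t * v 0 t * y 0 j) =
  v 0 i - v 0 j - y 0 t * v 0 t * (y 0 i - y 0 j) by ring.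
apply: zintB; first exact: o2.
by apply: zintM; [apply: zintM; apply: iv_zint; [exact: (iT _ yX)|exact: (iT _ vX)]|exact: o2].
Qed.

Lemma square_piv X e b y t : square X e b y -> e != t -> b != t -> y 0 t * y 0 t = 1 ->
  square (pimg X y t) e b (ux R t).
Proof.
case=> X1 X2 X3 X4 et bt yt.
have pe : piv y t (ux R e) = ux R e by rewrite piv_id // uxE eq_sym (negPf et).
have pb : piv y t (ux R b) = ux R b by rewrite piv_id // uxE eq_sym (negPf bt).
split.
- by exists y => //; rewrite piv_row.
- by exists (y + ux R e) => //; rewrite linearD /= pe piv_row.
- by exists (y + ux R b) => //; rewrite linearD /= pb piv_row.
- by exists (y + ux R e + ux R b) => //; rewrite !linearD /= pe pb piv_row.
Qed.

Lemma piv_on T r j v k : (forall i, i \in T -> r 0 i = 0) -> j \notin T -> k \in T ->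
  piv r j v 0 k = v 0 k.
Proof.
move=> r0 jT kT; have kj : k != j by apply: contraNneq jT => <-.
by rewrite pivE // (r0 k kT) mulr0 subr0.
Qed.

Lemma intT_on T r j X : intT T X -> (forall i, i \in T -> r 0 i = 0) -> j \notin T ->
  intT T (pimg X r j).
Proof. by move=> iT r0 jT w [v vX ->] k kT; rewrite (piv_on _ r0 jT kT); apply: iT. Qed.

Lemma card_setU3 e b t : e != b -> t != e -> t != b -> #|[set t; e; b]| = 3%N.
Proof.
by move=> eb te tb; rewrite -setUA cardsU1 cards2 eb !inE negb_or te tb.
Qed.

(* Pivoting on sums of the vertices of a square turns the following two combinations of
   coordinates into coordinates. *)
Lemma square_diff X e b t T : tm X -> intT T X -> e != b -> t != e -> t != b ->
  e \notin T -> b \notin T -> t \notin T -> square X e b (ux R t) ->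
  exists X' f, [/\ tm X', intT T X', forall v, X v -> X' (f v),
    forall v k, k \in T -> f v 0 k = v 0 k & forall v, f v 0 e = v 0 e - v 0 b].
Proof.
move=> tX iT eb te tb eT bT tT [_ _ _ sX].
have r0 i : i \in T -> (ux R t + ux R e + ux R b) 0 i = 0.
  move=> iiT; rewrite !mxE; have /negPf-> : i != t by apply: contraNneq tT => <-.
  have /negPf-> : i != e by apply: contraNneq eT => <-.
  have /negPf-> : i != b by apply: contraNneq bT => <-.
  by rewrite !addr0.
have rb : (ux R t + ux R e + ux R b) 0 b = 1.
  by rewrite !mxE eqxx !(eq_sym b) (negPf eb) (negPf tb) !add0r.
have re : (ux R t + ux R e + ux R b) 0 e = 1.
  by rewrite !mxE eqxx (eq_sym e t) (negPf eb) (negPf te) addr0 add0r.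
exists (pimg X (ux R t + ux R e + ux R b) b), (piv (ux R t + ux R e + ux R b) b); split.
- by apply: tm_piv => //; rewrite rb mulr1.
- exact: intT_on.
- by move=> v vX; exists v.
- by move=> v k kT; rewrite (piv_on _ r0 bT kT).
by move=> v; rewrite pivE // rb re mul1r mulr1.
Qed.

Lemma square_sum X e b t T : tm X -> intT T X -> e != b -> t != e -> t != b ->
  e \notin T -> b \notin T -> t \notin T -> square X e b (ux R t) ->
  exists X' f, [/\ tm X', intT T X', forall v, X v -> X' (f v),
    forall v k, k \in T -> f v 0 k = v 0 k & forall v, f v 0 e = v 0 e + v 0 b - v 0 t].
Proof.
move=> tX iT eb te tb eT bT tT [_ s1X s2X _].
have nT i : i \in T -> [/\ i == t = false, i == e = false & i == b = false].
  by move=> iiT; split; apply/negbTE; [apply: contraNneq tT|apply: contraNneq eT|apply: contraNneq bT] => <-.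
pose r := ux R t + ux R b; pose r' := ux R t + ux R e - ux R b.
have r0 i : i \in T -> r 0 i = 0 by case/nT=> h1 h2 h3; rewrite !mxE h1 h3 addr0.
have r0' i : i \in T -> r' 0 i = 0 by case/nT=> h1 h2 h3; rewrite !mxE h1 h2 h3 subr0 addr0.
have tb' : (b == t) = false by rewrite eq_sym (negPf tb).
have te' : (e == t) = false by rewrite eq_sym (negPf te).
have eb' : (b == e) = false by rewrite eq_sym (negPf eb).
have rt : r 0 t = 1 by rewrite !mxE eqxx (negPf tb) addr0.
have tX1 : tm (pimg X r t) by apply: tm_piv => //; rewrite rt mulr1.
have iT1 : intT T (pimg X r t) by apply: intT_on.
(* [r'] is the image of the vertex [ux t + ux e] under the first pivot. *)
have r'X : pimg X r t r'.
  exists (ux R t + ux R e) => //; rewrite linearD /= /r' (@piv_id _ _ _ (ux R e)); last first.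
    by rewrite uxE (negPf te).
  by apply/rowP=> k; rewrite /piv rt /r !mxE eqxx /=; lra.
have rb' : r' 0 b = -1 by rewrite !mxE eqxx eb' tb' !add0r.
have re' : r' 0 e = 1 by rewrite !mxE eqxx te' (negPf eb) add0r subr0.
exists (pimg (pimg X r t) r' b), (fun v => piv r' b (piv r t v)); split.
- by apply: tm_piv => //; rewrite rb' mulrNN mulr1.
- exact: intT_on.
- by move=> v vX; exists (piv r t v) => //; exists v.
- by move=> v k kT; rewrite (piv_on _ r0' bT kT) (piv_on _ r0 tT kT).
move=> v; rewrite pivE // !pivE ?rb' ?re' ?rt; last 2 first.
- by rewrite tb'.
- by rewrite te'.
by rewrite !mxE eqxx te' (negPf eb) tb' /=; lra.
Qed.

(** A single pivot at the vertex [ux t + ux e]. These differences provide the bounds that exclude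
    antipodal vertices of the cube. *)
Lemma square_base X e b t T : tm X -> intT T X -> e != b -> t != e -> t != b ->
  e \notin T -> b \notin T -> t \notin T -> square X e b (ux R t) ->
  exists X' f, [/\ tm X', intT T X', forall v, X v -> X' (f v),
    forall v k, k \in T -> f v 0 k = v 0 k & forall v, f v 0 e = v 0 e - v 0 t].
Proof.
move=> tX iT eb te tb eT bT tT [_ sX _ _].
have r0 i : i \in T -> (ux R t + ux R e) 0 i = 0.
  move=> iiT; rewrite !mxE; have /negPf-> : i != t by apply: contraNneq tT => <-.
  have /negPf-> : i != e by apply: contraNneq eT => <-.
  by rewrite !addr0.
have rt : (ux R t + ux R e) 0 t = 1 by rewrite !mxE eqxx (negPf te) addr0.
have re : (ux R t + ux R e) 0 e = 1 by rewrite !mxE eqxx (eq_sym e t) (negPf te) add0r.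
exists (pimg X (ux R t + ux R e) t), (piv (ux R t + ux R e) t); split.
- by apply: tm_piv => //; rewrite rt mulr1.
- exact: intT_on.
- by move=> v vX; exists v.
- by move=> v k kT; rewrite (piv_on _ r0 tT kT).
by move=> v; rewrite pivE 1?eq_sym // rt re mul1r mulr1.
Qed.

Lemma square_sym X e b y : square X e b y -> square X b e y.
Proof. by case=> ? ? ? h; split=> //; rewrite addrAC. Qed.

Definition bit (a : R) := a != 0.

Lemma bitE a : hv a -> zint a -> 0 <= a -> a = (bit a)%:R.
Proof.
move=> ha za a0; rewrite /bit; case/ivP: (hv_zint ha za) a0 => ->; rewrite ?eqxx ?oner_eq0 //; lra.
Qed.

(** The integral functionals v_e + v_b - v_t, v_e - v_b and v_t embed each fibre in a cube, and v_e
    is a fourth direction. In four times the count the directions have weights 3, 3, 3 and 6, so the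
    widths use 15t of the 16t available. *)
Lemma cube_bound X e b t x L : tm X -> oddon X [set e; b] -> e != b -> t != e -> t != b ->
  square X e b (ux R t) -> (forall i, i \in L -> X (x i)) -> nonpar x L -> (500 <= n)%N ->
  (#|L| <= phi n)%N.
Proof.
move=> tX oX eb te tb sq xX np n500; pose T := ~: [set t; e; b].
have oT := odd_intT oX.
have iT : intT T X.
  by move=> v vX j; rewrite !inE !negb_or => /andP[/andP[_ je] jb]; apply: oT; rewrite ?inE ?negb_or ?je.
have tT : t \notin T by rewrite !inE eqxx.
have eT : e \notin T by rewrite !inE eqxx orbT.
have bT : b \notin T by rewrite !inE eqxx !orbT.
have cT : (n = #|T|.+3)%N.
  have := cardsC [set t; e; b]; rewrite card_setU3 // card_ord; exact: esym.
have [P [fib [z F]]] := fibered_exists T tX xX.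
have cP := fib_reps tX iT xX F.
have [X1 [f1 [tX1 iT1 fX1 fT1 f1E]]] := square_sum tX iT eb te tb eT bT tT sq.
have [X2 [f2 [tX2 iT2 fX2 fT2 f2E]]] := square_diff tX iT eb te tb eT bT tT sq.
have [X3 [f3 [tX3 iT3 fX3 fT3 f3E]]] := square_base tX iT eb te tb eT bT tT sq.
have be : b != e by rewrite eq_sym.
have [X4 [f4 [tX4 iT4 fX4 fT4 f4E]]] := square_base tX iT be tb te bT eT tT (square_sym sq).
have [hv0 [lo0 [hi0 [lh0 w0]]]] := fib_width F tX iT eT (fun _ h => h) (fun _ _ _ => erefl).
have [hv1 [lo1 [hi1 [lh1 w1]]]] := fib_width F tX1 iT1 eT fX1 fT1.
have [hv2 [lo2 [hi2 [lh2 w2]]]] := fib_width F tX2 iT2 eT fX2 fT2.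
have [hv3 [lo3 [hi3 [lh3 w3]]]] := fib_width F tX iT tT (fun _ h => h) (fun _ _ _ => erefl).
have [hvb _] := fib_width F tX iT bT (fun _ h => h) (fun _ _ _ => erefl).
have [hvet _] := fib_width F tX3 iT3 eT fX3 fT3.
have [hvbt _] := fib_width F tX4 iT4 bT fX4 fT4.
have full (v w : 'rV[R]_n) : eqT T v w -> v 0 e = w 0 e -> v 0 b = w 0 b -> v 0 t = w 0 t -> v = w.
  move=> /eqTP H He Hb Ht; apply/rowP=> k; have [->//|ke] := eqVneq k e.
  have [->//|kb] := eqVneq k b; have [->//|kt] := eqVneq k t.
  by apply: H; rewrite !inE !negb_or kt ke.
have c0 : (#|[set i in L | eqT T (x i) 0]| <= 125)%N.
  have -> : 125%N = (5 ^ #|[set t; e; b]|)%N by rewrite card_setU3.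
  apply: (crude tX (x := x)) => [i|i j]; first by rewrite inE => /andP[/xX].
  rewrite !inE => /andP[iL i0] /andP[jL j0] /eqTP E.
  have [//|ij] := eqVneq i j; have [_ /(_ _ _ iL jL ij 1)/eqP[]] := np.
  rewrite scale1r; apply: full; rewrite ?E ?inE ?eqxx ?orbT //.
  by apply/eqTP=> k kT; rewrite (eqTP _ _ _ i0) // (eqTP _ _ _ j0).
pose y1 q i := f1 (z q i) 0 e; pose y2 q i := f2 (z q i) 0 e; pose y3 q i := z q i 0 t.
pose d1 q i := y1 q i - y1 q (lo1 q); pose d2 q i := y2 q i - y2 q (lo2 q).
pose d3 q i := y3 q i - y3 q (lo3 q).
have zz1 q i : i \in fib q -> zint (y1 q i).
  move=> iq; have zX := fibX F iq; rewrite /y1 f1E; apply: zintB; last first.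
    by apply: iv_zint; apply: oT zX _ _; rewrite !inE negb_or te.
  have -> : z q i 0 e + z q i 0 b = (z q i 0 e - z q i 0 b) + 2 * z q i 0 b by ring.
  apply: zintD; last by apply: hv_zint2; apply: tm_entry tX zX.
  by case: oX => _ oz; apply: oz zX _ _ _ _; rewrite !inE eqxx ?orbT.
have zz2 q i : i \in fib q -> zint (y2 q i).
  move=> iq; rewrite /y2 f2E; case: oX => _ oz.
  by apply: oz (fibX F iq) _ _ _ _; rewrite !inE eqxx ?orbT.
have zz3 q i : i \in fib q -> zint (y3 q i).
  by move=> iq; apply: iv_zint; apply: oT (fibX F iq) _ _; rewrite !inE negb_or te.
have cf q : q \in P -> 4 * #|fib q|%:R <= 4 + 3 * (y1 q (hi1 q) - y1 q (lo1 q)) +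
    3 * (y2 q (hi2 q) - y2 q (lo2 q)) + 3 * (y3 q (hi3 q) - y3 q (lo3 q)) +
    6 * (z q (hi0 q) 0 e - z q (lo0 q) 0 e).
  move=> qP.
  have [l0q h0q m0] := lh0 q qP; have [l1q h1q m1] := lh1 q qP.
  have [l2q h2q m2] := lh2 q qP; have [l3q h3q m3] := lh3 q qP.
  have E1 i : i \in fib q -> d1 q i = (bit (d1 q i))%:R.
    move=> iq; apply: bitE; [exact: hv1|apply: zintB; exact: zz1|].
    by rewrite subr_ge0; case/andP: (m1 i iq).
  have E2 i : i \in fib q -> d2 q i = (bit (d2 q i))%:R.
    move=> iq; apply: bitE; [exact: hv2|apply: zintB; exact: zz2|].
    by rewrite subr_ge0; case/andP: (m2 i iq).
  have E3 i : i \in fib q -> d3 q i = (bit (d3 q i))%:R.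
    move=> iq; apply: bitE; [exact: hv3|apply: zintB; exact: zz3|].
    by rewrite subr_ge0; case/andP: (m3 i iq).
  pose f i := (bit (d1 q i), bit (d2 q i), bit (d3 q i)).
  have yE i : [/\ y1 q i = z q i 0 e + z q i 0 b - z q i 0 t, y2 q i = z q i 0 e - z q i 0 b
     & y3 q i = z q i 0 t] by rewrite /y1 /y2 f1E f2E.
  have dE i j : i \in fib q -> j \in fib q -> 
     [/\ y1 q i - y1 q j = (bit (d1 q i))%:R - (bit (d1 q j))%:R,
         y2 q i - y2 q j = (bit (d2 q i))%:R - (bit (d2 q j))%:R &
         y3 q i - y3 q j = (bit (d3 q i))%:R - (bit (d3 q j))%:R].
    move=> iq jq; rewrite -!E1 // -!E2 // -!E3 // /d1 /d2 /d3; split; ring.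
  have fI : {in fib q &, injective f}.
    move=> i j iq jq [h1 h2 h3]; apply: (fib_inj F np iq jq).
    have [] := dE i j iq jq; rewrite h1 h2 h3 !subrr.
    have [-> -> ->] := yE i; have [-> -> ->] := yE j => k1 k2 k3.
    apply: full; first exact: (fibE F iq jq); lra.
  have C := card_cube fI; rewrite /= in C.
  (* If the three coordinates change by signs d1, d2, d3, then v_e, v_b, v_e - v_t and v_b - v_t
     change by half of d1 + d2 + d3, d1 - d2 + d3, d1 + d2 - d3 and d1 - d2 - d3. One of these is
     +-3/2. *)
  have anti i j : i \in fib q -> j \in fib q -> 
      [&& bit (d1 q i) != bit (d1 q j), bit (d2 q i) != bit (d2 q j)
        & bit (d3 q i) != bit (d3 q j)] = false.
    move=> iq jq; apply/negP=> /and3P[h1 h2 h3].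
    have [] := dE i j iq jq; have [-> -> ->] := yE i; have [-> -> ->] := yE j.
    have := hv_le1 (hv0 q i j iq jq); have := hv_le1 (hvb q i j iq jq).
    have := hv_le1 (hvet q i j iq jq); have := hv_le1 (hvbt q i j iq jq).
    rewrite !f3E !f4E; move: h1 h2 h3; clear.
    by case: (bit (d1 q i)); case: (bit (d1 q j)) => //; case: (bit (d2 q i));
       case: (bit (d2 q j)) => //; case: (bit (d3 q i)); case: (bit (d3 q j)) => //= _ _ _; lra.
  have nanti a c d : ~~ (occ (fib q) f (a, c, d) && occ (fib q) f (~~ a, ~~ c, ~~ d)).
    apply/negP=> /andP[/occP[i iq [h1 h2 h3]] /occP[j jq [k1 k2 k3]]].
    by have := anti i j iq jq; rewrite h1 h2 h3 k1 k2 k3; case: (a); case: (c); case: (d).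
  have z1 : bit (d1 q (lo1 q)) = false by rewrite /d1 subrr /bit eqxx.
  have z2 : bit (d2 q (lo2 q)) = false by rewrite /d2 subrr /bit eqxx.
  have z3 : bit (d3 q (lo3 q)) = false by rewrite /d3 subrr /bit eqxx.
  have occf i : i \in fib q -> occ (fib q) f (f i) by move=> iq; apply/occP; exists i.
  have a1 := occf _ l1q; rewrite /f z1 in a1.
  have a2 := occf _ l2q; rewrite /f z2 in a2.
  have a3 := occf _ l3q; rewrite /f z3 in a3.
  have := @cube _ _ _ _ _ _ _ _ (nanti false false false) (nanti false false true)
    (nanti false true false) (nanti true false false).
  case.
  - by move: a1; case: (bit _); case: (bit _) => ->; rewrite ?orbT.
  - by move: a2; case: (bit _); case: (bit _) => ->; rewrite ?orbT.
  - by move: a3; case: (bit _); case: (bit _) => ->; rewrite ?orbT.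
  move=> m [M [mP MP]]; rewrite -C => le4.
  have sumP k : [|| (k == 0) && occ (fib q) f (false, false, false),
      (k == 1) && [|| occ (fib q) f (false, false, true), occ (fib q) f (false, true, false)
         | occ (fib q) f (true, false, false)],
      (k == 2) && [|| occ (fib q) f (false, true, true), occ (fib q) f (true, false, true)
         | occ (fib q) f (true, true, false)] | (k == 3) && occ (fib q) f (true, true, true)]%N ->
      exists2 i, i \in fib q & k%:R = (bit (d1 q i))%:R + (bit (d2 q i))%:R + (bit (d3 q i))%:R :> R.
    have g (a c d : bool) (l : nat) : l = (a + c + d)%N -> occ (fib q) f (a, c, d) ->
      exists2 i, i \in fib q & l%:R = (bit (d1 q i))%:R + (bit (d2 q i))%:R + (bit (d3 q i))%:R :> R.
      by move=> -> /occP[i iq [h1 h2 h3]]; exists i => //; rewrite h1 h2 h3 !natrD.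
    by case/or4P=> /andP[/eqP kE] => [|/or3P[]|/or3P[]|]; apply: g.
  have [i iq iE] := sumP _ MP; have [j jq jE] := sumP _ mP.
  have [h1 h2 h3] := dE i j iq jq; have [k1 k2 k3] := yE i; have [l1 l2 l3] := yE j.
  have D0 : 0 <= z q (hi0 q) 0 e - z q (lo0 q) 0 e by rewrite subr_ge0; case/andP: (m0 _ h0q).
  have Mm : (M - m)%:R <= 2 * (z q (hi0 q) 0 e - z q (lo0 q) 0 e).
    have [Mm|Mm] := leqP m M; last by rewrite (eqP (ltnW Mm)) mulr_ge0.
    have := m0 i iq; have := m0 j jq => /andP[b1 b2] /andP[b3 b4].
    rewrite natrB // iE jE; move: h1 h2 h3 b1 b2 b3 b4; rewrite k1 k2 k3 l1 l2 l3; clear; lra.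
  have wt (d y : I -> I -> R) (l h : I) (B : bool) : (forall i, d q i = y q i - y q l) ->
    y q l <= y q h ->
    (B -> exists2 i, i \in fib q & d q i = 1 /\ y q i <= y q h) -> B%:R <= y q h - y q l.
    move=> dd hl; case: B => [/(_ isT)[k kq [kd kh]]|_]; last by rewrite subr_ge0.
    by move: kd; rewrite dd /=; lra.
  have B1 : [|| occ (fib q) f (true, false, false), occ (fib q) f (true, false, true),
     occ (fib q) f (true, true, false) | occ (fib q) f (true, true, true)]%:R <= y1 q (hi1 q) - y1 q (lo1 q).
    apply: (wt d1) => //; first by case/andP: (m1 _ h1q).
    by case/or4P=> /occP[k kq [k1' _ _]]; exists k => //; rewrite E1 // k1'; split=> //;
      case/andP: (m1 k kq).
  have B2 : [|| occ (fib q) f (false, true, false), occ (fib q) f (false, true, true),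
     occ (fib q) f (true, true, false) | occ (fib q) f (true, true, true)]%:R <= y2 q (hi2 q) - y2 q (lo2 q).
    apply: (wt d2) => //; first by case/andP: (m2 _ h2q).
    by case/or4P=> /occP[k kq [_ k1' _]]; exists k => //; rewrite E2 // k1'; split=> //;
      case/andP: (m2 k kq).
  have B3 : [|| occ (fib q) f (false, false, true), occ (fib q) f (false, true, true),
     occ (fib q) f (true, false, true) | occ (fib q) f (true, true, true)]%:R <= y3 q (hi3 q) - y3 q (lo3 q).
    apply: (wt d3) => //; first by case/andP: (m3 _ h3q).
    by case/or4P=> /occP[k kq [_ _ k1']]; exists k => //; rewrite E3 // k1'; split=> //;
      case/andP: (m3 k kq).
  have := le4; rewrite -(ler_nat R) natrM natrD natrM !natrD.
  move: B1 B2 B3 Mm; clear; lra.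
have s1 : 4 * (\sum_(q in P) #|fib q|)%:R <= 4 * #|P|%:R + 15 * #|T|%:R :> R.
  rewrite natr_sum -[#|P|]sum1_card natr_sum !mulr_sumr.
  apply: le_trans (_ : _ <= \sum_(q in P) (4 * 1%:R + 3 * (y1 q (hi1 q) - y1 q (lo1 q)) +
    3 * (y2 q (hi2 q) - y2 q (lo2 q)) + 3 * (y3 q (hi3 q) - y3 q (lo3 q)) +
    6 * (z q (hi0 q) 0 e - z q (lo0 q) 0 e))) _.
    by apply: ler_sum => q qP; have := cf q qP; rewrite mulr1.
  rewrite !big_split -!mulr_sumr /=; move: w0 w1 w2 w3; rewrite /y1 /y2 /y3; clear; lra.
rewrite -!natrM -natrD ler_nat in s1.
by rewrite (fibC F); apply: (phi3_ge cT n500 c0 cP s1).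
Qed.

(** A pivot at the base point of the square turns it into a unit vector, as [cube_bound]
    requires. *)
Lemma odd2_large X e b x L : tm X -> oddon X [set e; b] -> e != b ->
  (forall i, i \in L -> X (x i)) -> nonpar x L -> (500 <= n)%N -> (#|L| <= phi n)%N.
Proof.
move=> tX oX eb xX np n500.
have [//|[y sq y0]] := odd2_bound tX oX eb xX np.
have yX : X y by case: sq.
have [t tT yt] := intT_neq0 (odd_intT oX) yX y0.
have [te tb] : t != e /\ t != b by move: tT; rewrite !inE negb_or => /andP[].
have tX' := tm_piv tX yX yt.
apply: (@cube_bound (pimg X y t) e b t (fun i => piv y t (x i))) => //.
- by apply: odd_piv => //; move: tT; rewrite inE.
- by apply: square_piv; rewrite // 1?eq_sym.
- by move=> i iL; exists (x i) => //; apply: xX.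
- by apply: nonpar_lin np => v; apply: piv_inj0.
Qed.

End Cube.

(** * Contraction *)

Section Minimal.
Variable R : realFieldType.
Variable n : nat.
Implicit Types (X : 'rV[R]_n -> Prop) (S T : {set 'I_n}) (x y z w : 'rV[R]_n).

Definition oddset w : {set 'I_n} := [set j | hf (w 0 j)].

(** [g] runs over all bases of determinant +-1 inside X, and [w] is the coordinate vector of a
    member of X in that basis; so all bases are compared, not only the current one. *)
Definition hmin s X := forall (g : 'M[R]_n) w, (forall i, X (row i g)) -> `|\det g| = 1 ->
  X (w *m g) -> oddset w != set0 -> (s <= #|oddset w|)%N.

Lemma hmin_chg s X g : (forall i, X (row i g)) -> `|\det g| = 1 -> hmin s X ->
  hmin s (fun y => X (y *m g)).
Proof.
move=> gX dg hX h w hgX dh; rewrite -mulmxA; apply: hX.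
  by move=> i; rewrite row_mul.
by rewrite det_mulmx normrM dh dg mulr1.
Qed.

Lemma hmin_pimg s X x j : tm X -> X x -> x 0 j * x 0 j = 1 -> hmin s X -> hmin s (pimg X x j).
Proof.
move=> tX xX xj hX; have [g [gX dg pX]] := pimg_chg tX xX xj.
move=> h w hgX dh /pX; apply: (hmin_chg gX dg hX) => // i; exact/pX.
Qed.

Lemma hminE s X w : hmin s X -> tm X -> X w -> oddset w != set0 -> (s <= #|oddset w|)%N.
Proof.
move=> hX tX wX; apply: (hX 1%:M); rewrite ?det1 ?normr1 ?mulmx1 // => i.
by rewrite row1; have := tmU tX i; congr X; apply/rowP=> k; rewrite !mxE eqxx.
Qed.

(** If the unit vectors [f i] are exchanged for the [x i], then [w] has the coordinates [c i] at
    [f i] and 0 elsewhere. *)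
Lemma hmin_rows s X k (x : 'I_k -> 'rV[R]_n) (f : 'I_k -> 'I_n) (c : 'I_k -> R) w :
  tm X -> hmin s X -> injective f -> (forall i, X (x i)) ->
  `|\det (\matrix_(i, j) x i 0 (f j))| = 1 -> X w -> w = \sum_i c i *: x i ->
  let w' := \sum_i c i *: ux R (f i) in oddset w' != set0 -> (s <= #|oddset w'|)%N.
Proof.
move=> tX hX fi xX d1 wX wE w'; have [g [gX g1 g2 dg]] := tm_minor tX fi xX.
apply: (hX g); rewrite ?dg // mulmx_suml.
suff -> : \sum_i c i *: ux R (f i) *m g = w by [].
by rewrite wE; apply: eq_bigr => i _; rewrite -scalemxAl mul_uxmx g1.
Qed.

End Minimal.

Section Contract.
Variable R : realFieldType.
Variable n : nat.
Implicit Types (X : 'rV[R]_n.+1 -> Prop) (e : 'I_n.+1) (v w : 'rV[R]_n.+1).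

Definition drop e v : 'rV[R]_n := col' e v.

Lemma dropE e v k : drop e v 0 k = v 0 (lift e k).
Proof. by rewrite mxE. Qed.

Definition dimg X e (z : 'rV[R]_n) := exists2 v, X v & z = drop e v.

(** Minors after the contraction are minors that avoid column e. *)
Lemma tm_drop X e : tm X -> tm (dimg X e).
Proof.
move=> tX; split=> [j|z [v vX ->]|A AX].
- exists (ux R (lift e j)); first exact: tmU.
  by apply/rowP=> k; rewrite dropE !uxE (inj_eq (@lift_inj _ e)).
- by exists (- v); [exact: tmN|apply/rowP=> k; rewrite !mxE].
have /fin_all_exists2[f fX fE] := AX.
have := tm_det tX (@lift_inj _ e) fX; congr (is_true (hv (\det _))).
by apply/matrixP=> i j; rewrite mxE -dropE -fE mxE.
Qed.

Lemma drop_eqT e v w : eqT [set~ e] v w = (drop e v == drop e w).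
Proof.
apply/eqTP/eqP=> [H|/rowP H j].
  by apply/rowP=> k; rewrite !dropE H // !inE eq_sym neq_lift.
by rewrite !inE; case: (unliftP e j) => [k -> _|->]; rewrite ?eqxx // -!dropE H.
Qed.

(** Two vectors that become parallel when e is contracted differ, up to sign, by exactly one unit
    vector of e; multiples of [ux e] are left out. *)
Definition linep X e := forall v w c, X v -> X w -> eqT [set~ e] v (c *: w) ->
  ~~ eqT [set~ e] v 0 -> v != c *: w ->
  c * c = 1 /\ (v 0 e - c * w 0 e) * (v 0 e - c * w 0 e) = 1.

Variable I : finType.

(** Fibres over the complement of e have at most two members, since three differences +-1 cannot add
    up to 0. [P] has one index for each class, [V] marks the classes with two members, [y q] is the
    lower end of such a pair up to a common sign, and the summand 1 is for the multiples of
    [ux e]. *)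
Lemma contract X e (x : I -> 'rV[R]_n.+1) (L : {set I}) : tm X -> linep X e ->
  (forall i, i \in L -> X (x i)) -> nonpar x L ->
  exists (P V : {set I}) (y : I -> 'rV[R]_n.+1),
  [/\ [/\ {subset P <= L}, {subset V <= P} & (#|L| <= 1 + #|P| + #|V|)%N],
      nonpar (fun i => drop e (x i)) P,
      forall q, q \in V -> [/\ X (y q), X (y q + ux R e) & ~~ eqT [set~ e] (y q) 0]
    & forall q r, q \in V -> r \in V -> q != r -> forall c, ~~ eqT [set~ e] (y q) (c *: y r)].
Proof.
move=> tX lX xX np; pose T := [set~ e].
have [P [fib [z F]]] := fibered_exists T tX xX.
pose V := [set q in P | 1 < #|fib q|]%N.
have full v w : eqT T v w -> v 0 e = w 0 e -> v = w.
  move=> /eqTP H He; apply/rowP=> k; have [->//|ke] := eqVneq k e.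
  by apply: H; rewrite !inE.
have ze q i j : i \in fib q -> j \in fib q -> i != j ->
    (z q i 0 e - z q j 0 e) * (z q i 0 e - z q j 0 e) = 1.
  move=> iq jq ij.
  have E : eqT T (z q i) (1 *: z q j) by rewrite scale1r; apply: (fibE F iq jq).
  have N : z q i != 1 *: z q j.
    by rewrite scale1r; apply: contra ij => /eqP/(fib_inj F np iq jq)->.
  by have [_] := lX _ _ _ (fibX F iq) (fibX F jq) E (fibn F iq) N; rewrite mul1r.
have f2 q : (#|fib q| <= 2)%N.
  rewrite leqNgt; apply/negP=> /card_gt2P[i [j [k [[iq jq kq] [ij jk ki]]]]].
  have := ze q i j iq jq ij; have := ze q j k jq kq jk; have := ze q k i kq iq ki.
  by move=> /sign_cases[] h1 /sign_cases[] h2 /sign_cases[] h3; lra.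
have PL := fibPL F.
have VP : {subset V <= P} by move=> q; rewrite inE => /andP[].
have cL : (#|L| <= 1 + #|P| + #|V|)%N.
  rewrite (fibC F) -addnA; apply: leq_add.
    apply/card_le1_eqP=> i j; rewrite !inE => /andP[iL i0] /andP[jL j0].
    have [//|ij] := eqVneq i j; have [nz /(_ _ _ iL jL ij (x i 0 e / x j 0 e))/eqP[]] := np.
    apply: (full).
      apply/eqTP=> k kT; rewrite (eqTP _ _ _ i0 k kT) !mxE (eqTP _ _ _ j0 k kT) mxE mulr0 //.
    rewrite mxE divfK //; apply: contra (nz _ jL) => /eqP xj; apply/eqP; apply: (full) => //.
    by rewrite xj mxE.
  have -> : #|V| = (\sum_(q in P) (1 < #|fib q|))%N.
    by rewrite -sum1_card big_mkcond [RHS]big_mkcond; apply: eq_bigr => q _; rewrite inE;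
       case: (q \in P) => //=; case: ifP.
  rewrite -sum1_card -big_split; apply: leq_sum => q qP.
  by have := f2 q; case: (#|fib q|) => [|[|[|m]]].
have /fin_all_exists[y yP] : forall q, exists yq, q \in V ->
   [/\ X yq, X (yq + ux R e) & exists2 i, i \in fib q & eqT T yq (z q i)].
  move=> q; have [qV|_] := boolP (q \in V); last by exists 0.
  have := qV; rewrite inE => /andP[qP /card_gt1P[i [j [iq jq ij]]]].
  have nx k l : k \in fib q -> l \in fib q -> z q k 0 e = z q l 0 e + 1 -> z q l + ux R e = z q k.
    move=> kq lq E; apply: full; last by rewrite !mxE eqxx E.
    apply/eqTP=> m mT; rewrite !mxE (eqTP _ _ _ (fibE F kq lq) m mT).
    by move: mT; rewrite !inE => /negPf->; rewrite addr0.
  have [d|d] := sign_cases (ze q i j iq jq ij).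
    exists (z q j) => _; rewrite (nx i j) //; last by move: d; lra.
    split; [exact: (fibX F jq)|exact: (fibX F iq)|].
    by exists j => //; apply/eqTP.
  exists (z q i) => _; rewrite (nx j i) //; last by move: d; lra.
  split; [exact: (fibX F iq)|exact: (fibX F jq)|].
  by exists i => //; apply/eqTP.
have par v w c : X v -> X w -> ~~ eqT T v 0 -> v != c *: w -> eqT T v (c *: w) -> sim T v w.
  by move=> vX wX v0 vw E; apply/simP; exists c => //; have [] := lX v w c vX wX E v0 vw.
exists P, V, y; split=> //.
- split=> [i iP|i j iP jP ij c].
    have := fibPn F iP; rewrite drop_eqT; apply: contra => /eqP->.
    by apply/eqP/rowP=> k; rewrite !mxE.
  apply: contra (fibP F iP jP ij) => /eqP E.
  apply: (par _ _ c); rewrite ?xX ?PL ?(fibPn F) //.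
  - by apply: xX; apply: PL.
  - by apply: xX; apply: PL.
  - by case: np => _ np; apply: np => //; apply: PL.
  by rewrite drop_eqT E; apply/eqP/rowP=> k; rewrite !mxE.
- move=> q qV; have [yX y1X [i iq yE]] := yP q qV; split=> //.
  have := fibn F iq; apply: contra => /eqTP H; apply/eqTP=> k kT.
  by rewrite -(eqTP _ _ _ yE k kT) H.
move=> q r qV rV qr c; have [qX q1X [i iq qE]] := yP q qV; have [rX r1X [j jr rE]] := yP r rV.
apply/negP=> E.
have nz : ~~ eqT T (y q) 0.
  have := fibn F iq; apply: contra => /eqTP H; apply/eqTP=> k kT.
  by rewrite -(eqTP _ _ _ qE k kT) H.
have ns : ~~ sim T (y q) (y r).
  have := fibs F (VP _ qV) (VP _ rV) qr iq jr; apply: contra => /simP[s s1 /eqTP H].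
  apply/simP; exists s => //; apply/eqTP=> k kT; have := H k kT.
  by rewrite !mxE (eqTP _ _ _ qE k kT) (eqTP _ _ _ rE k kT).
have [yE|yE] := eqVneq (y q) (c *: y r); last by case/negP: ns; apply: (par _ _ c).
have eE : eqT T (y q + ux R e) (y q).
  by apply/eqTP=> k; rewrite !inE => /negPf ke; rewrite !mxE ke addr0.
have nE : y q + ux R e != c *: y r.
  by rewrite -yE -subr_eq0 addrC addKr; apply/eqP=> /rowP/(_ e); rewrite !mxE eqxx => /eqP; rewrite oner_eq0.
case/negP: ns.
have /simP[s s1 /eqTP H] : sim T (y q + ux R e) (y r).
  apply: (par _ _ c) => //.
    by apply: contra nz => /eqTP H; apply/eqTP=> k kT; rewrite -(eqTP _ _ _ eE k kT) H.
  by apply/eqTP=> k kT; rewrite (eqTP _ _ _ eE k kT) (eqTP _ _ _ E k kT).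
by apply/simP; exists s => //; apply/eqTP=> k kT; rewrite -(eqTP _ _ _ eE k kT) H.
Qed.

End Contract.

Lemma bigD1_col (R : nzRingType) k n (c : 'rV[R]_k.+1) (A : 'M[R]_(k.+1, n)) i :
  c *m A = c 0 i *: row i A + col' i c *m row' i A.
Proof.
apply/rowP=> j; rewrite !mxE (bigD1_ord i) //=; congr (_ + _).
by apply: eq_bigr => l _; rewrite !mxE.
Qed.

(** * Independence of the contracted pairs for large odd sets *)

Section Independence.
Variable R : realFieldType.
Variable n : nat.
Variable I : finType.
Variables (X : 'rV[R]_n.+1 -> Prop) (e : 'I_n.+1) (s : nat).
Hypotheses (tX : tm X) (hX : hmin s X) (s5 : (4 < s)%N).

Section Circuit.
Variables (k : nat) (y : 'I_k.+1 -> 'rV[R]_n.+1).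
Hypotheses (yX : forall i, X (y i)) (y1X : forall i, X (y i + ux R e)).
Let A : 'M[R]_(k.+1, n) := \matrix_i drop e (y i).
Hypothesis An : ~~ row_free A.
Hypothesis Af : forall i, row_free (row' i A).
Hypothesis k2 : (1 < k)%N.

Let AE i j : A i j = y i 0 (lift e j). Proof. by rewrite mxE dropE. Qed.

Let relation : exists2 c : 'rV[R]_k.+1, c *m A = 0 & forall i, c 0 i != 0.
Proof.
have : kermx A != 0 by rewrite kermx_eq0.
rewrite -nz_row_eq0; set c := nz_row _ => c0.
have cA : c *m A = 0 by apply/sub_kermxP; apply: nz_row_sub.
exists c => // i; apply: contra c0 => /eqP ci.
have : col' i c *m row' i A = 0 by rewrite -cA (bigD1_col c A i) ci scale0r add0r.
move/eqP; rewrite mulmx_free_eq0 // => /eqP/rowP d0.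
apply/eqP/rowP=> j; rewrite mxE; case: (unliftP i j) => [l ->|->] //.
by have := d0 l; rewrite !mxE.
Qed.

Let fullA : row_full (row' 0 A)^T.
Proof. by rewrite /row_full mxrank_tr; apply: Af. Qed.

Let f := fullrankfun fullA.
Let N : 'M[R]_(k.+1, k) := \matrix_(i, j) A i (f j).
(** Cramer's coefficients of the linear relation among the rows of [A], taken from the columns [f];
    [F] adds the column e to these. *)
Let w (i : 'I_k.+1) := (-1) ^+ i * \det (row' i N).
Let F (d : 'I_k.+1) := if unlift 0 d is Some j then lift e (f j) else e.

Let F0 : F 0 = e. Proof. by rewrite /F unlift_none. Qed.
Let FS j : F (lift 0 j) = lift e (f j). Proof. by rewrite /F liftK. Qed.

Let F_inj : injective F.
Proof.
move=> a b; case: (unliftP 0 a) => [i ->|->]; case: (unliftP 0 b) => [j ->|->]; rewrite ?F0 ?FS //.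
- by move/lift_inj/fullrankfun_inj->.
- by move/eqP; rewrite eq_sym (negPf (neq_lift _ _)).
- by move/eqP; rewrite (negPf (neq_lift _ _)).
Qed.

Let w_expand (g : 'I_k.+1 -> R) (Q : 'M[R]_k.+1) :
  (forall i, Q i 0 = g i) -> (forall i j, Q i (lift 0 j) = N i j) ->
  \det Q = \sum_i g i * w i.
Proof.
move=> Q0 QS; rewrite (expand_det_col _ 0); apply: eq_bigr => i _.
rewrite Q0 /cofactor addn0; congr (_ * (_ * \det _)).
by apply/matrixP=> a b; rewrite !mxE QS !mxE.
Qed.

Let w_hv i : hv (w i).
Proof.
have fi : injective (fun j => lift e (f j)) by move=> a b /lift_inj/fullrankfun_inj.
have := tm_det tX fi (fun a : 'I_k => yX (lift i a)).
have -> : \matrix_(c, d) y (lift i c) 0 (lift e (f d)) = row' i N.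
  by apply/matrixP=> a b; rewrite !mxE.
rewrite /w -signr_odd; case: (odd _); first by rewrite expr1 mulN1r hvN.
by rewrite expr0 mul1r.
Qed.

Let w_rel j : \sum_i N i j * w i = 0.
Proof.
pose Q : 'M[R]_k.+1 := \matrix_(i, d) if unlift 0 d is Some l then N i l else N i j.
rewrite -(w_expand (Q := Q)).
- rewrite -det_tr; apply: (determinant_alternate (neq_lift 0 j)) => i.
  by rewrite !mxE unlift_none liftK !mxE.
- by move=> i; rewrite mxE unlift_none.
- by move=> i l; rewrite mxE liftK.
Qed.

Let unitN : row' 0 N \in unitmx.
Proof.
rewrite -unitmx_tr (_ : _^T = rowsub f (row' 0 A)^T) ?fullrowsub_unit //.
by apply/matrixP=> a b; rewrite !mxE.
Qed.

Let w0 : w 0 != 0.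
Proof. by rewrite /w expr0 mul1r -unitfE -unitmxE unitN. Qed.

Let w_lin : (forall i, w i != 0) /\ forall j, \sum_i w i * A i j = 0.
Proof.
have [c cA cn] := relation.
have cS j : \sum_i c 0 i * A i j = 0.
  by have /rowP/(_ j) := cA; rewrite [LHS]mxE [RHS]mxE.
pose mu := w 0 / c 0 0.
have mu0 : mu != 0 by rewrite mulf_neq0 ?invr_eq0.
suff wE i : w i = mu * c 0 i.
  split=> [i|j]; first by rewrite wE mulf_neq0.
  rewrite (eq_bigr (fun i => mu * (c 0 i * A i j))) => [|i _]; last by rewrite wE mulrA.
  by rewrite -mulr_sumr cS mulr0.
pose d := (\row_i w i) - mu *: c.
have dN : d *m N = 0.
  apply/rowP=> j; rewrite [LHS]mxE [RHS]mxE.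
  rewrite (eq_bigr (fun l => N l j * w l - mu * (c 0 l * A l (f j)))) => [|l _].
    by rewrite sumrB w_rel -mulr_sumr cS mulr0 subr0.
  by rewrite !mxE; ring.
have d0 : d 0 0 = 0 by rewrite !mxE /mu divfK ?subrr.
have : col' 0 d *m row' 0 N = 0 by rewrite -dN (bigD1_col d N 0) d0 scale0r add0r.
move/(congr1 (mulmxr (invmx (row' 0 N)))); rewrite /= mulmxK // mul0mx => /rowP dd.
apply/eqP; rewrite -subr_eq0; have -> : w i - mu * c 0 i = d 0 i by rewrite !mxE.
case: (unliftP 0 i) => [l ->|->]; last by rewrite d0.
by have := dd l; rewrite !mxE => ->.
Qed.

(** The determinant on the columns [F] when row i is shifted by [ux e] exactly where [p i] holds. *)
Let E (p : 'I_k.+1 -> bool) := \sum_i (y i 0 e + (p i)%:R) * w i.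
Let xx (p : 'I_k.+1 -> bool) i := y i + (p i)%:R *: ux R e.

Let xxX p i : X (xx p i).
Proof. by rewrite /xx; case: (p i); rewrite ?scale1r ?scale0r ?addr0. Qed.

Let xxE p : \det (\matrix_(i, d) xx p i 0 (F d)) = E p.
Proof.
apply: w_expand => [i|i j].
  by rewrite mxE F0 !mxE eqxx mulr1.
by rewrite mxE FS !mxE eq_sym (negPf (neq_lift _ _)) mulr0 addr0.
Qed.

Let E_hv p : hv (E p).
Proof. by rewrite -xxE; apply: tm_det tX F_inj (xxX p). Qed.

(** Shifting the rows with positive, respectively negative, [w i] gives determinants that differ by
    the sum of the |w_i|. Each |w_i| is at least 1/2 and the difference at most 2, so k + 1 <= 4.
    One of the determinants is +-1, and in that basis [ux e] has the coordinates +-w_i. If some w_i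
    is half-integral, this is an odd set of at most four columns, against minimality; otherwise the
    sum of the |w_i| is k + 1 > 2. *)
Lemma circuit_absurd : False.
Proof.
have [wn wA] := w_lin.
pose pp i := 0 < w i; pose pm i := w i < 0.
have Ed : E pp - E pm = \sum_i `|w i|.
  rewrite -sumrB; apply: eq_bigr => i _; rewrite /pp /pm.
  by case: ltrgt0P (wn i) => //= _ _; ring.
have wge i : 2^-1 <= `|w i|.
  case/hvP: (w_hv i) (wn i) => ->; rewrite ?eqxx // ?normrN ?normr1 => _; try lra;
  by rewrite ger0_norm ?invr_ge0.
have Sge : k.+1%:R / 2 <= \sum_i `|w i|.
  have -> : k.+1%:R / 2 = \sum_(i < k.+1) 2^-1 :> R.
    by rewrite big_const_ord iter_addr_0 -[RHS]mulr_natl.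
  by apply: ler_sum => i _.
have k3 : 3%:R <= k.+1%:R :> R by rewrite ler_nat.
have hp := E_hv pp; have hm := E_hv pm.
have k4 : (k.+1 <= 4)%N.
  rewrite -(ler_nat R); move: Ed Sge (hv_le1 hp) (hv_le1 hm); lra.
(* Two multiples of 1/2 in [-1, 1] with difference at least 3/2: the larger is 1 or the smaller is
   -1. *)
have [p p1] : exists p, E p * E p = 1.
  have : E pp = 1 \/ E pm = -1.
    case/hvP: hp (hp) => h _; case/hvP: hm => h'; move: Ed Sge k3; rewrite h h' => *;
    first [by left|by right|exfalso; lra].
  by case=> h; [exists pp|exists pm]; rewrite h ?mulrNN mulr1.
pose D := E p.
have uE : ux R e = \sum_i (D * w i) *: xx p i.
  apply/rowP=> j; rewrite summxE uxE; case: (unliftP e j) => [l ->|->].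
    rewrite eq_sym (negPf (neq_lift _ _)).
    rewrite (eq_bigr (fun i => D * (w i * A i l))) => [|i _].
      by rewrite -mulr_sumr wA mulr0.
    by rewrite AE !mxE eq_sym (negPf (neq_lift _ _)) mulr0 addr0; ring.
  rewrite eqxx (eq_bigr (fun i => D * ((y i 0 e + (p i)%:R) * w i))) => [|i _].
    by rewrite -mulr_sumr -/(E p) p1.
  by rewrite !mxE eqxx mulr1; ring.
have dD : `|\det (\matrix_(i, d) xx p i 0 (F d))| = 1.
  by rewrite xxE; case: (sign_cases p1) => ->; rewrite ?normrN normr1.
have entry i : (\sum_i (D * w i) *: ux R (F i)) 0 (F i) = D * w i.
  rewrite summxE (bigD1 i) //= big1 => [|j ji]; rewrite !mxE ?eqxx ?mulr1 ?addr0 //.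
  by rewrite (inj_eq F_inj) eq_sym (negPf ji) mulr0.
have sub : oddset (\sum_i (D * w i) *: ux R (F i)) \subset F @: setT.
  apply/subsetP=> j; rewrite inE; apply: contraLR => jF.
  rewrite summxE big1 => [|i _]; first by apply/negP=> /hfP[]; lra.
  rewrite !mxE; case: eqP => [jE|_]; last by rewrite mulr0.
  by case/negP: jF; rewrite jE imset_f.
have le4 : (#|oddset (\sum_i (D * w i) *: ux R (F i))| <= 4)%N.
  apply: leq_trans (subset_leq_card sub) _; apply: leq_trans (leq_imset_card _ _) _.
  by rewrite cardsT card_ord.
have := hmin_rows tX hX F_inj (xxX p) dD (tmU tX e) uE.
rewrite /= => /(_ _)/leq_trans/(_ le4); rewrite leqNgt s5 => H; apply/notF/H.
have [/existsP[i wi]|no] := boolP [exists i, hf (w i)].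
  apply/set0Pn; exists (F i); rewrite inE entry.
  by case/hfP: wi => ->; case: (sign_cases p1) => hD; rewrite /D hD /hf ?mul1r ?mulN1r ?opprK eqxx ?orbT.
have w1 i : `|w i| = 1.
  have := w_hv i; rewrite /hv orbC => /orP[h|/ivP h].
    by case/negP: no; apply/existsP; exists i.
  by case: h (wn i) => ->; rewrite ?eqxx // ?normrN normr1.
have : \sum_i `|w i| = k.+1%:R.
  by rewrite (eq_bigr (fun=> 1)) // big_const_ord iter_addr_0.
move: k3 Ed (hv_le1 hp) (hv_le1 hm); lra.
Qed.

End Circuit.

(** More than n vectors in dimension n contain a circuit. Circuits of size 1 and 2 are excluded by
    the hypotheses, larger ones by [circuit_absurd]. *)
Lemma indep_lines (V : {set I}) (y : I -> 'rV[R]_n.+1) :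
  (forall q, q \in V -> [/\ X (y q), X (y q + ux R e) & ~~ eqT [set~ e] (y q) 0]) ->
  (forall q r, q \in V -> r \in V -> q != r -> forall c, ~~ eqT [set~ e] (y q) (c *: y r)) ->
  (#|V| <= n)%N.
Proof.
move=> yP yn; rewrite leqNgt; apply/negP=> ltV.
pose yv (i : 'I_#|V|) := y (enum_val i).
pose M : 'M[R]_(#|V|, n) := \matrix_i drop e (yv i).
have nf : ~~ row_free M.
  by apply/negP=> /eqP rM; have := rank_leq_col M; rewrite rM leqNgt ltV.
pose dep k := [exists h : {ffun 'I_k -> 'I_#|V|}, injectiveb h && ~~ row_free (rowsub h M)].
have ex : exists k, dep k.
  exists #|V|; apply/existsP; exists [ffun i => i]; apply/andP; split.
    by apply/injectiveP=> i j; rewrite !ffunE.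
  by rewrite (_ : rowsub _ _ = M) //; apply/matrixP=> i j; rewrite mxE ffunE.
(* A dependent subfamily of minimal size is a circuit. *)
case: (ex_minnP ex) => k /existsP[h /andP[/injectiveP hi hnf]] kmin.
case: k => [|k] in h hi hnf kmin *.
  by case/negP: hnf; rewrite /row_free eqn_leq rank_leq_row.
have vV i : yv (h i) = y (enum_val (h i)) /\ enum_val (h i) \in V.
  by split=> //; apply: enum_valP.
have nz i : ~~ eqT [set~ e] (yv (h i)) 0.
  by have [-> /yP[]] := vV i.
have npar i j c : i != j -> ~~ eqT [set~ e] (yv (h i)) (c *: yv (h j)).
  move=> ij; have [-> iV] := vV i; have [-> jV] := vV j; apply: yn => //.
  by rewrite (inj_eq enum_val_inj) (inj_eq hi).
have AE : rowsub h M = \matrix_i drop e (yv (h i)).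
  by apply/matrixP=> i j; rewrite !mxE.
apply: (@circuit_absurd k (fun i => yv (h i))).
- by move=> i; have [-> /yP[]] := vV i.
- by move=> i; have [-> /yP[]] := vV i.
- by rewrite -AE.
- move=> i; rewrite -AE -[row_free _]negbK; apply/negP=> nfi.
  have : dep k.
    apply/existsP; exists [ffun j => h (lift i j)]; apply/andP; split.
      by apply/injectiveP=> a b; rewrite !ffunE => /hi/lift_inj.
    by rewrite (_ : rowsub _ _ = row' i (rowsub h M)) //; apply/matrixP=> a b; rewrite !mxE ffunE.
  by move/kmin; rewrite ltnn.
have : kermx (rowsub h M) != 0 by rewrite kermx_eq0.
rewrite -nz_row_eq0; set c := nz_row _ => c0.
have cA : c *m rowsub h M = 0 by apply/sub_kermxP; apply: nz_row_sub.
case: k => [|[|k]] // in h hi hnf kmin vV nz npar AE c c0 cA *; exfalso.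
  have cA0 : c 0 0 != 0.
    by apply: contra c0 => /eqP c00; apply/eqP/rowP=> i; rewrite ord1 c00 mxE.
  case/negP: (nz 0); apply/eqTP=> j; rewrite !inE; case: (unliftP e j) => [l -> _|->]; last by rewrite eqxx.
  have /rowP/(_ l) := cA; rewrite !mxE big_ord1 AE mxE dropE => /eqP.
  by rewrite mulf_eq0 (negPf cA0) => /eqP.
have rel l : c 0 0 * yv (h 0) 0 (lift e l) + c 0 1 * yv (h 1) 0 (lift e l) = 0.
  have /rowP/(_ l) := cA; rewrite !mxE !big_ord_recl big_ord0 addr0 AE !mxE.
  by rewrite (_ : lift ord0 ord0 = 1) //; apply/val_inj.
have [c00|c00] := eqVneq (c 0 0) 0.
  have c1 : c 0 1 != 0.
    apply: contra c0 => /eqP c01; apply/eqP/rowP=> i; rewrite mxE.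
    by case: (unliftP 0 i) => [j ->|->] //; rewrite (ord1 j) -c01; congr (c 0 _); apply/val_inj.
  case/negP: (nz 1); apply/eqTP=> j; rewrite !inE; case: (unliftP e j) => [l -> _|->]; last by rewrite eqxx.
  by have := rel l; rewrite c00 mul0r add0r mxE => /eqP; rewrite mulf_eq0 (negPf c1) => /eqP.
case/negP: (npar 0 1 (- (c 0 1 / c 0 0)) isT); apply/eqTP=> j; rewrite !inE.
case: (unliftP e j) => [l -> _|->]; last by rewrite eqxx.
apply: (mulfI c00); rewrite mxE mulNr mulrN mulrA mulrCA divff // mulr1.
by apply/eqP; rewrite -addr_eq0 rel.
Qed.

End Independence.

(** * Minimal odd sets *)

Section Frame.
Variable R : realFieldType.
Variable n : nat.
Implicit Types (X : 'rV[R]_n -> Prop) (S T : {set 'I_n}) (e b c d t : 'I_n) (x y z w h : 'rV[R]_n).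

Definition half X S := exists2 w, X w & forall j, j \in S -> hf (w 0 j).

Record frame X S : Prop := Frame {
  frT : tm X; frO : oddon X S; frH : half X S; frM : hmin #|S| X }.

Lemma hf_zintF a : hf a -> ~ @zint R a.
Proof.
by move=> ha za; have := ivNhf (hv_zint (hf_hv ha) za); rewrite ha.
Qed.

Lemma hf_add (a b : R) : hf a -> zint b -> hv (a + b) -> hf (a + b).
Proof.
move=> ha zb; rewrite /hv => /orP[/iv_zint zab|//]; case: (hf_zintF ha).
by have -> : a = (a + b) - b; [ring|apply: zintB].
Qed.

Lemma hf_subF (a b s s' : R) : hf a -> hf b -> s * s = 1 -> s' * s' = 1 -> ~~ hf (a - s * b * s').
Proof.
by move=> /hfP[]-> /hfP[]-> /sign_cases[]-> /sign_cases[]->; apply/negP=> /hfP[]; lra.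
Qed.

Lemma piv_at x t v : x 0 t * x 0 t = 1 -> piv x t v 0 t = x 0 t * v 0 t.
Proof.
by move=> xt; rewrite /piv !mxE eqxx mulrBr mulr1 mulrAC xt mul1r opprB addrCA subrr addr0.
Qed.

(** A pivot at [z] on j subtracts +-w_j from the entry w_k of a half-integral vector. Entry k
    becomes integral while entry j stays half-integral, so the odd set would shrink. *)
Lemma int_supp X S z j k : frame X S -> X z -> eqT (~: S) z 0 -> (forall i, i \in S -> iv (z 0 i)) ->
  j \in S -> k \in S -> z 0 j != 0 -> z 0 k != 0 -> j = k.
Proof.
move=> [tX oX [w wX wh] hX] zX z0 zi jS kS zj zk; have [//|jk] := eqVneq j k.
have zj1 := iv_sqr (zi _ jS) zj.
pose w' := piv z j w.
have w'X : pimg X z j w' by exists w.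
have w'j : w' 0 j = z 0 j * w 0 j.
  exact: piv_at.
have hj : hf (w' 0 j).
  rewrite w'j; case/hfP: (wh _ jS) => ->; case: (sign_cases zj1) => ->;
  by rewrite /hf ?mul1r ?mulN1r ?opprK eqxx ?orbT.
have sub : oddset w' \subset S :\ k.
  apply/subsetP=> i; rewrite !inE => hi; have [ij|ij] := eqVneq i j.
    by rewrite ij jk jS.
  have iS : i \in S.
    apply: contraLR hi => iS; rewrite pivE // (eqTP _ _ _ z0 i) ?inE // mxE mulr0 subr0.
    by apply: ivNhf; case: oX => oX _; apply: oX.
  rewrite iS andbT; apply: contraTneq hi => ik; rewrite ik pivE; last by rewrite eq_sym.
  exact: hf_subF (wh _ kS) (wh _ jS) zj1 (iv_sqr (zi _ kS) zk).
have := hminE (hmin_pimg tX zX zj1 hX) (tm_piv tX zX zj1) w'X.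
rewrite leqNgt; have -> : (#|oddset w'| < #|S|)%N.
  by apply: leq_ltn_trans (subset_leq_card sub) _; rewrite [ltnRHS](cardsD1 k) kS.
by move=> H; have // : ~~ true by apply: H; apply/set0Pn; exists j; rewrite inE.
Qed.

Lemma frame_piv X S x t : frame X S -> X x -> t \notin S -> x 0 t * x 0 t = 1 -> S != set0 ->
  frame (pimg X x t) S.
Proof.
move=> [tX oX [w wX wh] hX] xX tS xt /set0Pn[a aS].
have tX' := tm_piv tX xX xt; have oX' := odd_piv tX oX xX tS xt.
split=> //; last exact: hmin_pimg.
suff [v vX va] : exists2 v, X v & hf (piv x t v 0 a).
  have pX : pimg X x t (piv x t v) by exists v.
  by exists (piv x t v) => // j jS; apply: odd_hf tX' oX' pX aS jS va.
have at' : a != t by apply: contraNneq tS => <-.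
have ti : t \in ~: S by rewrite inE.
have oI := odd_intT oX.
case: (boolP (iv (x 0 a))) => [xa|xa].
  exists w => //; have hvw := tm_entry a tX' (ex_intro2 _ _ w wX erefl).
  rewrite pivE // in hvw *; apply: hf_add => //; first exact: wh.
  by apply/zintN/zintM/iv_zint => //; apply: zintM; apply: iv_zint; [apply: oI xX _ ti|apply: oI wX _ ti].
(* Here [x] is half-integral at a, so the pivoted unit vector of t is the new half-integral
   vector. *)
exists (ux R t); first exact: tmU.
rewrite pivE // !uxE (negPf at') eqxx mulr1 sub0r.
have xah : hf (x 0 a) by rewrite hf_iv ?xa //; apply: tm_entry tX xX.
case: (sign_cases xt) => ->; case/hfP: xah => ->;
  by rewrite /hf ?mul1r ?mulN1r ?opprK eqxx ?orbT.
Qed.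

(** A pivot at [y] turns [x] into a vector [r] with entry 1 at t and the entries of x - y on S.
    Pivoting a half-integral vector at [r] on b makes the columns of S where x and y differ
    integral, except b, while column t may become odd. Minimality of S thus allows at most two such
    columns. *)
Lemma pair_supp X S x y : frame X S -> X x -> X y -> eqT (~: S) x y -> ~~ eqT (~: S) y 0 ->
  (forall j, j \in S -> zint (x 0 j - y 0 j)) ->
  (#|[set j in S | (x 0 j != y 0 j)%R]| <= 2)%N.
Proof.
move=> fr xX yX xy y0 zi; have [tX oX hS hX] := fr.
have iT := odd_intT oX; have [t tT yt] := intT_neq0 iT yX y0.
have tS : t \notin S by rewrite inE in tT.
have [->|[b bD]] := set_0Vmem [set j in S | x 0 j != y 0 j]; first by rewrite cards0.
have [bS xyb] : b \in S /\ x 0 b != y 0 b by move: bD; rewrite inE => /andP[].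
have S0 : S != set0 by apply/set0Pn; exists b.
have fr' := frame_piv fr yX tS yt S0; have [tX' oX' [w wX wh] hX'] := fr'.
have dE k : k != t -> piv y t x 0 k = x 0 k - y 0 k.
  by move=> kt; rewrite (@piv_coord _ _ (~: S) y t x 1) ?scale1r ?mul1r.
pose r := piv y t x; have rX : pimg X y t r by exists x.
have bt : b != t by apply: contraNneq tS => <-.
have rt : r 0 t = 1.
  by rewrite /r piv_at // (eqTP _ _ _ xy t tT).
have ri j : j \in S -> iv (r 0 j).
  move=> jS; have jt : j != t by apply: contraNneq tS => <-.
  apply: hv_zint; first exact: tm_entry tX' rX.
  by rewrite dE //; apply: zi.
have rb1 : r 0 b * r 0 b = 1 by apply: iv_sqr (ri _ bS) _; rewrite dE // subr_eq0.
pose w' := piv r b w.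
have w'X : pimg (pimg X y t) r b w' by exists w.
have tX'' := tm_piv tX' rX rb1.
have hb : hf (w' 0 b).
  rewrite /w' piv_at //; case/hfP: (wh _ bS) => ->; case: (sign_cases rb1) => ->;
  by rewrite /hf ?mul1r ?mulN1r ?opprK eqxx ?orbT.
have sub : oddset w' \subset t |: (b |: [set j in S | x 0 j == y 0 j]).
  apply/subsetP=> i; rewrite !inE => hi; have [//|it] := eqVneq i t; have [//|ib] := eqVneq i b.
  have iS : i \in S.
    apply: contraLR hi => iS; rewrite pivE // (dE i it).
    rewrite (eqTP _ _ _ xy i) ?inE // subrr mulr0 subr0.
    by apply: ivNhf; case: oX' => oX' _; apply: oX'.
  rewrite iS /=; apply: contraTT hi => xyi.
  have rin : r 0 i != 0 by rewrite dE // subr_eq0.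
  by rewrite pivE //; apply: hf_subF (wh _ iS) (wh _ bS) rb1 (iv_sqr (ri _ iS) rin).
have := hminE (hmin_pimg tX' rX rb1 hX') tX'' w'X.
have nz : oddset w' != set0 by apply/set0Pn; exists b; rewrite inE.
move/(_ nz) => leS.
have : (#|S| <= 2 + #|[set j in S | (x 0 j == y 0 j)%R]|)%N.
  apply: leq_trans leS (leq_trans (subset_leq_card sub) _).
  apply: leq_trans (leq_card_setU _ _) _; rewrite cards1 -(addnA 1 1) leq_add2l.
  by apply: leq_trans (leq_card_setU _ _) _; rewrite cards1.
have := cardsID [set j | x 0 j == y 0 j] S.
rewrite (_ : S :&: _ = [set j in S | x 0 j == y 0 j]); last by apply/setP=> j; rewrite !inE.
rewrite (_ : S :\: _ = [set j in S | x 0 j != y 0 j]); last by apply/setP=> j; rewrite !inE andbC.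
by move=> <-; rewrite addnC leq_add2r.
Qed.

Lemma pivot_to_unit X T x y : tm X -> intT T X -> X x -> X (x + y) -> ~~ eqT T x 0 -> eqT T y 0 ->
  exists X' t, [/\ tm X', t \in T, X' (ux R t + y) & forall h, X h -> eqT T h 0 -> X' h].
Proof.
move=> tX iT xX xyX x0 y0; have [t tT xt] := intT_neq0 iT xX x0.
exists (pimg X x t), t; split=> //; first exact: tm_piv.
  exists (x + y) => //; rewrite linearD /= piv_row // piv_id //.
  by rewrite (eqTP _ _ _ y0) // mxE.
by move=> h hX h0; exists h => //; rewrite piv_id // (eqTP _ _ _ h0) // mxE.
Qed.

Lemma pivot_to_units X T x x' y y' : tm X -> intT T X -> X x -> X x' -> X (x + y) -> X (x' + y') ->
  ~~ eqT T x 0 -> ~~ eqT T x' 0 -> ~~ sim T x' x -> eqT T y 0 -> eqT T y' 0 ->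
  exists X' t t', [/\ tm X', t \in T /\ t' \in T :\ t, X' (ux R t + y), X' (ux R t' + y')
   & forall h, X h -> eqT T h 0 -> X' h].
Proof.
move=> tX iT xX x'X xyX x'yX x0 x'0 ns y0 y'0; have [t tT xt] := intT_neq0 iT xX x0.
have tX1 := tm_piv tX xX xt; have iT1 := intT_piv tX iT xX tT xt.
have pX v : X v -> pimg X x t (piv x t v) by exists v.
have y't : y' 0 t = 0 by rewrite (eqTP _ _ _ y'0) // mxE.
have yt : y 0 t = 0 by rewrite (eqTP _ _ _ y0) // mxE.
have x'n : ~~ eqT (T :\ t) (piv x t x') 0.
  by apply/negP=> /(piv_eq0 tT xt)/(sim_mul iT x'X xX x'0); apply/negP.
have y'0' : eqT (T :\ t) y' 0 by apply: eqT_sub y'0; apply: subD1set.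
have x'y : pimg X x t (piv x t x' + y').
  by exists (x' + y') => //; rewrite linearD /= (@piv_id _ _ _ y').
have [X' [t' [tX' t'T h1 h2]]] := pivot_to_unit tX1 iT1 (pX _ x'X) x'y x'n y'0'.
have t't : t' != t by move: t'T; rewrite !inE => /andP[].
have t'T' : t' \in T by move: t'T; rewrite !inE => /andP[].
exists X', t, t'; split=> //.
  apply: h2.
    by exists (x + y) => //; rewrite linearD /= piv_row // piv_id.
  apply/eqTP=> k; rewrite !inE => /andP[kt kT].
  by rewrite !mxE (negPf kt) (eqTP _ _ _ y0) // mxE addr0.
move=> h hX h0; apply: h2; last by apply: eqT_sub h0; apply: subD1set.
by exists h => //; rewrite piv_id // (eqTP _ _ _ h0) // mxE.
Qed.

(** The two signs give the two diagonals of the square. *)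
Lemma square_sign X e b y (s : R) : square X e b y -> s * s = 1 ->
  exists x, [/\ X x, X (x + (ux R e + s *: ux R b)) & x = y \/ x = y + ux R b].
Proof.
case=> h0 he hb heb /sign_cases[]->.
  by exists y; rewrite scale1r addrA; split=> //; left.
exists (y + ux R b); split=> //; last by right.
by rewrite scaleN1r addrACA subrr addr0.
Qed.

Lemma square_base_on X T e b y x : b \notin T -> x = y \/ x = y + ux R b -> eqT T x y.
Proof.
move=> bT [->|->]; first by apply/eqTP.
apply/eqTP=> k kT; rewrite !mxE; have /negPf-> : k != b by apply: contraNneq bT => <-.
by rewrite addr0.
Qed.

Lemma ux_on T e : e \notin T -> eqT T (ux R e) 0.
Proof.
by move=> eT; apply/eqTP=> k kT; rewrite !mxE; have /negPf-> : k != e by apply: contraNneq eT => <-.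
Qed.

Lemma eqT_comb T e b (s : R) : e \notin T -> b \notin T -> eqT T (ux R e + s *: ux R b) 0.
Proof.
move=> /ux_on/eqTP H /ux_on/eqTP H'; apply/eqTP=> k kT.
by have := H k kT; have := H' k kT; rewrite !mxE => -> ->; rewrite mulr0 addr0.
Qed.

Lemma sim_eqT T x x' y y' : eqT T x y -> eqT T x' y' -> sim T x x' = sim T y y'.
Proof.
move=> /eqTP H /eqTP H'.
by apply/simP/simP=> -[s s1 /eqTP E]; exists s => //; apply/eqTP=> k kT; have := E k kT;
   rewrite !mxE !H ?H' // -?H -?H'.
Qed.

Lemma two_squares X T e b c y y' (s s' : R) : tm X -> intT T X ->
  e \notin T -> b \notin T -> c \notin T ->
  square X e b y -> square X e c y' -> ~~ eqT T y 0 -> ~~ eqT T y' 0 -> ~~ sim T y' y ->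
  s * s = 1 -> s' * s' = 1 ->
  exists X' t t', [/\ tm X', t \in T /\ t' \in T :\ t, X' (ux R t + (ux R e + s *: ux R b)),
    X' (ux R t' + (ux R e + s' *: ux R c)) & forall h, X h -> eqT T h 0 -> X' h].
Proof.
move=> tX iT eT bT cT sq sq' y0 y'0 ns s1 s1'.
have [x [xX x1X xE]] := square_sign sq s1; have [x' [x'X x'1X x'E]] := square_sign sq' s1'.
have xy := square_base_on X e bT xE; have x'y := square_base_on X e cT x'E.
apply: (pivot_to_units tX iT xX x'X x1X x'1X); try exact: eqT_comb.
- by apply: contra y0 => /eqTP H; apply/eqTP=> k kT; rewrite -(eqTP _ _ _ xy k kT) H.
- by apply: contra y'0 => /eqTP H; apply/eqTP=> k kT; rewrite -(eqTP _ _ _ x'y k kT) H.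
by rewrite (sim_eqT x'y xy).
Qed.

(** Otherwise pivots turn diagonals of opposite sign into t + e + b and t' + e - b (unit vectors),
    whose minor in the columns e and b is -2. *)
Lemma squares_same X T e b y y' : tm X -> intT T X -> e \notin T -> b \notin T -> e != b ->
  square X e b y -> square X e b y' -> ~~ eqT T y 0 -> ~~ eqT T y' 0 -> sim T y' y.
Proof.
move=> tX iT eT bT eb sq sq' y0 y'0; rewrite -[sim _ _ _]negbK; apply/negP=> ns.
have N1 : (-1) * (-1) = 1 :> R by rewrite mulrNN mulr1.
have [X' [t [t' [tX' [tT t'T] h1 h2 _]]]] :=
  two_squares tX iT eT bT bT sq sq' y0 y'0 ns (mulr1 1) N1.
have t'T' : t' \in T by move: t'T; rewrite !inE => /andP[].
have nE k j : k \notin T -> j \in T -> (k == j) = false.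
  by move=> kT jT; apply/negbTE; apply: contraNneq kT => ->.
have ne := (nE e t eT tT, nE e t' eT t'T', nE b t bT tT, nE b t' bT t'T').
have := tm_det2 tX' h1 h2 eb; rewrite !mxE !ne !eqxx (negPf eb) (eq_sym b) (negPf eb) /=.
by move/hv_le1; lra.
Qed.

(** Otherwise diagonals in directions e + s b and e + s' c can be based at two different unit
    vectors, with s and s' chosen against the signs of [h]. Two pivots then triple the entry of [h]
    at e, which becomes +-3/2. *)
Lemma squares_half X T e b c y y' h : tm X -> intT T X ->
  e \notin T -> b \notin T -> c \notin T -> e != b -> e != c -> b != c ->
  square X e b y -> square X e c y' -> ~~ eqT T y 0 -> ~~ eqT T y' 0 ->
  X h -> eqT T h 0 -> hf (h 0 e) -> hf (h 0 b) -> hf (h 0 c) -> sim T y' y.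
Proof.
move=> tX iT eT bT cT eb ec bc sq sq' y0 y'0 hX h0 he hb hc.
rewrite -[sim _ _ _]negbK; apply/negP=> ns.
have sgn (a a' : R) : hf a -> hf a' -> exists2 s, s * s = 1 & s * a' = - a.
  by move=> /hfP[]-> /hfP[]->; [exists (-1)|exists 1|exists 1|exists (-1)]; lra.
have [s s1 sE] := sgn _ _ he hb; have [s' s1' sE'] := sgn _ _ he hc.
have [X' [t [t' [tX' [tT t'T] h1 h2 hh]]]] :=
  two_squares tX iT eT bT cT sq sq' y0 y'0 ns s1 s1'.
have t'T' : t' \in T by move: t'T; rewrite !inE => /andP[].
have nE k j : k \notin T -> j \in T -> (k == j) = false.
  by move=> kT jT; apply/negbTE; apply: contraNneq kT => ->.
have ne := (nE e t eT tT, nE e t' eT t'T', nE b t bT tT, nE b t' bT t'T', nE c t cT tT, nE c t' cT t'T').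
pose r : 'rV[R]_n := ux R t + (ux R e + s *: ux R b); pose r' : 'rV[R]_n := ux R t' + (ux R e + s' *: ux R c).
have rE : [/\ r 0 b = s, r 0 e = 1 & r 0 c = 0].
  rewrite !mxE !ne !eqxx (eq_sym c) (eq_sym c) (eq_sym b e) (negPf eb) (negPf bc) (negPf ec).
  by rewrite !mulr0 !mulr1 !add0r !addr0.
have rE' : [/\ r' 0 b = 0, r' 0 e = 1 & r' 0 c = s'].
  rewrite !mxE !ne !eqxx (eq_sym c e) (eq_sym b e) (negPf eb) (negPf bc) (negPf ec).
  by rewrite !mulr0 !mulr1 !add0r !addr0.
have [rb re rc] := rE; have [rb' re' rc'] := rE'.
have r1 : r 0 b * r 0 b = 1 by rewrite rb.
have r1' : r' 0 c * r' 0 c = 1 by rewrite rc'.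
have tX1 := tm_piv tX' h1 r1.
have r'X : pimg X' r b r' by exists r' => //; rewrite piv_id.
have hX1 : pimg X' r b (piv r b h) by exists h => //; apply: hh.
have := tm_entry e (tm_piv tX1 r'X r1') (ex_intro2 _ _ _ hX1 erefl).
have cb : c != b by rewrite eq_sym.
rewrite pivE // (pivE _ _ eb) (pivE _ _ cb) -/r -/r' rb re rc rc' re' mulr0 subr0 !mulr1 sE sE'.
by case/hfP: he => -> /hv_le1; lra.
Qed.

End Frame.

Section FrameLine.
Variable R : realFieldType.
Variable n : nat.
Implicit Types (X : 'rV[R]_n.+1 -> Prop) (S : {set 'I_n.+1}) (v w : 'rV[R]_n.+1).

Lemma hf_ratio (a b c : R) : hf a -> hf b -> a = c * b -> c * c = 1.
Proof. by move=> /hfP[]-> /hfP[]->; nra. Qed.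

Lemma hf_diff (a b : R) : hf a -> hf b -> a != b -> (a - b) * (a - b) = 1.
Proof. by move=> /hfP[]-> /hfP[]->; rewrite ?eqxx // => _; lra. Qed.

Lemma hf_sign (a s : R) : s * s = 1 -> hf a -> hf (s * a).
Proof.
by move=> /sign_cases[]-> /hfP[]->; rewrite /hf ?mul1r ?mulN1r ?opprK eqxx ?orbT.
Qed.

(** If [v] is non-zero outside S, an integral column there gives c = +-1, and a further column of S,
    where v = c w, makes the difference at e integral. If [v] vanishes outside S, then [int_supp]
    forces both vectors to be half-integral on S. Three columns ensure that S has one besides e and
    k. *)
Lemma frame_line X S e : frame X S -> e \in S -> (2 < #|S|)%N -> linep X e.
Proof.
move=> fr eS S3 v w c vX wX vw vn vNw; have [tX oX hS hX] := fr.
have iT := odd_intT oX; have eT : e \notin ~: S by rewrite inE eS.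
have vwe : v 0 e != c * w 0 e.
  apply: contra vNw => /eqP E; apply/eqP/rowP=> k; have [->|ke] := eqVneq k e; first by rewrite mxE.
  by rewrite (eqTP _ _ _ vw) // !inE.
have other k : exists b, [/\ b \in S, b != e & b != k].
  have : (0 < #|S :\ e :\ k|)%N.
    have := cardsD1 k (S :\ e); have := cardsD1 e S; rewrite eS.
    by case: (k \in S :\ e) => h1 h2; move: S3; rewrite h1 h2 ?add0n ?add1n !ltnS; [|apply: ltnW].
  by case/card_gt0P=> b; rewrite !inE => /and3P[bk be bS]; exists b.
have vwk k : k != e -> v 0 k = c * w 0 k.
  by move=> ke; rewrite (eqTP _ _ _ vw k) ?inE // mxE.
have [v0|v0] := boolP (eqT (~: S) v 0); last first.
  have [t tT vt] := neqTP v0; rewrite mxE in vt.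
  have te : t != e by apply: contraNneq eT => <-.
  have c1 : c * c = 1.
    have := iT _ vX _ tT; have := iT _ wX _ tT; move: vt; rewrite vwk //.
    by move=> + /ivP[] E; rewrite E ?mulr0 ?eqxx // => + /ivP[] h; rewrite h ?eqxx // => _; nra.
  split=> //; have cwX := tm_sign tX wX c1.
  have cw0 : ~~ eqT (~: S) (c *: w) 0.
    apply/negP=> /eqTP/(_ t tT); rewrite !mxE -vwk // => E.
    by rewrite E eqxx in vt.
  have vcw : eqT (~: S) v (c *: w).
    by apply: eqT_sub vw; apply/subsetP=> k; rewrite !inE; apply: contraNneq => ->.
  have := two_term tX iT eT cwX vX cw0 vcw; rewrite mxE => hvd.
  apply: iv_sqr; last by rewrite subr_eq0.
  apply: hv_zint hvd _; have [b [bS be _]] := other e.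
  have -> : v 0 e - c * w 0 e = (v 0 e - v 0 b) - ((c *: w) 0 e - (c *: w) 0 b).
    by rewrite !mxE (vwk b be); ring.
  by case: oX => _ oX; apply: zintB; apply: oX.
have [k kE vk] := neqTP vn; rewrite mxE in vk.
have ke : k != e by move: kE; rewrite !inE.
have kS : k \in S.
  by apply: contraNT vk => kS; rewrite (eqTP _ _ _ v0) ?inE // mxE.
have c0 : c != 0 by apply: contraNneq vk => c0; rewrite vwk // c0 mul0r.
have w0 : eqT (~: S) w 0.
  apply/eqTP=> j jT; have je : j != e by apply: contraNneq eT => <-.
  apply/eqP; have := eqTP _ _ _ v0 j jT; rewrite vwk // !mxE => /eqP.
  by rewrite mulf_eq0 (negPf c0).
have wk : w 0 k != 0 by apply: contraNneq vk => wk; rewrite vwk // wk mulr0.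
have [b [bS be bk]] := other k.
have allS x (i j : 'I_n.+1) : X x -> i \in S -> j \in S -> hf (x 0 i) -> hf (x 0 j).
  by move=> xX iS jS; apply: odd_hf tX oX xX iS jS.
have cases x : X x -> (forall i, i \in S -> hf (x 0 i)) \/ (forall i, i \in S -> iv (x 0 i)).
  move=> xX; have [xk|xk] := boolP (hf (x 0 k)); first by left=> i iS; apply: allS xX kS iS xk.
  right=> i iS; apply: contraNT xk; rewrite -hf_iv; last exact: tm_entry tX xX.
  by apply: allS.
have [vh|vi] := cases _ vX; have [wh|wi] := cases _ wX.
- have c1 := hf_ratio (vh _ kS) (wh _ kS) (vwk _ ke).
  by split=> //; apply: hf_diff (vh _ eS) (hf_sign c1 (wh _ eS)) vwe.
- have wb : w 0 b != 0.
    by apply: contraTneq (hf_neq0 (vh _ bS)) => E; rewrite vwk // E mulr0 eqxx.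
  by case/eqP: bk; apply: int_supp fr wX w0 wi bS kS wb wk.
- have vb : v 0 b != 0 by rewrite vwk // mulf_neq0 // hf_neq0 ?wh.
  by case/eqP: bk; apply: int_supp fr vX v0 vi bS kS vb vk.
have z x : X x -> eqT (~: S) x 0 -> (forall i, i \in S -> iv (x 0 i)) -> x 0 k != 0 -> x 0 e = 0.
  move=> xX x0 xi xk; apply/eqP; apply: contraNT ke => xe; apply/eqP.
  exact: int_supp fr xX x0 xi kS eS xk xe.
by rewrite (z v) // (z w) // mulr0 eqxx in vwe.
Qed.

End FrameLine.

(** * Pairs differing by a unit vector for three or four odd columns *)

Section SmallLines.
Variable R : realFieldType.
Variable n : nat.
Implicit Types (X : 'rV[R]_n -> Prop) (S T : {set 'I_n}) (e b k : 'I_n) (u v w h : 'rV[R]_n).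

(** The bounds for v + e against w and for w + e against v make the entries at e equal. Then v + e
    and w differ at e, and [pair_supp] leaves one further column. Two pairs in one fibre therefore
    form a square. *)
Lemma line_pair X S e v w : frame X S -> e \in S -> X v -> X (v + ux R e) -> X w -> X (w + ux R e) ->
  eqT (~: S) v w -> ~~ eqT (~: S) w 0 -> ~~ eqT [set~ e] v w ->
  exists2 b, b \in S :\ e & v = w + ux R b \/ w = v + ux R b.
Proof.
move=> fr eS vX v1X wX w1X vw w0 nvw; have [tX oX hS hX] := fr.
have iT := odd_intT oX; have eT : e \notin ~: S by rewrite inE eS.
have eE x : eqT (~: S) (x + ux R e) x.
  by apply/eqTP=> k kT; rewrite mxE (eqTP _ _ _ (ux_on R eT) k kT) mxE addr0.
have v1w : eqT (~: S) (v + ux R e) w.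
  by apply/eqTP=> k kT; rewrite (eqTP _ _ _ (eE v) k kT) (eqTP _ _ _ vw k kT).
have vw1 : eqT (~: S) v (w + ux R e).
  by apply/eqTP=> k kT; rewrite (eqTP _ _ _ (eE w) k kT) (eqTP _ _ _ vw k kT).
have w10 : ~~ eqT (~: S) (w + ux R e) 0.
  by apply: contra w0 => /eqTP H; apply/eqTP=> k kT; rewrite -(eqTP _ _ _ (eE w) k kT) H.
have de : v 0 e = w 0 e.
  have := hv_le1 (two_term tX iT eT wX v1X w0 v1w); have := hv_le1 (two_term tX iT eT w1X vX w10 vw1).
  by rewrite !mxE eqxx /=; lra.
have zi j : j \in S -> zint (v 0 j - w 0 j).
  move=> jS; have -> : v 0 j - w 0 j = (v 0 j - v 0 e) - (w 0 j - w 0 e) by rewrite de; ring.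
  by case: oX => _ oX; apply: zintB; apply: oX.
have zi1 j : j \in S -> zint ((v + ux R e) 0 j - w 0 j).
  move=> jS; rewrite !mxE addrAC; apply: zintD; first exact: zi.
  by apply: iv_zint; rewrite /iv; case: (j == e); rewrite ?eqxx ?orbT.
have D2 := pair_supp fr v1X wX v1w w0 zi1.
have [b be vb] := neqTP nvw; rewrite !inE in be.
have bS : b \in S.
  by apply: contraNT vb => bS; rewrite (eqTP _ _ _ vw) ?inE.
have oth k : k != e -> k != b -> v 0 k = w 0 k.
  move=> ke kb; have [kS|kS] := boolP (k \in S); last by rewrite (eqTP _ _ _ vw) ?inE.
  apply/eqP; move: D2; rewrite leqNgt; apply: contraNT => vk.
  apply/card_gt2P; exists e, b, k; rewrite !inE !mxE eS bS kS !eqxx (negPf ke) (negPf be) /=.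
  rewrite !addr0; split; split=> //; [|by rewrite eq_sym|by rewrite eq_sym].
  by apply/eqP; rewrite de; lra.
exists b; first by rewrite !inE be.
have /sign_cases[d|d] : (v 0 b - w 0 b) * (v 0 b - w 0 b) = 1.
  apply: iv_sqr; last by rewrite subr_eq0.
  apply: hv_zint (zi _ bS).
  by apply: two_term tX iT _ wX vX w0 vw; rewrite inE bS.
- left; apply/rowP=> k; rewrite !mxE; have [->|kb] := eqVneq k b; first by move: d => /= ; lra.
  rewrite addr0; have [->//|ke] := eqVneq k e; exact: oth.
right; apply/rowP=> k; rewrite !mxE; have [->|kb] := eqVneq k b; first by move: d => /= ; lra.
rewrite addr0; have [->//|ke] := eqVneq k e; exact/esym/oth.
Qed.

(** If [u] were integral, then [u] or [u + ux e] would have non-zero entries at e and at another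
    column of S, against [int_supp]. *)
Lemma line_half X S e u : frame X S -> e \in S -> X u -> X (u + ux R e) -> eqT (~: S) u 0 ->
  ~~ eqT [set~ e] u 0 -> (forall k, k \in S -> hf (u 0 k)) /\ u 0 e = - 2^-1.
Proof.
move=> fr eS uX u1X u0 un; have [tX oX hS hX] := fr.
have eT : e \notin ~: S by rewrite inE eS.
have [k ke uk] := neqTP un; rewrite mxE in uk; rewrite !inE in ke.
have kS : k \in S by apply: contraNT uk => kS; rewrite (eqTP _ _ _ u0) ?inE // mxE.
have u1e : (u + ux R e) 0 e = u 0 e + 1 by rewrite !mxE eqxx.
have u1k j : j != e -> (u + ux R e) 0 j = u 0 j by move=> je; rewrite !mxE (negPf je) addr0.
have hu := tm_entry e tX uX; have hu1 := tm_entry e tX u1X; rewrite u1e in hu1.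
have [ue|ue] := boolP (hf (u 0 e)).
  split=> [j jS|]; first exact: odd_hf tX oX uX eS jS ue.
  by case/hfP: ue hu1 => -> // /hv_le1; lra.
have ui j : j \in S -> iv (u 0 j).
  move=> jS; apply: contraNT ue => uj; apply: (odd_hf tX oX uX jS eS).
  by rewrite hf_iv //; apply: tm_entry tX uX.
have [ue0|ue0] := eqVneq (u 0 e) 0; last first.
  by case/eqP: ke; apply: int_supp fr uX u0 ui kS eS uk ue0.
have u1i j : j \in S -> iv ((u + ux R e) 0 j).
  move=> jS; have [->|je] := eqVneq j e; last by rewrite u1k // ui.
  by rewrite u1e ue0 add0r /iv eqxx orbT.
have u10 : eqT (~: S) (u + ux R e) 0.
  apply/eqTP=> j jT; have je : j != e by apply: contraNneq eT => <-.
  by rewrite u1k // (eqTP _ _ _ u0 j jT).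
case/eqP: (ke); apply: (int_supp fr u1X u10 u1i kS eS); first by rewrite u1k.
by rewrite u1e ue0 add0r oner_neq0.
Qed.

Lemma code_sign S e b u w : (forall k, k \in S -> hf (u 0 k)) -> (forall k, k \in S -> hf (w 0 k)) ->
  eqT (~: S) u 0 -> eqT (~: S) w 0 -> b \in S :\ e ->
  [set k in S :\ e :\ b | u 0 k == u 0 b] = [set k in S :\ e :\ b | w 0 k == w 0 b] ->
  exists2 s, s * s = 1 & eqT [set~ e] u (s *: w).
Proof.
move=> uh wh u0 w0; rewrite !inE => /andP[be bS] E.
have [s s1 sE] : exists2 s, s * s = 1 & u 0 b = s * w 0 b.
  by case/hfP: (uh _ bS) => ->; case/hfP: (wh _ bS) => ->;
    [exists 1|exists (-1)|exists (-1)|exists 1]; lra.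
exists s => //; apply/eqTP=> k; rewrite !inE mxE => ke.
have [->//|kb] := eqVneq k b.
have [kS|kS] := boolP (k \in S); last by rewrite (eqTP _ _ _ u0) ?(eqTP _ _ _ w0) ?inE // !mxE mulr0.
have /setP/(_ k) := E; rewrite !inE ke kb kS /= => Ek.
have flip (v : 'rV[R]_n) : (forall k, k \in S -> hf (v 0 k)) -> v 0 k != v 0 b -> v 0 k = - v 0 b.
  by move=> vh; case/hfP: (vh _ kS) => ->; case/hfP: (vh _ bS) => ->; rewrite ?eqxx ?opprK.
have [uk|uk] := eqVneq (u 0 k) (u 0 b).
  by move: Ek; rewrite uk eqxx => /esym/eqP->.
rewrite (flip u) // (flip w) //; first by rewrite sE mulrN.
by rewrite -Ek.
Qed.

Variable I : finType.

(** Off e and up to sign, a half-integral vector is determined by the columns of S other than e and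
    b where it agrees with its entry at b. If all these subsets occur, all sign patterns on S do,
    because both members of each pair are in X. *)
Lemma half_lines X S e b (U : {set I}) (y : I -> 'rV[R]_n) : frame X S -> e \in S -> b \in S :\ e ->
  (forall q, q \in U -> [/\ X (y q), X (y q + ux R e), eqT (~: S) (y q) 0 & ~~ eqT [set~ e] (y q) 0]) ->
  (forall q r, q \in U -> r \in U -> q != r -> forall c, ~~ eqT [set~ e] (y q) (c *: y r)) ->
  (#|U| <= 2 ^ (#|S| - 2))%N /\
  ((2 ^ (#|S| - 2) <= #|U|)%N ->
   forall h, eqT (~: S) h 0 -> (forall k, k \in S -> hf (h 0 k)) -> X h).
Proof.
move=> fr eS bS yU yN; have [tX oX hS hX] := fr.
pose B := S :\ e :\ b.
have cB : #|B| = (#|S| - 2)%N.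
  by have := cardsD1 e S; rewrite eS (cardsD1 b (S :\ e)) bS => ->; rewrite addnA addKn.
pose code (v : 'rV[R]_n) := [set k in B | v 0 k == v 0 b].
have inj : {in U &, injective (fun q => code (y q))}.
  move=> q r qU rU E; have [//|qr] := eqVneq q r.
  have [qX q1 q0 qn] := yU q qU; have [rX r1 r0 rn] := yU r rU.
  have [hq _] := line_half fr eS qX q1 q0 qn; have [hr _] := line_half fr eS rX r1 r0 rn.
  have [s _ H] := code_sign hq hr q0 r0 bS E.
  by have := yN q r qU rU qr s; rewrite H.
pose C := [set code (y q) | q in U].
have CB : C \subset powerset B.
  by apply/subsetP=> _ /imsetP[q _ ->]; rewrite inE; apply/subsetP=> k; rewrite inE => /andP[].
have cC : #|C| = #|U| by apply: card_in_imset.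
have cP : #|powerset B| = (2 ^ (#|S| - 2))%N by rewrite card_powerset cB.
split; first by rewrite -cC -cP; apply: subset_leq_card.
rewrite -cC -cP => ge h h0 hh.
have CE : C = powerset B by apply/eqP; rewrite eqEcard CB.
have : code h \in C.
  by rewrite CE inE; apply/subsetP=> k; rewrite inE => /andP[].
case/imsetP=> q qU E; have [qX q1 q0 qn] := yU q qU.
have [hq qe] := line_half fr eS qX q1 q0 qn.
have [s s1 H] := code_sign hh hq h0 q0 bS E.
have sE x : eqT [set~ e] x (y q) -> x 0 e = s * h 0 e -> h = s *: x.
  move=> xE xe; apply/rowP=> k; rewrite mxE; have [->|ke] := eqVneq k e.
    by rewrite xe mulrA s1 mul1r.
  by rewrite (eqTP _ _ _ H) ?inE // mxE (eqTP _ _ _ xE) ?inE.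
have /hfP[se|se] := hf_sign s1 (hh _ eS).
  rewrite (sE (y q + ux R e)); first exact: tm_sign.
    by apply/eqTP=> k; rewrite !inE => /negPf ke; rewrite !mxE ke addr0.
  by rewrite se !mxE eqxx qe /=; lra.
rewrite (sE (y q)); [exact: tm_sign|by apply/eqTP|by rewrite se qe].
Qed.

(** Adding a unit vector changes the sum of the coordinates by 1, and three signs never add up to
    0. *)
Lemma leq_3class (A : {set I}) (f : I -> 'rV[R]_n) :
  {in A &, forall i j, i != j -> exists b, f i = f j + ux R b \/ f j = f i + ux R b} -> (#|A| <= 2)%N.
Proof.
move=> H; rewrite leqNgt; apply/negP=> /card_gt2P[i [j [k [[iA jA kA] [ij jk ki]]]]].
have [b Hb] := H i j iA jA ij; have [c Hc] := H j k jA kA jk; have [d Hd] := H k i kA iA ki.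
have sE (v w : 'rV[R]_n) (a : 'I_n) : v = w + ux R a \/ w = v + ux R a ->
    exists2 s, s * s = 1 & \sum_l v 0 l = \sum_l w 0 l + s.
  have sum1 : \sum_l (ux R a) 0 l = 1.
    by rewrite (bigD1 a) //= big1 ?uxE ?eqxx ?addr0 // => l /negPf la; rewrite uxE la.
  have sumD (x : 'rV[R]_n) : \sum_l (x + ux R a) 0 l = \sum_l x 0 l + 1.
    by rewrite -sum1 -big_split; apply: eq_bigr => l _; rewrite mxE.
  case=> ->; [exists 1|exists (-1)]; rewrite ?mulrNN ?mulr1 // sumD // addrK //.
have [s s1 {}Hb] := sE _ _ _ Hb; have [s' s1' {}Hc] := sE _ _ _ Hc; have [s'' s1'' {}Hd] := sE _ _ _ Hd.
have : s + s' + s'' = 0 by move: Hb Hc Hd; lra.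
by case: (sign_cases s1) => ->; case: (sign_cases s1') => ->; case: (sign_cases s1'') => ->; lra.
Qed.

Lemma small_linesE (k u a p t v m : nat) : (v <= u + p + a -> p <= t -> k + t = m ->
  u + a <= k -> v <= m)%N.
Proof. lia. Qed.

(** [U] collects the pairs supported in S; the others lie in fibres over the complement of S. There
    are at most as many fibres as columns outside S, by [width_sum] in direction e. The fibres in
    [A] contain two pairs, hence a square in columns e and b, and b determines the fibre by
    [squares_same]. Two such fibres leave [U] empty by [squares_half]; with at most one, |U| + |A|
    <= |S| unless |S| = 4, |U| = 4 and |A| = 1. *)
Lemma small_lines X S e (V : {set I}) (y : I -> 'rV[R]_n) : frame X S -> e \in S ->
  #|S| = 3%N \/ #|S| = 4%N ->
  (forall q, q \in V -> [/\ X (y q), X (y q + ux R e) & ~~ eqT [set~ e] (y q) 0]) ->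
  (forall q r, q \in V -> r \in V -> q != r -> forall c, ~~ eqT [set~ e] (y q) (c *: y r)) ->
  (#|V| <= n)%N \/
  [/\ #|S| = 4%N, exists b y0, [/\ b \in S, b != e, square X e b y0 & ~~ eqT (~: S) y0 0]
    & forall h, eqT (~: S) h 0 -> (forall k, k \in S -> hf (h 0 k)) -> X h].
Proof.
move=> fr eS S34 yV yN; have [tX oX hS hX] := fr.
have iT := odd_intT oX; have eT : e \notin ~: S by rewrite inE eS.
have yX q : q \in V -> X (y q) by case/yV.
have [P [fib [z F]]] := fibered_exists (~: S) tX yX.
(* Lower end of the pair of i after the sign change made by [z]: negation swaps the two ends of a
   pair. *)
pose bb q i := if z q i == y i then y i else - y i - ux R e.
have eE x : eqT (~: S) (x + ux R e) x.
  by apply/eqTP=> k kT; rewrite mxE (eqTP _ _ _ (ux_on R eT) k kT) mxE addr0.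
have bbP q i : i \in fib q -> [/\ X (bb q i), X (bb q i + ux R e),
    eqT (~: S) (bb q i) (z q i) & exists2 s, s * s = 1 & eqT [set~ e] (bb q i) (s *: y i)].
  move=> iq; have iV := fib_sub F iq; have [iX i1X _] := yV i iV.
  rewrite /bb; have [E|NE] := eqVneq (z q i) (y i).
    split=> //; first by rewrite E; apply/eqTP.
    by exists 1; rewrite ?mulr1 // scale1r; apply/eqTP.
  have E : z q i = - y i by case: (fib_pm F iq) NE => // ->; rewrite eqxx.
  split.
  - by have -> : - y i - ux R e = - (y i + ux R e) by [rewrite opprD]; apply: tmN.
  - by rewrite subrK; apply: tmN.
  - rewrite E; apply/eqTP=> k kT; rewrite !mxE; have := eqTP _ _ _ (ux_on R eT) k kT.
    by rewrite !mxE => ->; rewrite subr0.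
  exists (-1); first by rewrite mulrNN mulr1.
  by apply/eqTP=> k; rewrite !inE => /negPf ke; rewrite !mxE ke subr0 mulN1r.
have bb0 q i : i \in fib q -> ~~ eqT (~: S) (bb q i) 0.
  move=> iq; have [_ _ E _] := bbP q i iq; apply: contra (fibn F iq) => /eqTP H.
  by apply/eqTP=> k kT; rewrite -(eqTP _ _ _ E k kT) H.
have pr q i j : i \in fib q -> j \in fib q -> i != j ->
    exists2 b, b \in S :\ e & bb q i = bb q j + ux R b \/ bb q j = bb q i + ux R b.
  move=> iq jq ij; have [iX i1 iE [s s1 iY]] := bbP q i iq; have [jX j1 jE [s' s1' jY]] := bbP q j jq.
  apply: (line_pair fr eS) => //; last 1 first.
  - apply: contra (yN _ _ (fib_sub F iq) (fib_sub F jq) ij (s * s')) => /eqTP H.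
    apply/eqTP=> k kT; have := H k kT; rewrite (eqTP _ _ _ iY k kT) (eqTP _ _ _ jY k kT) !mxE => E.
    by rewrite -mulrA -E mulrA s1 mul1r.
  - apply/eqTP=> k kT.
    by rewrite (eqTP _ _ _ iE k kT) (eqTP _ _ _ jE k kT) (eqTP _ _ _ (fibE F iq jq) k kT).
  exact: bb0 jq.
have f2 q : (#|fib q| <= 2)%N.
  by apply: (@leq_3class _ (bb q)) => i j iq jq /(pr q i j iq jq)[b _ E]; exists b.
pose A := [set q in P | 1 < #|fib q|]%N.
pose U := [set i in V | eqT (~: S) (y i) 0].
have cV : (#|V| <= #|U| + #|P| + #|A|)%N.
  rewrite (fibC F) -addnA leq_add2l.
  have -> : #|A| = (\sum_(q in P) (1 < #|fib q|))%N.
    by rewrite -sum1_card big_mkcond [RHS]big_mkcond; apply: eq_bigr => q _; rewrite inE;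
       case: (q \in P) => //=; case: ifP.
  rewrite -sum1_card -big_split; apply: leq_sum => q qP.
  by have := f2 q; case: (#|fib q|) => [|[|[|m]]].
have /fin_all_exists[rep repP] : forall q, exists i, q \in P -> i \in fib q.
  move=> q; have [qP|_] := boolP (q \in P); last by exists q.
  by have /set0Pn[i iq] := fib0 F qP; exists i.
have simz q r i j v w : q \in P -> r \in P -> i \in fib q -> j \in fib r ->
    eqT (~: S) v (z q i) -> eqT (~: S) w (z r j) -> sim (~: S) v w -> q = r.
  move=> qP rP iq jr vE wE; rewrite (sim_eqT vE wE) => H; have [//|qr] := eqVneq q r.
  by have := fibs F qP rP qr iq jr; rewrite H.
have cP : (#|P| <= #|~: S|)%N.
  have := @width_sum _ _ X (~: S) e I P (fun q => bb q (rep q)) (fun q => bb q (rep q) + ux R e) tX iT eT.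
  rewrite /wsum (eq_bigr (fun _ => 1)); last by move=> q qP; rewrite !mxE eqxx /=; lra.
  rewrite sumr_const -/(_%:R) ler_nat; apply.
    move=> q qP; have iq := repP q qP; have [iX i1 iE _] := bbP q _ iq.
    split=> //; [exact: bb0|by rewrite !mxE eqxx /=; lra].
  move=> q r qP rP qr; apply: contra qr => H; apply/eqP.
  have [_ _ qE _] := bbP q _ (repP q qP); have [_ _ rE _] := bbP r _ (repP r rP).
  exact: simz qP rP (repP q qP) (repP r rP) qE rE H.
have /fin_all_exists[sq sqP] : forall q, exists p : 'I_n * 'rV[R]_n, q \in A ->
    [/\ p.1 \in S :\ e, square X e p.1 p.2, ~~ eqT (~: S) p.2 0 &
      exists2 i, i \in fib q & eqT (~: S) p.2 (z q i)].
  move=> q; have [qA|_] := boolP (q \in A); last by exists (e, 0).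
  have := qA; rewrite inE => /andP[qP /card_gt1P[i [j [iq jq ij]]]].
  have mk (k l : I) b : k \in fib q -> l \in fib q -> b \in S :\ e -> bb q k = bb q l + ux R b ->
      exists p : 'I_n * 'rV[R]_n, [/\ p.1 \in S :\ e, square X e p.1 p.2,
        ~~ eqT (~: S) p.2 0 & exists2 i, i \in fib q & eqT (~: S) p.2 (z q i)].
    move=> kq lq bS E; exists (b, bb q l) => /=; have [lX l1 lE _] := bbP q l lq.
    have [kX k1 _ _] := bbP q k kq; split=> //; [|exact: bb0|by exists l].
    by split=> //; rewrite -?E // addrAC -E.
  have [b bS [E|E]] := pr q i j iq jq ij.
    by have [p pP] := mk i j b iq jq bS E; exists p.
  by have [p pP] := mk j i b jq iq bS E; exists p.
pose beta q := (sq q).1.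
have AP q : q \in A -> q \in P by rewrite inE => /andP[].
have nT b : b \in S :\ e -> (b \notin ~: S) /\ e != b.
  by rewrite !inE negbK eq_sym => /andP[-> ->].
have bI : {in A &, injective beta}.
  move=> q r qA rA E; have [bq sqq q0 [i iq qE]] := sqP q qA; have [br sqr r0 [j jr rE]] := sqP r rA.
  have [bT eb] := nT _ bq; rewrite -/(beta q) -/(beta r) -?E in sqq sqr bT eb.
  apply: simz (AP _ qA) (AP _ rA) iq jr qE rE _; rewrite sim_sym.
  exact: squares_same tX iT eT bT eb sqq sqr q0 r0.
have cA : (#|A| < #|S|)%N.
  rewrite -(card_in_imset bI) (cardsD1 e S) eS add1n ltnS; apply: subset_leq_card.
  by apply/subsetP=> _ /imsetP[q /sqP[bq _ _ _] ->].
have cT : (#|S| + #|~: S| = n)%N by rewrite cardsC card_ord.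
have UV q : q \in U -> [/\ X (y q), X (y q + ux R e), eqT (~: S) (y q) 0 & ~~ eqT [set~ e] (y q) 0].
  by rewrite inE => /andP[/yV[h1 h2 h3] h4].
have UN q r : q \in U -> r \in U -> q != r -> forall c, ~~ eqT [set~ e] (y q) (c *: y r).
  by rewrite !inE => /andP[qV _] /andP[rV _]; apply: yN.
have [A2|A1] := ltnP 1 #|A|.
  left; move: cV; suff -> : U = set0 by rewrite cards0; lia.
  apply/setP=> h; rewrite [RHS]inE; apply/negP=> hU; have [hX' h1 h0 hn] := UV h hU.
  have [hh _] := line_half fr eS hX' h1 h0 hn.
  have /card_gt1P[q [r [qA rA qr]]] := A2.
  have [bq sqq q0 [i iq qE]] := sqP q qA; have [br sqr r0 [j jr rE]] := sqP r rA.
  have [bT eb] := nT _ bq; have [cT' ec] := nT _ br.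
  have bc : beta q != beta r by apply: contra qr => /eqP/bI->.
  have inS b : b \in S :\ e -> b \in S by rewrite !inE => /andP[].
  case/eqP: qr; apply: (simz _ _ _ _ _ _ (AP _ qA) (AP _ rA) iq jr qE rE); rewrite sim_sym.
  apply: (squares_half tX iT eT bT cT' eb ec bc sqq sqr q0 r0 hX' h0); apply: hh => //; exact: inS.
have /set0Pn[b bS] : S :\ e != set0.
  by rewrite -card_gt0; have := cardsD1 e S; rewrite eS; case: S34 => ->; case: #|_|.
have [cU full] := half_lines fr eS bS UV UN.
case: S34 => S34; rewrite S34 /= in cU full cT.
  by left; apply: (small_linesE cV cP cT); apply: (leq_add (n1 := 2)).
have [U4|U4] := ltnP #|U| 4.
  by left; apply: (small_linesE cV cP cT); apply: (leq_add (n1 := 3)).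
have [A0|] := posnP #|A|.
  by left; apply: (small_linesE cV cP cT); rewrite A0 addn0.
case/card_gt0P=> q qA; right; split=> //; last exact: full.
have [bq sqq q0 _] := sqP q qA; exists (sq q).1, (sq q).2.
by move: bq; rewrite !inE => /andP[].
Qed.

End SmallLines.

(** * Four odd columns *)

Section IntersectingEdges.
Variable K : finType.
Implicit Types (F : {set {set K}}) (E : {set K}) (a b c : K).

Lemma card2_eq E a b : #|E| = 2%N -> a \in E -> b \in E -> a != b -> E = [set a; b].
Proof.
move=> E2 aE bE ab; apply/esym/eqP; rewrite eqEcard E2 cards2 ab andbT.
by apply/subsetP=> k; rewrite !inE => /orP[]/eqP->.
Qed.

(* Pairwise meeting edges form a star or a triangle. *)
Lemma meeting_edges F : (forall E, E \in F -> #|E| = 2%N) ->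
  (forall E E', E \in F -> E' \in F -> E :&: E' != set0) -> (#|F| <= #|cover F|)%N.
Proof.
move=> F2 FI; have inC E k : E \in F -> k \in E -> k \in cover F.
  by move=> EF kE; apply/bigcupP; exists E.
have [->|[E0 E0F]] := set_0Vmem F; first by rewrite cards0.
have [/existsP[a /forall_inP aF]|] := boolP [exists a, [forall E in F, a \in E]].
  pose f E := odflt a [pick k in E :\ a].
  have fP E : E \in F -> f E \in E :\ a.
    move=> EF; rewrite /f; case: pickP => [k //|E1].
    have : #|E :\ a| = 1%N by have := cardsD1 a E; rewrite F2 // aF // => -[].
    by rewrite (eq_card0 E1).
  rewrite -(card_in_imset (f := f)).
    apply: subset_leq_card; apply/subsetP=> _ /imsetP[E EF ->].
    by apply: (inC E) => //; have := fP E EF; rewrite inE => /andP[].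
  move=> E E' EF E'F fE.
  have H G : G \in F -> G = [set a; f G].
    by move=> GF; have := fP G GF; rewrite !inE => /andP[fa fG]; apply: card2_eq; rewrite ?F2 ?aF // eq_sym.
  by rewrite (H E) // (H E') // fE.
rewrite negb_exists => /forallP no.
have avoid a : exists2 E, E \in F & a \notin E.
  by have := no a; rewrite negb_forall => /existsP[E]; rewrite negb_imply => /andP[]; exists E.
have meet E E' : E \in F -> E' \in F -> exists2 k, k \in E & k \in E'.
  by move=> EF E'F; have /set0Pn[k] := FI _ _ EF E'F; rewrite inE => /andP[]; exists k.
have /card_gt1P[a [b [aE bE ab]]] : (1 < #|E0|)%N by rewrite F2.
have E0E := card2_eq (F2 _ E0F) aE bE ab.
have [E1 E1F aE1] := avoid a; have [E2 E2F bE2] := avoid b.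
have bE1 : b \in E1.
  have [k] := meet _ _ E0F E1F; rewrite E0E !inE => /orP[]/eqP-> //.
  by rewrite (negPf aE1).
have aE2 : a \in E2.
  have [k] := meet _ _ E0F E2F; rewrite E0E !inE => /orP[]/eqP-> //.
  by rewrite (negPf bE2).
have [c cE1 cE2] := meet _ _ E1F E2F.
have ac : a != c by apply: contraNneq aE1 => ->.
have bc : b != c by apply: contraNneq bE2 => ->.
have E1E := card2_eq (F2 _ E1F) bE1 cE1 bc; have E2E := card2_eq (F2 _ E2F) aE2 cE2 ac.
pose A := a |: [set b; c].
have A3 : #|A| = 3%N by rewrite cardsU1 cards2 !inE negb_or ab ac bc.
have : A \subset cover F.
  apply/subsetP=> k; rewrite !inE => /or3P[]/eqP->; [apply: (inC E0)|apply: (inC E0)|apply: (inC E1)] => //.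
move/subset_leq_card; rewrite A3; apply: leq_trans.
rewrite -[3%N]/('C(3, 2)) -A3 -cards_draws; apply: subset_leq_card; apply/subsetP=> E EF.
rewrite inE F2 // eqxx andbT.
suff [k [l [kA lA kl [kE lE]]]] : exists k l, [/\ k \in A, l \in A, k != l & k \in E /\ l \in E].
  by rewrite (card2_eq (F2 _ EF) kE lE kl); apply/subsetP=> m; rewrite !inE => /orP[]/eqP->; move: kA lA; rewrite !inE.
have aA : a \in A by rewrite !inE eqxx.
have bA : b \in A by rewrite !inE eqxx orbT.
have cA : c \in A by rewrite !inE eqxx !orbT.
have [k0] := meet _ _ E0F EF; have [k1] := meet _ _ E1F EF; have [k2] := meet _ _ E2F EF.
rewrite E0E E1E E2E !inE => /orP[]/eqP-> h2 /orP[]/eqP-> h1 /orP[]/eqP-> h0;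
by [exists a, b|exists a, c|exists b, c|exists b, a].
Qed.

End IntersectingEdges.

Section Seen.
Variable R : realFieldType.
Variable n : nat.
Variable I : finType.
Implicit Types (X : 'rV[R]_n -> Prop) (T : {set 'I_n}) (e b t u : 'I_n) (v w z : 'rV[R]_n).

(* [p] becomes a coordinate outside T after a change of basis that fixes the coordinates in T. *)
Definition seen X T (p : 'rV[R]_n -> R) := exists X' f u,
  [/\ tm X', intT T X', u \notin T, forall v, X v -> X' (f v) &
   (forall v k, k \in T -> f v 0 k = v 0 k) /\ forall v, f v 0 u = p v].

Lemma seen_coord X T u : tm X -> intT T X -> u \notin T -> seen X T (fun v => v 0 u).
Proof. by move=> tX iT uT; exists X, id, u. Qed.

Lemma seen_eq X T p p' : p =1 p' -> seen X T p -> seen X T p'.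
Proof.
move=> E [X' [f [u [tX iT uT fX [fT fu]]]]]; exists X', f, u; split=> //; split=> // v.
by rewrite fu E.
Qed.

Lemma seen_square X T e b t : tm X -> intT T X -> e != b -> t != e -> t != b ->
  e \notin T -> b \notin T -> t \notin T -> square X e b (ux R t) ->
  [/\ seen X T (fun v => v 0 e + v 0 b - v 0 t), seen X T (fun v => v 0 e - v 0 b),
      seen X T (fun v => v 0 e - v 0 t) & seen X T (fun v => v 0 b - v 0 t)].
Proof.
move=> tX iT eb te tb eT bT tT sq; have be : b != e by rewrite eq_sym.
split.
- have [X1 [f1 [? ? ? ? ?]]] := square_sum tX iT eb te tb eT bT tT sq.
  by exists X1, f1, e.
- have [X1 [f1 [? ? ? ? ?]]] := square_diff tX iT eb te tb eT bT tT sq.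
  by exists X1, f1, e.
- have [X1 [f1 [? ? ? ? ?]]] := square_base tX iT eb te tb eT bT tT sq.
  by exists X1, f1, e.
have [X1 [f1 [? ? ? ? ?]]] := square_base tX iT be tb te bT eT tT (square_sym sq).
by exists X1, f1, b.
Qed.

Lemma seen_piv X T z t p : (forall k, k \in T -> z 0 k = 0) -> t \notin T ->
  seen (pimg X z t) T p -> seen X T (fun v => p (piv z t v)).
Proof.
move=> z0 tT [X' [f [u [tX iT uT fX [fT fu]]]]].
exists X', (fun v => f (piv z t v)), u; split=> //; first by move=> v vX; apply: fX; exists v.
by split=> // v k kT; rewrite fT // (piv_on _ z0 tT kT).
Qed.

Lemma seen_hv X T p v w : seen X T p -> X v -> X w -> eqT T v w -> ~~ eqT T w 0 -> hv (p v - p w).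
Proof.
move=> [X' [f [u [tX iT uT fX [fT fu]]]]] vX wX vw w0; rewrite -!fu.
apply: (two_term tX iT uT (fX _ wX) (fX _ vX)).
  by apply: contra w0 => /eqTP H; apply/eqTP=> k kT; rewrite -fT ?H.
by apply/eqTP=> k kT; rewrite !fT // (eqTP _ _ _ vw).
Qed.

Lemma seen_width X T x (L P : {set I}) (fib : I -> {set I}) (z : I -> I -> 'rV[R]_n) p : fibered X x L T P fib z -> seen X T p ->
  exists lo hi : I -> I,
   (forall q, q \in P -> [/\ lo q \in fib q, hi q \in fib q
      & forall i, i \in fib q -> p (z q (lo q)) <= p (z q i) <= p (z q (hi q))]) /\
   \sum_(q in P) (p (z q (hi q)) - p (z q (lo q))) <= #|T|%:R.
Proof.
move=> F [X' [f [u [tX iT uT fX [fT fu]]]]].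
have [_ [lo [hi [H1 H2]]]] := fib_width F tX iT uT fX fT.
exists lo, hi; split=> [q /H1[lq hq lh]|]; first by split=> // i /lh; rewrite !fu.
by under eq_bigr do rewrite -!fu.
Qed.

(** Pivots bring the pair to [ux t2] and [r1], and the vertex of the square opposite to [z] to [r2].
    The signs of the half-integral vector [h] are chosen so that pivots at these vectors, on c and
    then on d, raise its entry at e to 3/2. *)
Lemma mixed_pair_absurd X T (S : {set 'I_n}) (c d e t : 'I_n) z w (s s' : R) : tm X -> intT T X ->
  e \in S -> c \in S -> d \in S -> c != e -> d != e -> c != d ->
  (forall k, k \in S -> k \notin T) -> t \notin T -> t \notin S ->
  square X c d z -> z 0 t = 1 -> (forall k, k \in T -> z 0 k = 0) ->
  (forall h : 'rV[R]_n, (forall k, k \in S -> hf (h 0 k)) -> (forall k, k \notin S -> h 0 k = 0) -> X h) ->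
  s * s = 1 -> s' * s' = 1 -> X w -> X (w + (s *: ux R e + s' *: ux R c)) -> eqT T w 0.
Proof.
move=> tX iT eS cS dS ce de cd ST tT tS sq zt z0 full s1 s1' wX w1X.
rewrite -[eqT _ _ _]negbK; apply/negP=> w0.
have [eT cT dT] : [/\ e \notin T, c \notin T & d \notin T] by split; apply: ST.
have y0 : eqT T (s *: ux R e + s' *: ux R c) 0.
  apply/eqTP=> k kT; have := eqTP _ _ _ (ux_on R eT) k kT; have := eqTP _ _ _ (ux_on R cT) k kT.
  by rewrite !mxE => -> ->; rewrite !mulr0 addr0.
have [X' [t2 [tX' t2T r1X hX]]] := pivot_to_unit tX iT wX w1X w0 y0.
pose r1 : 'rV[R]_n := ux R t2 + (s *: ux R e + s' *: ux R c).
pose r2 : 'rV[R]_n := ux R t + ux R c + ux R d.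
pose h : 'rV[R]_n := \row_k if k \in S then (if k == c then - (s * s' / 2) else
  if k == d then s * s' / 2 else 2^-1) else 0.
have nE k j : k \notin T -> j \in T -> (k == j) = false.
  by move=> kT jT; apply/negbTE; apply: contraNneq kT => ->.
have sE k j : k \in S -> j \notin S -> (k == j) = false.
  by move=> kS jS; apply/negbTE; apply: contraNneq jS => <-.
have sE' k j : k \in S -> j \notin S -> (j == k) = false by move=> kS jS; rewrite eq_sym sE.
have [ec ed] : e != c /\ e != d by rewrite eq_sym ce eq_sym.
have dc : d != c by rewrite eq_sym.
have [X1 _ _ X4] := sq.
have zX' : X' z by apply: hX => //; apply/eqTP=> k kT; rewrite z0 // mxE.
have z1X' : X' (z + ux R c + ux R d).
  apply: hX => //; apply/eqTP=> k kT; have := eqTP _ _ _ (ux_on R dT) k kT.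
  by have := eqTP _ _ _ (ux_on R cT) k kT; rewrite !mxE => -> ->; rewrite z0 // !addr0.
have hX' : X' h.
  apply: hX; last by apply/eqTP=> k kT; rewrite !mxE; case: ifP => // /ST; rewrite kT.
  apply: full => k kS; rewrite mxE ?kS ?(negPf kS) //.
  have hs : hf (s * s' / 2) by apply: hf_sign; [rewrite mulrACA s1 s1' mulr1|rewrite /hf eqxx].
  case: ifP => _; last by case: ifP => _ //; rewrite /hf eqxx.
  by rewrite -mulN1r; apply: hf_sign => //; rewrite mulrNN mulr1.
have zz : z 0 t * z 0 t = 1 by rewrite zt mulr1.
have tX2 := tm_piv tX' zX' zz.
have r2X : pimg X' z t r2.
  exists (z + ux R c + ux R d) => //; rewrite !linearD /= piv_row //.
  by rewrite !piv_id // uxE sE'.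
have r1X2 : pimg X' z t r1.
  by exists r1 => //; rewrite piv_id // !mxE nE // !sE' // !mulr0 !addr0.
have hX2 : pimg X' z t h by exists h => //; rewrite piv_id // mxE (negPf tS).
have r1c : r1 0 c = s'.
  by rewrite !mxE nE // eqxx (negPf ce) mulr0 mulr1 !add0r.
have r1d : r1 0 d = 0.
  by rewrite !mxE nE // (negPf de) (negPf dc) !mulr0 !add0r.
have r1e : r1 0 e = s.
  by rewrite !mxE nE // eqxx (negPf ec) mulr0 mulr1 addr0 add0r.
have r2c : r2 0 c = 1 by rewrite !mxE sE // eqxx (negPf cd) addr0 add0r.
have r2d : r2 0 d = 1 by rewrite !mxE sE // eqxx (negPf dc) !add0r.
have r2e : r2 0 e = 0 by rewrite !mxE sE // (negPf ed) (negPf ec) !add0r.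
have hc : h 0 c = - (s * s' / 2) by rewrite mxE cS eqxx.
have hd : h 0 d = s * s' / 2 by rewrite mxE dS eqxx (negPf dc).
have he : h 0 e = 2^-1 by rewrite mxE eS (negPf ec) (negPf ed).
have c1 : r1 0 c * r1 0 c = 1 by rewrite r1c.
have tX3 := tm_piv tX2 r1X2 c1.
have r2X3 : pimg (pimg X' z t) r1 c (piv r1 c r2) by exists r2.
have hX3 : pimg (pimg X' z t) r1 c (piv r1 c h) by exists h.
have qd : piv r1 c r2 0 d = 1 by rewrite pivE // r1d r2d mulr0 subr0.
have q1 : piv r1 c r2 0 d * piv r1 c r2 0 d = 1 by rewrite qd mulr1.
have := tm_entry e (tm_piv tX3 r2X3 q1) (ex_intro2 _ _ _ hX3 erefl).
rewrite pivE // qd (pivE _ _ ec) (pivE _ _ dc) (pivE _ _ ec) r1c r1d r1e r2c r2e hc hd he.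
have -> : 2^-1 - s' * - (s * s' / 2) * s - 1 * (s * s' / 2 - s' * - (s * s' / 2) * 0) * (0 - s' * 1 * s) =
  2^-1 + (s * s) * (s' * s') / 2 + (s * s) * (s' * s') / 2 by ring.
by rewrite s1 s1' => /hv_le1; lra.
Qed.

End Seen.

Lemma iv_parity (R : realFieldType) (a : R) : iv a -> exists m : int, a = (a != 0)%:R + 2 * m%:~R.
Proof.
case/ivP=> ->; rewrite ?eqxx ?oner_eq0 ?oppr_eq0 ?oner_eq0; [exists 0|exists 0|exists (-1)].
- by rewrite /=; lra.
- by rewrite /=; lra.
by rewrite mulrNz /=; lra.
Qed.

Lemma even_bits (R : realFieldType) (a0 a1 a2 a3 a4 : R) : iv a0 -> iv a1 -> iv a2 -> iv a3 -> iv a4 ->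
  zint ((a0 + a1 + a2 + a3 + a4) / 2) ->
  ~~ odd ((a0 != 0)%R + (a1 != 0)%R + (a2 != 0)%R + (a3 != 0)%R + (a4 != 0)%R)%N.
Proof.
move=> /iv_parity[m0 E0] /iv_parity[m1 E1] /iv_parity[m2 E2] /iv_parity[m3 E3] /iv_parity[m4 E4] [m mE].
move: E0 E1 E2 E3 E4; set k0 := nat_of_bool (a0 != 0); set k1 := nat_of_bool (a1 != 0);
set k2 := nat_of_bool (a2 != 0); set k3 := nat_of_bool (a3 != 0); set k4 := nat_of_bool (a4 != 0).
move=> E0 E1 E2 E3 E4.
have : (k0 + k1 + k2 + k3 + k4)%:Z%:~R = (2 * (m - m0 - m1 - m2 - m3 - m4))%:~R :> R.
  rewrite !PoszD !intrD intrM !intrB -![in LHS]pmulrn; move: mE E0 E1 E2 E3 E4; lra.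
by move/intr_inj; lia.
Qed.

Lemma two_bits (k0 k1 k2 k3 k4 : bool) : ~~ odd (k0 + k1 + k2 + k3 + k4)%N ->
  ~~ [&& k0, k1 & k4] -> ~~ [&& k2, k3 & k4] -> ~~ [&& k0, k1, k2, k3 & ~~ k4] ->
  [|| k0, k1, k2, k3 | k4] -> (k0 + k1 + k2 + k3 + k4 = 2)%N.
Proof. by case: k0; case: k1; case: k2; case: k3; case: k4. Qed.

(** If all three were signs, one of x, y, x - t, y - t would be +-3/2, as for the antipodal pairs in
    [cube_bound]. *)
Lemma sum_nz3 (R : realFieldType) (x y t : R) : iv (x + y - t) -> iv (x - y) -> iv t ->
  -1 <= x <= 1 -> -1 <= y <= 1 -> -1 <= x - t <= 1 -> -1 <= y - t <= 1 ->
  ~~ [&& x + y - t != 0, x - y != 0 & t != 0].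
Proof.
move=> i0 i1 i2 b0 b1 b2 b3; apply/negP=> /and3P[].
move=> /(iv_sqr i0)/sign_cases h0 /(iv_sqr i1)/sign_cases h1 /(iv_sqr i2)/sign_cases h2.
move: b0 b1 b2 b3 {i0 i1 i2}; case: h0 => h0; case: h1 => h1; case: h2 => h2; lra.
Qed.

Lemma unit_split (R : realFieldType) (x y t : R) : iv (x + y - t) -> iv (x - y) ->
  x + y - t != 0 -> x - y != 0 -> t = 0 -> (x * x = 1 /\ y = 0) \/ (x = 0 /\ y * y = 1).
Proof.
move=> i0 i1 /(iv_sqr i0)/sign_cases h0 /(iv_sqr i1)/sign_cases h1 t0.
have [[h h']|[h h']] : (y = 0 /\ (x = 1 \/ x = -1)) \/ (x = 0 /\ (y = 1 \/ y = -1)).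
- by case: h0 => h0; case: h1 => h1; [left; split; [|left]|right; split; [|left]|right; split; [|right]|left; split; [|right]]; lra.
- by left; split=> //; case: h' => ->; lra.
by right; split=> //; case: h' => ->; lra.
Qed.

(** * The exceptional configuration on five columns *)

Section FiveColumns.
Variable R : realFieldType.
Variable n : nat.
Variable I : finType.
Implicit Types (X : 'rV[R]_n -> Prop) (v w z : 'rV[R]_n).

(* What remains when contracting each of four odd columns fails: two squares whose base points,
   after pivoting the first one to the column t, differ by half of e + b - c - d. *)
Record d5 X (e b c d t : 'I_n) z : Prop := D5 {
  d5T : tm X;
  d5O : oddon X [set e; b; c; d];
  d5U : uniq [:: e; b; c; d; t];
  d5e : square X e b (ux R t);
  d5c : square X c d z;
  d5z : [/\ z 0 t = 1, z 0 c = - 2^-1 & z 0 d = - 2^-1];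
  d5z0 : forall k, k \notin [set e; b; c; d; t] -> z 0 k = 0;
  d5H : forall h : 'rV[R]_n, (forall k, k \in [set e; b; c; d] -> hf (h 0 k)) ->
     (forall k, k \notin [set e; b; c; d] -> h 0 k = 0) -> X h }.

(* In these coordinates two vectors of the same fibre differ in exactly two places. *)
Definition d5y (e b c d t : 'I_n) (k : 'I_5) v : R :=
  [:: v 0 e + v 0 b - v 0 t; v 0 e - v 0 b; v 0 c + v 0 d; v 0 c - v 0 d; v 0 t]`_k.

Section Config.
Variables (X : 'rV[R]_n -> Prop) (e b c d t : 'I_n) (z : 'rV[R]_n).
Hypothesis D : d5 X e b c d t z.

Let T := ~: [set e; b; c; d; t].

Lemma d5_ne : [/\ e != b, e != c, e != d, e != t & [/\ b != c, b != d, b != t & [/\ c != d, c != t & d != t]]].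
Proof.
by have := d5U D; rewrite /= !inE !negb_or => /and5P[/and4P[-> -> -> ->] /and3P[-> -> ->] /andP[-> ->] -> _].
Qed.

Lemma d5_T : [/\ e \notin T, b \notin T, c \notin T, d \notin T & t \notin T].
Proof. by rewrite !inE !eqxx !orbT. Qed.

Lemma d5_int : intT T X.
Proof.
move=> v vX j jT; case: (d5O D) => o1 _; apply: (o1 _ vX).
by move: jT; rewrite !inE !negb_or => /andP[].
Qed.

Lemma d5_seenE : [/\ seen X T (fun v => v 0 e + v 0 b - v 0 t), seen X T (fun v => v 0 e - v 0 b),
  seen X T (fun v => v 0 e - v 0 t) & seen X T (fun v => v 0 b - v 0 t)].
Proof.
have [eT bT cT dT tT] := d5_T; have [eb ec ed et [bc bd bt [cd ct dt]]] := d5_ne.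
by apply: seen_square (d5T D) d5_int _ _ _ _ _ _ (d5e D); rewrite // eq_sym.
Qed.

(** A pivot at [z] bases the second square at [ux t]; the multiples of v_t / 2 come from the entries
    -1/2 of [z] at c and d. *)
Lemma d5_seenC : [/\ seen X T (fun v => v 0 c + v 0 d), seen X T (fun v => v 0 c - v 0 d),
  seen X T (fun v => v 0 c - v 0 t / 2) & seen X T (fun v => v 0 d - v 0 t / 2)] /\
  seen X T (fun v => v 0 c + v 0 t / 2) /\ seen X T (fun v => v 0 d + v 0 t / 2).
Proof.
have [eT bT cT dT tT] := d5_T; have [eb ec ed et [bc bd bt [cd ct dt]]] := d5_ne.
have [zt zc zd] := d5z D; have zz : z 0 t * z 0 t = 1 by rewrite zt mulr1.
have z0 k : k \in T -> z 0 k = 0 by rewrite inE; apply: d5z0 D k.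
have zX : X z by case: (d5c D).
have tX := tm_piv (d5T D) zX zz.
have iT : intT T (pimg X z t) by apply: intT_on => //; apply: d5_int.
have sq := square_piv (d5c D) ct dt zz.
have [tc td] : t != c /\ t != d by rewrite eq_sym ct eq_sym.
have [S1 S2 S3 S4] := seen_square tX iT cd tc td cT dT tT sq.
have pc v : piv z t v 0 c = v 0 c + v 0 t / 2 by rewrite pivE // zt zc; ring.
have pd v : piv z t v 0 d = v 0 d + v 0 t / 2 by rewrite pivE // zt zd; ring.
have pt v : piv z t v 0 t = v 0 t by rewrite piv_at // zt mul1r.
split; [split|split].
- by apply: seen_eq (seen_piv z0 tT S1) => v; rewrite pc pd pt; field.
- by apply: seen_eq (seen_piv z0 tT S2) => v; rewrite pc pd; field.
- by apply: seen_eq (seen_piv z0 tT S3) => v; rewrite pc pt; field.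
- by apply: seen_eq (seen_piv z0 tT S4) => v; rewrite pd pt; field.
- by apply: seen_eq (seen_piv z0 tT (seen_coord tX iT cT)) => v; rewrite pc.
by apply: seen_eq (seen_piv z0 tT (seen_coord tX iT dT)) => v; rewrite pd.
Qed.

Lemma d5_seen k : seen X T (d5y e b c d t k).
Proof.
have [S1 S2 _ _] := d5_seenE; have [[S3 S4 _ _] _] := d5_seenC.
have [_ _ _ _ tT] := d5_T.
rewrite /d5y; case: k => -[|[|[|[|[|//]]]]] _ //=.
exact: seen_coord (d5T D) d5_int tT.
Qed.

Lemma d5_zint k v : X v -> zint (d5y e b c d t k v).
Proof.
move=> vX; have [eb ec ed et [bc bd bt [cd ct dt]]] := d5_ne.
have [o1 o2] := d5O D.
have vt : zint (v 0 t).
  by apply: iv_zint; apply: (o1 _ vX); rewrite !inE !negb_or !(eq_sym t) et bt ct dt.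
have z2 j : zint (2 * v 0 j) by apply: hv_zint2; apply: tm_entry (d5T D) vX.
have oe : zint (v 0 e - v 0 b) by apply: o2 => //; rewrite !inE eqxx ?orbT.
have oc : zint (v 0 c - v 0 d) by apply: o2 => //; rewrite !inE eqxx ?orbT.
rewrite /d5y; case: k => -[|[|[|[|[|//]]]]] _ //=.
  have -> : v 0 e + v 0 b - v 0 t = (v 0 e - v 0 b) + 2 * v 0 b - v 0 t by ring.
  by apply: zintB => //; apply: zintD.
have -> : v 0 c + v 0 d = (v 0 c - v 0 d) + 2 * v 0 d by ring.
exact: zintD.
Qed.

(** The five coordinates add up to 2 (v_e + v_c), and the difference of v_e + v_c for two vectors is
    integral, so an even number of coordinates changes. [sum_nz3] forbids that 0, 1, 4 or 2, 3, 4
    all change, and [mixed_pair_absurd] forbids the set 0, 1, 2, 3. *)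
Lemma d5_pair v w : X v -> X w -> eqT T v w -> ~~ eqT T w 0 -> v != w ->
  #|[set k | d5y e b c d t k v != d5y e b c d t k w]| = 2%N.
Proof.
move=> vX wX vw w0 vNw; have [eb ec ed et [bc bd bt [cd ct dt]]] := d5_ne.
have [eT bT cT dT tT] := d5_T; have [tX iT] := (d5T D, d5_int).
have ivY k : iv (d5y e b c d t k v - d5y e b c d t k w).
  by apply: hv_zint; [apply: seen_hv vX wX vw w0; apply: d5_seen|apply: zintB; apply: d5_zint].
have bnd p : seen X T p -> -1 <= p v - p w <= 1.
  by move=> sp; have := hv_le1 (seen_hv sp vX wX vw w0).
pose de := v 0 e - w 0 e; pose db := v 0 b - w 0 b; pose dc := v 0 c - w 0 c.
pose dd := v 0 d - w 0 d; pose dt' := v 0 t - w 0 t.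
have Y0 : d5y e b c d t 0 v - d5y e b c d t 0 w = de + db - dt' by rewrite /d5y /= /de /db /dt'; ring.
have Y1 : d5y e b c d t 1 v - d5y e b c d t 1 w = de - db by rewrite /d5y /= /de /db; ring.
have Y2 : d5y e b c d t 2 v - d5y e b c d t 2 w = dc + dd by rewrite /d5y /= /dc /dd; ring.
have Y3 : d5y e b c d t 3 v - d5y e b c d t 3 w = dc - dd by rewrite /d5y /= /dc /dd; ring.
have Y4 : d5y e b c d t 4 v - d5y e b c d t 4 w = dt' by rewrite /d5y /= /dt'.
have i0 := ivY 0; have i1 := ivY 1; have i2 := ivY 2; have i3 := ivY 3; have i4 := ivY 4.
rewrite Y0 in i0; rewrite Y1 in i1; rewrite Y2 in i2; rewrite Y3 in i3; rewrite Y4 in i4.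
have par : zint (((de + db - dt') + (de - db) + (dc + dd) + (dc - dd) + dt') / 2).
  have -> : ((de + db - dt') + (de - db) + (dc + dd) + (dc - dd) + dt') / 2 =
     (v 0 e - v 0 c) - (w 0 e - w 0 c) + 2 * v 0 c - 2 * w 0 c by rewrite /de /dc; field.
  have [_ o2] := d5O D; apply: zintB; last by apply: hv_zint2; apply: tm_entry tX wX.
  apply: zintD; last by apply: hv_zint2; apply: tm_entry tX vX.
  by apply: zintB; apply: o2; rewrite // !inE eqxx ?orbT.
have [_ _ Se Sb] := d5_seenE; have [[_ _ Sc Sd] [Sc' Sd']] := d5_seenC.
have n014 : ~~ [&& de + db - dt' != 0, de - db != 0 & dt' != 0].
  apply: sum_nz3 => //.
  - exact: bnd _ (seen_coord tX iT eT).
  - exact: bnd _ (seen_coord tX iT bT).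
  - by have := bnd _ Se; rewrite /de /dt'; lra.
  - by have := bnd _ Sb; rewrite /db /dt'; lra.
have n234 : ~~ [&& dc + dd != 0, dc - dd != 0 & dt' != 0].
  have E1 : (dc + dt' / 2) + (dd + dt' / 2) - dt' = dc + dd by field.
  have E2 : (dc + dt' / 2) - (dd + dt' / 2) = dc - dd by field.
  rewrite -{1}E1 -E2; apply: sum_nz3; rewrite ?E1 ?E2 //.
  - by have := bnd _ Sc'; rewrite /dc /dt'; lra.
  - by have := bnd _ Sd'; rewrite /dd /dt'; lra.
  - by have := bnd _ Sc; rewrite /dc /dt'; lra.
  - by have := bnd _ Sd; rewrite /dd /dt'; lra.
have cD : #|[set k | d5y e b c d t k v != d5y e b c d t k w]| =
    ((de + db - dt' != 0)%R + (de - db != 0)%R + (dc + dd != 0)%R + (dc - dd != 0)%R + (dt' != 0)%R)%N.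
  rewrite -sum1_card big_mkcond /= (eq_bigr (fun k => nat_of_bool (d5y e b c d t k v - d5y e b c d t k w != 0))).
    rewrite !big_ord_recl big_ord0 /= addn0.
    rewrite -Y0 -Y1 -Y2 -Y3 -Y4 !addnA; congr (_ + _ + _ + _ + _)%N.
  by move=> k _; rewrite inE subr_eq0; case: (_ == _).
rewrite cD; apply: two_bits => //; first exact: even_bits.
(* If 0, 1, 2, 3 change and v_t does not, then exactly one of e, b and one of c, d change, each by a
   unit. *)
- apply/negP=> /and5P[a0 a1 a2 a3]; rewrite negbK => /eqP t0.
  have i2' : iv (dc + dd - 0) by rewrite subr0.
  have a2' : dc + dd - 0 != 0 by rewrite subr0.
  have He := unit_split i0 i1 a0 a1 t0; have Hc := unit_split i2' i3 a2' a3 erefl.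
  have other k : k \notin [set e; b; c; d] -> v 0 k = w 0 k.
    move=> kS; have [->|kt] := eqVneq k t; first by apply/eqP; rewrite -subr_eq0; apply/eqP.
    by apply: (eqTP _ _ _ vw); rewrite inE in_setU inE (negPf kt) orbF.
  have [z1 _ _] := d5z D.
  have ST k : k \in [set e; b; c; d] -> k \notin T by move=> kS; rewrite inE negbK in_setU kS.
  have tS : t \notin [set e; b; c; d] by rewrite !inE !negb_or !(eq_sym t) et bt ct.
  have z0 k : k \in T -> z 0 k = 0 by rewrite inE; apply: d5z0 D k.
  have key e' c' d' : e' \in [set e; b; c; d] -> c' \in [set e; b; c; d] -> d' \in [set e; b; c; d] ->
      c' != e' -> d' != e' -> c' != d' -> square X c' d' z ->
      (v 0 e' - w 0 e') * (v 0 e' - w 0 e') = 1 -> (v 0 c' - w 0 c') * (v 0 c' - w 0 c') = 1 ->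
      (forall k, k \in [set e; b; c; d] -> k != e' -> k != c' -> v 0 k = w 0 k) -> False.
    move=> e'S c'S d'S ce de' cd' sq s1 s1' vk.
    case/negP: w0; apply: (mixed_pair_absurd tX iT e'S c'S d'S ce de' cd' ST tT tS sq z1 z0 (d5H D) s1 s1' wX).
    suff -> : w + ((v 0 e' - w 0 e') *: ux R e' + (v 0 c' - w 0 c') *: ux R c') = v by [].
    apply/rowP=> k; rewrite !mxE; have [->|ke'] := eqVneq k e'.
      by rewrite eq_sym (negPf ce) mulr0 mulr1 addr0 addrC subrK.
    have [->|kc'] := eqVneq k c'; first by rewrite mulr0 mulr1 add0r addrC subrK.
    rewrite !mulr0 !addr0; have [kS|kS] := boolP (k \in [set e; b; c; d]); first exact/esym/vk.
    exact/esym/other.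
  have inS : [/\ e \in [set e; b; c; d], b \in [set e; b; c; d], c \in [set e; b; c; d] & d \in [set e; b; c; d]].
    by rewrite !inE !eqxx !orbT.
  have [eS bS cS dS] := inS; have sq := d5c D; have sq' := square_sym sq.
  have [ce de' cb db'] : [/\ c != e, d != e, c != b & d != b] by rewrite !(eq_sym c) !(eq_sym d).
  have dc' : d != c by rewrite eq_sym.
  have eqd (x y : R) : x - y = 0 -> x = y by move/eqP; rewrite subr_eq0 => /eqP.
  case: He => -[he hb]; case: Hc => -[hc hd].
  + apply: (key e c d) => // k; rewrite !inE -!orbA => /or4P[]/eqP->; rewrite ?eqxx // => _ _; exact: eqd.
  + apply: (key e d c) => // k; rewrite !inE -!orbA => /or4P[]/eqP->; rewrite ?eqxx // => _ _; exact: eqd.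
  + apply: (key b c d) => // k; rewrite !inE -!orbA => /or4P[]/eqP->; rewrite ?eqxx // => _ _; exact: eqd.
  + apply: (key b d c) => // k; rewrite !inE -!orbA => /or4P[]/eqP->; rewrite ?eqxx // => _ _; exact: eqd.
apply: contraR vNw; rewrite !negb_or !negbK => /and5P[/eqP h0 /eqP h1 /eqP h2 /eqP h3 /eqP h4].
apply/eqP/rowP=> k; have [kT|] := boolP (k \in T); first exact: (eqTP _ _ _ vw).
rewrite !inE negbK -!orbA; move: h0 h1 h2 h3 h4; rewrite /de /db /dc /dd /dt' => h0 h1 h2 h3 h4.
by clear -h0 h1 h2 h3 h4; case/or4P=> [/eqP->|/eqP->|/eqP->|/orP[]/eqP->]; lra.
Qed.

End Config.
End FiveColumns.

(** [phi n] exceeds C(t+1, 2) by 6t + 19, so a slack of t + 19 has to absorb the vectors supported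
    on the five columns; [5 ^ 5 + 5 <= n] makes t at least 5^5. The power is generalised in the
    proof to keep it from being evaluated. *)
Lemma phi5_ge n t c p f : (n = t.+4.+1 -> 5 ^ 5 + 5 <= n -> c <= 5 ^ 5 -> p <= 'C(t.+1, 2) ->
  f <= p + 5 * t -> c + f <= phi n)%N.
Proof.
move=> nE; rewrite nE; move: (5 ^ 5)%N => N ? ? ? ?.
by have := bin2_double t; have := phiE t.+4.+1; nia.
Qed.

Section FiveColumnsBound.
Variable R : realFieldType.
Variable n : nat.
Variable I : finType.
Implicit Types (X : 'rV[R]_n -> Prop) (v w z : 'rV[R]_n).

(** To each member of a fibre other than a fixed one corresponds the set of two places where it
    differs from the fixed one. These sets meet pairwise, as disjoint ones would give members that
    differ in four places. They are distinct, as a place takes only two values in a fibre. So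
    [meeting_edges] bounds their number by the number of places of positive width. *)
Lemma d5_bound X e b c d t zz (x : I -> 'rV[R]_n) (L : {set I}) : d5 X e b c d t zz ->
  (forall i, i \in L -> X (x i)) -> nonpar x L -> (5 ^ 5 + 5 <= n)%N -> (#|L| <= phi n)%N.
Proof.
move=> D xX np nbig; pose T := ~: [set e; b; c; d; t].
have [tX iT] : tm X /\ intT T X := conj (d5T D) (d5_int D).
have c5 : #|[set e; b; c; d; t]| = 5%N.
  have := card_uniqP (d5U D); rewrite /= => <-; apply: eq_card => k.
  by rewrite !inE -!orbA.
have cT : n = #|T|.+4.+1.
  by have := cardsC [set e; b; c; d; t]; rewrite c5 card_ord; exact: esym.
have [P [fib [z F]]] := fibered_exists T tX xX.
have cP := fib_reps tX iT xX F.
have c0 : (#|[set i in L | eqT T (x i) 0]| <= 5 ^ 5)%N.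
  rewrite -[X in (5 ^ X)%N]c5.
  apply: (crude tX (x := x)) => [i|i j]; first by rewrite inE => /andP[/xX].
  rewrite !inE => /andP[iL i0] /andP[jL j0] /eqTP E.
  have [//|ij] := eqVneq i j; have [_ /(_ _ _ iL jL ij 1)/eqP[]] := np.
  rewrite scale1r; apply/rowP=> k; have [kG|kG] := boolP (k \in [set e; b; c; d; t]); first exact: E.
  have kT : k \in T by rewrite inE.
  by rewrite (eqTP _ _ _ i0 k kT) (eqTP _ _ _ j0 k kT).
pose Y k q i := d5y e b c d t k (z q i).
have /fin_all_exists[lo loP] := fun k => seen_width F (d5_seen D k).
have {loP} /fin_all_exists[hi H] := loP.
have cf q : q \in P -> #|fib q|%:R <= 1 + \sum_k (Y k q (hi k q) - Y k q (lo k q)) :> R.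
  move=> qP; have /set0Pn[i0 i0q] := fib0 F qP.
  pose E i := [set k | Y k q i != Y k q i0].
  have pair i j : i \in fib q -> j \in fib q -> i != j ->
      #|[set k | Y k q i != Y k q j]| = 2%N.
    move=> iq jq ij; apply: (d5_pair D (fibX F iq) (fibX F jq) (fibE F iq jq) (fibn F jq)).
    by apply: contra ij => /eqP/(fib_inj F np iq jq)->.
  have ivY k i j : i \in fib q -> j \in fib q -> iv (Y k q i - Y k q j).
    move=> iq jq; apply: hv_zint; last by apply: zintB; apply: (d5_zint D); apply: (fibX F).
    exact: seen_hv (d5_seen D k) (fibX F iq) (fibX F jq) (fibE F iq jq) (fibn F jq).
  pose J := fib q :\ i0; pose Fm := E @: J.
  have meetE i j : i \in J -> j \in J -> E i :&: E j != set0.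
    rewrite !inE => /andP[ii0 iq] /andP[ji0 jq]; have [<-|ij] := eqVneq i j.
      by rewrite setIid -card_gt0 pair.
    apply/negP=> /eqP E0; have := pair i j iq jq ij.
    have sub : E i :|: E j \subset [set k | Y k q i != Y k q j].
      apply/subsetP=> k; rewrite !inE => H'; apply/negP=> /eqP Ek.
      have /setP/(_ k) := E0; rewrite !inE -Ek andbb => h.
      by move: H'; rewrite -Ek orbb h.
    have := subset_leq_card sub => + h; rewrite h cardsU E0 cards0 subn0.
    by rewrite !pair.
  have injE : {in J &, injective E}.
    move=> i j iJ jJ Eij; have [//|ij] := eqVneq i j.
    move: iJ jJ; rewrite !inE => /andP[ii0 iq] /andP[ji0 jq].
    suff E0 : [set k | Y k q i != Y k q j] = set0 by have := pair i j iq jq ij; rewrite E0 cards0.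
    apply/setP=> k; rewrite !inE; apply/negbTE; rewrite negbK; apply/eqP.
    have /setP/(_ k) := Eij; rewrite !inE.
    have := ivY k i i0 iq i0q; have := ivY k j i0 jq i0q; have := ivY k i j iq jq.
    move: (Y k q i) (Y k q j) (Y k q i0) => a a' a0 /ivP h1 h2 h3.
    have [->|ne] := eqVneq a a0; first by move=> /= /esym/negbFE/eqP->.
    move/esym=> ne'; rewrite -subr_eq0 in ne; rewrite -subr_eq0 in ne'.
    have := sign_cases (iv_sqr h2 ne'); have := sign_cases (iv_sqr h3 ne).
    by case=> k1 [] k2; case: h1 => k3; lra.
  have cJ : (#|J| <= #|cover Fm|)%N.
    have <- : #|Fm| = #|J| by apply: card_in_imset.
    apply: meeting_edges.
      by move=> A /imsetP[i]; rewrite !inE => /andP[ii0 iq] ->; apply: pair.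
    by move=> A B /imsetP[i iJ ->] /imsetP[j jJ ->]; apply: meetE.
  rewrite (cardsD1 i0 (fib q)) i0q natrD lerD2l -/J.
  apply: le_trans (_ : #|cover Fm|%:R <= _); first by rewrite ler_nat.
  rewrite -sum1_card natr_sum big_mkcond /=; apply: ler_sum => k _.
  have [lq hq lh] := (H k).1 q qP; have lhk := lh _ hq.
  case: ifP => [/bigcupP[A /imsetP[i]]|_]; last by rewrite subr_ge0; case/andP: lhk.
  rewrite !inE => /andP[ii0 iq] ->; rewrite inE -subr_eq0 => nz.
  have /andP[b1 b2] := lh i iq; have /andP[b3 b4] := lh i0 i0q.
  have := sign_cases (iv_sqr (ivY k i i0 iq i0q) nz).
  by rewrite /Y; case=> h; move: b1 b2 b3 b4 h; rewrite /Y; clear; lra.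
have s1 : (\sum_(q in P) #|fib q|)%:R <= (#|P| + 5 * #|T|)%:R :> R.
  rewrite natr_sum natrD -[#|P|]sum1_card natr_sum.
  apply: le_trans (_ : _ <= \sum_(q in P) (1%:R + \sum_k (Y k q (hi k q) - Y k q (lo k q)))) _.
    exact: ler_sum.
  rewrite big_split lerD2l exchange_big /= natrM mulr_natl -[X in _ *+ X](card_ord 5) -sumr_const.
  by apply: ler_sum => k _; case: (H k).
rewrite ler_nat in s1.
by rewrite (fibC F); apply: (phi5_ge cT nbig c0 cP s1).
Qed.

End FiveColumnsBound.

(** * Relative position of two squares *)

Section TwoSquares.
Variable R : realFieldType.
Variable n : nat.
Implicit Types (X : 'rV[R]_n -> Prop) (S T : {set 'I_n}) (e b c d t k : 'I_n) (x y z w h : 'rV[R]_n).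

Lemma square_flip X e b y : tm X -> square X e b y -> square X e b (- y - ux R e - ux R b).
Proof.
move=> tX [X1 X2 X3 X4].
have N v : X v -> X (- v) by apply: tmN.
split.
- by have := N _ X4; rewrite !opprD.
- by have := N _ X3; rewrite !opprD (addrAC (- y)) addrNK.
- by have := N _ X2; rewrite !opprD addrNK.
by have := N _ X1; rewrite (addrAC (- y)) addrNK addrNK.
Qed.

Definition sqp e b y (i j : bool) : 'rV[R]_n := y + i%:R *: ux R e + j%:R *: ux R b.

Lemma sqpX X e b y i j : square X e b y -> X (sqp e b y i j).
Proof.
by case=> X1 X2 X3 X4; rewrite /sqp; case: i; case: j; rewrite ?scale0r ?scale1r ?addr0.
Qed.

Lemma sqpT T e b y i j : e \notin T -> b \notin T -> eqT T (sqp e b y i j) y.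
Proof.
move=> eT bT; apply/eqTP=> k kT; have := eqTP _ _ _ (ux_on R eT) k kT.
by have := eqTP _ _ _ (ux_on R bT) k kT; rewrite !mxE => -> ->; rewrite !mulr0 !addr0.
Qed.

Lemma sqpE e b y i j k : sqp e b y i j 0 k = y 0 k + i%:R * (k == e)%:R + j%:R * (k == b)%:R.
Proof. by rewrite !mxE. Qed.

Lemma square_align X T e b y y' : tm X -> e \notin T -> b \notin T -> square X e b y' -> sim T y' y ->
  exists2 z, square X e b z & eqT T z y.
Proof.
move=> tX eT bT sq /orP[E|E]; first by exists y'.
exists (- y' - ux R e - ux R b); first exact: square_flip.
apply/eqTP=> k kT; have := eqTP _ _ _ (ux_on R eT) k kT.
have := eqTP _ _ _ (ux_on R bT) k kT; have := eqTP _ _ _ E k kT.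
by rewrite !mxE => -> -> ->; rewrite opprK !subr0.
Qed.

Lemma pick_bit (a : R) : exists i : bool, a + i%:R != 0.
Proof.
have [->|a0] := eqVneq a 0; last by exists false; rewrite addr0.
by exists true; rewrite add0r oner_neq0.
Qed.

(** By [squares_half] both squares can be placed in one fibre, and the bounds make the entries of
    their base points at e equal. Suitable vertices then have integral differences on S that are
    non-zero at e, b and c, against [pair_supp]. *)
Lemma squares_share X S e b c y z h : frame X S -> e \in S -> b \in S -> c \in S ->
  e != b -> e != c -> b != c -> square X e b y -> square X e c z ->
  ~~ eqT (~: S) y 0 -> ~~ eqT (~: S) z 0 ->
  X h -> eqT (~: S) h 0 -> (forall k, k \in S -> hf (h 0 k)) -> False.
Proof.
move=> fr eS bS cS eb ec bc sq sqz y0 z0 hX h0 hh; have [tX oX hS hM] := fr.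
have iT := odd_intT oX; have nT k : k \in S -> k \notin ~: S by rewrite inE negbK.
have sm := squares_half tX iT (nT _ eS) (nT _ bS) (nT _ cS) eb ec bc sq sqz y0 z0 hX h0
  (hh _ eS) (hh _ bS) (hh _ cS).
have [z' sqz' zy] := square_align tX (nT _ eS) (nT _ cS) sqz sm.
have eqp i j i' j' : eqT (~: S) (sqp e c z' i j) (sqp e b y i' j').
  apply/eqTP=> k kT; rewrite (eqTP _ _ _ (sqpT z' i j (nT _ eS) (nT _ cS)) k kT).
  by rewrite (eqTP _ _ _ (sqpT y i' j' (nT _ eS) (nT _ bS)) k kT) (eqTP _ _ _ zy k kT).
have np i j : ~~ eqT (~: S) (sqp e b y i j) 0.
  apply: contra y0 => /eqTP H; apply/eqTP=> k kT.
  by rewrite -(eqTP _ _ _ (sqpT y i j (nT _ eS) (nT _ bS)) k kT) H.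
have tt k i j i' j' : k \in S -> hv (sqp e c z' i j 0 k - sqp e b y i' j' 0 k).
  move=> kS; apply: (two_term tX iT (nT _ kS) (sqpX i' j' sq) (sqpX i j sqz')) => //.
have ze : z' 0 e = y 0 e.
  have := hv_le1 (tt e true false false false eS); have := hv_le1 (tt e false false true false eS).
  by rewrite !sqpE eqxx (negPf eb) (negPf ec) /=; lra.
have zi k i j i' j' : k \in S -> zint (sqp e c z' i j 0 k - sqp e b y i' j' 0 k).
  move=> kS; rewrite !sqpE.
  have zb (p q : bool) : zint (p%:R * q%:R : R) by rewrite -natrM; exists (p * q)%N%:Z.
  have -> : z' 0 k + i%:R * (k == e)%:R + j%:R * (k == c)%:R - (y 0 k + i'%:R * (k == e)%:R +
     j'%:R * (k == b)%:R) = (z' 0 k - z' 0 e) - (y 0 k - y 0 e) + i%:R * (k == e)%:R + j%:R * (k == c)%:R -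
     i'%:R * (k == e)%:R - j'%:R * (k == b)%:R by rewrite ze; ring.
  have [_ o2] := oX; have [z'X _ _ _] := sqz'; have [yX _ _ _] := sq.
  by apply: zintB => //; apply: zintB => //; apply: zintD => //; apply: zintD => //; apply: zintB; apply: o2.
have [i iP] := pick_bit (z' 0 c - y 0 c); have [j jP] := pick_bit (y 0 b - z' 0 b).
have := pair_supp fr (sqpX true i sqz') (sqpX false j sq) (eqp _ _ _ _) (np _ _) (fun k => @zi k _ _ _ _).
rewrite leqNgt => /negP; apply; apply/card_gt2P; exists e, b, c.
rewrite !inE eS bS cS !sqpE !eqxx (eq_sym b e) (eq_sym c e) (eq_sym c b) (negPf eb) (negPf ec) (negPf bc).
rewrite !mulr0 !mulr1 !addr0 /= ze; split; split=> //.
- by apply/eqP=> /=; lra.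
- by apply: contra jP => /eqP E; apply/eqP; move: E => /=; lra.
- by apply: contra iP => /eqP E; apply/eqP; move: E => /=; lra.
Qed.

(** Otherwise pivots bring diagonals to t + e - b and t' + c - d. Pivots on b and d then turn the
    entries at e and c into v_e + v_b and v_c + v_d, which are (1, 1) for [h] and (1, -1) for [h']:
    a minor -2. *)
Lemma squares_apart X T e b c d y z h h' : tm X -> intT T X ->
  e \notin T -> b \notin T -> c \notin T -> d \notin T -> uniq [:: e; b; c; d] ->
  square X e b y -> square X c d z -> ~~ eqT T y 0 -> ~~ eqT T z 0 ->
  X h -> eqT T h 0 -> [/\ h 0 e = 2^-1, h 0 b = 2^-1, h 0 c = 2^-1 & h 0 d = 2^-1] ->
  X h' -> eqT T h' 0 -> [/\ h' 0 e = 2^-1, h' 0 b = 2^-1, h' 0 c = - 2^-1 & h' 0 d = - 2^-1] ->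
  sim T z y.
Proof.
move=> tX iT eT bT cT dT; rewrite /= !inE !negb_or => /and4P[/and3P[eb ec ed] /andP[bc bd] cd _].
move=> sq sqz y0 z0 hX h0 [he hb hc hd] h'X h'0 [he' hb' hc' hd'].
rewrite -[sim _ _ _]negbK; apply/negP=> ns.
have N1 : (-1) * (-1) = 1 :> R by rewrite mulrNN mulr1.
have [x [xX x1X xE]] := square_sign sq N1; have [x' [x'X x'1X x'E]] := square_sign sqz N1.
have xy := square_base_on X e bT xE; have xz := square_base_on X c dT x'E.
have x0 : ~~ eqT T x 0.
  by apply: contra y0 => /eqTP H; apply/eqTP=> k kT; rewrite -(eqTP _ _ _ xy k kT) H.
have x'0 : ~~ eqT T x' 0.
  by apply: contra z0 => /eqTP H; apply/eqTP=> k kT; rewrite -(eqTP _ _ _ xz k kT) H.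
have ns' : ~~ sim T x' x by rewrite (sim_eqT xz xy).
have [X' [t [t' [tX' [tT t'T] rX r'X hh]]]] := pivot_to_units tX iT xX x'X x1X x'1X x0 x'0 ns'
  (eqT_comb (-1) eT bT) (eqT_comb (-1) cT dT).
have t'T' : t' \in T by move: t'T; rewrite !inE => /andP[].
have nE k j : k \notin T -> j \in T -> (k == j) = false.
  by move=> kT jT; apply/negbTE; apply: contraNneq kT => ->.
pose r : 'rV[R]_n := ux R t + (ux R e + -1 *: ux R b).
pose r' : 'rV[R]_n := ux R t' + (ux R c + -1 *: ux R d).
have [be ce de] : [/\ b != e, c != e & d != e] by split; rewrite eq_sym.
have [cb db dc] : [/\ c != b, d != b & d != c] by split; rewrite eq_sym.
have rE : [/\ r 0 e = 1, r 0 b = -1, r 0 c = 0 & r 0 d = 0].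
  rewrite !mxE !(nE _ _ _ tT) // !eqxx (negPf eb) (negPf be) (negPf ce) (negPf cb) (negPf de) (negPf db).
  by rewrite !mulr0 mulr1 !addr0 !add0r.
have rE' : [/\ r' 0 e = 0, r' 0 b = 0, r' 0 c = 1 & r' 0 d = -1].
  rewrite !mxE !(nE _ _ _ t'T') // !eqxx (negPf ec) (negPf ed) (negPf bc) (negPf bd) (negPf cd) (negPf dc).
  by rewrite !mulr0 mulr1 !addr0 !add0r.
have [re rb rc rd] := rE; have [re' rb' rc' rd'] := rE'.
have r1 : r 0 b * r 0 b = 1 by rewrite rb.
have r1' : r' 0 d * r' 0 d = 1 by rewrite rd'.
have tX1 := tm_piv tX' rX r1.
have r'X1 : pimg X' r b r' by exists r' => //; rewrite piv_id.
have tX2 := tm_piv tX1 r'X1 r1'.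
have im v : X v -> eqT T v 0 -> pimg (pimg X' r b) r' d (piv r' d (piv r b v)).
  by move=> vX v0; exists (piv r b v) => //; exists v => //; apply: hh.
have pe v : piv r' d (piv r b v) 0 e = v 0 e + v 0 b.
  by rewrite pivE // re' mulr0 subr0 pivE // re rb; ring.
have pc v : piv r' d (piv r b v) 0 c = v 0 c + v 0 d.
  by rewrite pivE // !(pivE _ _ _) ?rc ?rd ?rc' ?rd' //; ring.
have := tm_det2 tX2 (im _ hX h0) (im _ h'X h'0) ec.
by rewrite !pe !pc he hb hc hd he' hb' hc' hd' => /hv_le1; lra.
Qed.

Lemma square_pimg X e b z y t : square X e b z -> e != t -> b != t ->
  square (pimg X y t) e b (piv y t z).
Proof.
case=> X1 X2 X3 X4 et bt.
have pe : piv y t (ux R e) = ux R e by rewrite piv_id // uxE eq_sym (negPf et).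
have pb : piv y t (ux R b) = ux R b by rewrite piv_id // uxE eq_sym (negPf bt).
split; first by exists z.
- by exists (z + ux R e) => //; rewrite linearD /= pe.
- by exists (z + ux R b) => //; rewrite linearD /= pb.
by exists (z + ux R e + ux R b) => //; rewrite !linearD /= pe pb.
Qed.

(* An integral offset would give two vectors differing in three columns of S, against [pair_supp];
   so the offset of the two squares is half-integral. *)
Lemma squares_offset X S e b c d y z : frame X S ->
  e \in S -> b \in S -> c \in S -> d \in S -> uniq [:: e; b; c; d] ->
  square X e b y -> square X c d z -> ~~ eqT (~: S) y 0 ->
  eqT (~: S) z y -> z 0 c - y 0 c = - 2^-1 /\ z 0 d - y 0 d = - 2^-1.
Proof.
move=> fr eS bS cS dS; rewrite /= !inE !negb_or => /and4P[/and3P[eb ec ed] /andP[bc bd] cd _] sq sqz y0 zy.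
have [tX oX hS hM] := fr.
have iT := odd_intT oX; have nT k : k \in S -> k \notin ~: S by move=> kS; rewrite in_setC negbK.
have [be ce de] : [/\ b != e, c != e & d != e] by split; rewrite eq_sym.
have [cb db dc] : [/\ c != b, d != b & d != c] by split; rewrite eq_sym.
have eqp i j i' j' : eqT (~: S) (sqp c d z i j) (sqp e b y i' j').
  apply/eqTP=> k kT; rewrite (eqTP _ _ _ (sqpT z i j (nT _ cS) (nT _ dS)) k kT).
  by rewrite (eqTP _ _ _ (sqpT y i' j' (nT _ eS) (nT _ bS)) k kT) (eqTP _ _ _ zy k kT).
have np i j : ~~ eqT (~: S) (sqp e b y i j) 0.
  apply: contra y0 => /eqTP H; apply/eqTP=> k kT.
  by rewrite -(eqTP _ _ _ (sqpT y i j (nT _ eS) (nT _ bS)) k kT) H.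
have tt k i j i' j' : k \in S -> hv (sqp c d z i j 0 k - sqp e b y i' j' 0 k).
  move=> kS; apply: (two_term tX iT (nT _ kS) (sqpX i' j' sq) (sqpX i j sqz)) => //.
have [yX _ _ _] := sq; have [zX _ _ _] := sqz; have [_ o2] := oX.
have nz : ~ zint (z 0 e - y 0 e).
  move=> ze.
  have zi k i j i' j' : k \in S -> zint (sqp c d z i j 0 k - sqp e b y i' j' 0 k).
    move=> kS; rewrite !sqpE.
    have zb (p q : bool) : zint (p%:R * q%:R : R) by rewrite -natrM; exists (p * q)%N%:Z.
    have -> : z 0 k + i%:R * (k == c)%:R + j%:R * (k == d)%:R - (y 0 k + i'%:R * (k == e)%:R +
       j'%:R * (k == b)%:R) = (z 0 k - z 0 e) - (y 0 k - y 0 e) + (z 0 e - y 0 e) + i%:R * (k == c)%:R +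
       j%:R * (k == d)%:R - i'%:R * (k == e)%:R - j'%:R * (k == b)%:R by ring.
    by apply: zintB => //; apply: zintB => //; apply: zintD => //; apply: zintD => //; apply: zintD => //;
      apply: zintB; apply: o2.
  have [i1 i1P] := pick_bit (y 0 e - z 0 e); have [i2 i2P] := pick_bit (y 0 b - z 0 b).
  have [i3 i3P] := pick_bit (z 0 c - y 0 c).
  have := pair_supp fr (sqpX i3 false sqz) (sqpX i1 i2 sq) (eqp _ _ _ _) (np _ _) (fun k => @zi k _ _ _ _).
  rewrite leqNgt => /negP; apply; apply/card_gt2P; exists e, b, c.
  rewrite !inE eS bS cS !sqpE !eqxx (negPf eb) (negPf ec) (negPf ed) (negPf be) (negPf bc) (negPf bd)
     (negPf ce) (negPf cb) (negPf cd).
  rewrite !mulr0 !mulr1 !addr0 /=; split; split=> //.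
  - by apply: contra i1P => /eqP E; apply/eqP; move: E => /=; lra.
  - by apply: contra i2P => /eqP E; apply/eqP; move: E => /=; lra.
  by apply: contra i3P => /eqP E; apply/eqP; move: E => /=; lra.
have nk k : k \in S -> ~ zint (z 0 k - y 0 k).
  move=> kS zk; apply: nz; have -> : z 0 e - y 0 e = (z 0 e - z 0 k) - (y 0 e - y 0 k) + (z 0 k - y 0 k) by ring.
  by apply: zintD => //; apply: zintB; apply: o2.
have val k : k \in S -> k != e -> k != b -> k = c \/ k = d -> z 0 k - y 0 k = - 2^-1.
  move=> kS ke kb kcd; have := tt k false false false false kS.
  have : hv (z 0 k - y 0 k + 1).
    case: kcd => kE; [have := tt k true false false false kS|have := tt k false true false false kS];
    by rewrite !sqpE (negPf ke) (negPf kb) kE eqxx ?(negPf cd) ?(negPf dc) !mulr0 ?mulr1 !addr0 addrAC.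
  rewrite !sqpE !mul0r !addr0; have := nk k kS.
  move: (z 0 k - y 0 k) => a na h1 /hvP[] aE //; case: na; rewrite ?aE.
  - by exists 0.
  - by exists 1.
  - by exists (-1).
  by move: h1 => /hv_le1; lra.
by split; apply: val => //; [left|right].
Qed.

End TwoSquares.

Section Exceptional.
Variable R : realFieldType.
Variable n : nat.
Variable I : finType.
Implicit Types (X : 'rV[R]_n -> Prop) (S : {set 'I_n}).

(** By [squares_share] the squares pair off the four columns as e, b and c, d. [squares_apart] puts
    both squares into one fibre, [squares_offset] gives the offset -1/2, and a pivot at [y] produces
    the configuration [d5]. *)
Lemma exceptional_bound X S (x : I -> 'rV[R]_n) (L : {set I}) : frame X S -> #|S| = 4%N ->
  (forall e, e \in S -> exists b y, [/\ b \in S, b != e, square X e b y & ~~ eqT (~: S) y 0]) ->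
  (forall h, eqT (~: S) h 0 -> (forall k, k \in S -> hf (h 0 k)) -> X h) ->
  (forall i, i \in L -> X (x i)) -> nonpar x L -> (5 ^ 5 + 5 <= n)%N -> (#|L| <= phi n)%N.
Proof.
move=> fr S4 sqS full xX np nbig; have [tX oX hS hM] := fr.
have iT := odd_intT oX; have nT k : k \in S -> k \notin ~: S by rewrite inE negbK.
(* [A] is the set of columns with the negative sign; the cases [set0] and [[set c; d]] are the two
   vectors needed by [squares_apart]. *)
pose hw (A : {set 'I_n}) : 'rV[R]_n := \row_k if k \in S then (if k \in A then - 2^-1 else 2^-1) else 0.
have hw0 A : eqT (~: S) (hw A) 0 by apply/eqTP=> k; rewrite inE !mxE => /negPf->.
have hwh A k : k \in S -> hf (hw A 0 k).
  by move=> kS; rewrite mxE kS; case: ifP => _; rewrite /hf eqxx ?orbT.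
have hwX A : X (hw A) by apply: full => // k; apply: hwh.
have /card_gt0P[e eS] : (0 < #|S|)%N by rewrite S4.
have [b [y [bS be sq y0]]] := sqS e eS.
have eb : e != b by rewrite eq_sym.
have /card_gt0P[c] : (0 < #|S :\ e :\ b|)%N.
  have := cardsD1 e S; rewrite eS S4 => -[]; have := cardsD1 b (S :\ e).
  by rewrite !inE be bS => -> -[]; rewrite add0n => <-.
rewrite !inE => /and3P[cb ce cS].
have [d [z [dS dc sqz z0]]] := sqS c cS.
have [ec bc cd] : [/\ e != c, b != c & c != d] by split; rewrite eq_sym.
have de : d != e.
  apply/negP=> /eqP dE; rewrite dE in sqz.
  exact: squares_share fr eS bS cS eb ec bc sq (square_sym sqz) y0 z0 (hwX set0) (hw0 _) (hwh _).
have db : d != b.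
  apply/negP=> /eqP dE; rewrite dE in sqz.
  exact: squares_share fr bS eS cS be bc ec (square_sym sq) (square_sym sqz) y0 z0 (hwX set0) (hw0 _) (hwh _).
have un : uniq [:: e; b; c; d].
  by rewrite /= !inE !negb_or eb ec bc cd !(eq_sym _ d) de db.
have SE : [set e; b; c; d] = S.
  apply/eqP; rewrite eqEcard S4; apply/andP; split.
    by apply/subsetP=> k; rewrite !inE -!orbA => /or4P[]/eqP->.
  have := card_uniqP un; rewrite /= => <-; rewrite leq_eqVlt; apply/orP; left; apply/eqP/eq_card=> k.
  by rewrite !inE -!orbA.
have sm : sim (~: S) z y.
  apply: (squares_apart tX iT (nT _ eS) (nT _ bS) (nT _ cS) (nT _ dS) un sq sqz y0 z0
    (hwX set0) (hw0 _) _ (hwX [set c; d]) (hw0 _)).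
    by rewrite !mxE eS bS cS dS !in_set0.
  by rewrite !mxE eS bS cS dS !inE !eqxx (negPf ec) (negPf bc) (eq_sym e) (eq_sym b) (negPf de) (negPf db) ?orbT.
have [z' sqz' zy] := square_align tX (nT _ cS) (nT _ dS) sqz sm.
have [oc od] := squares_offset fr eS bS cS dS un sq sqz' y0 zy.
have yX : X y by case: sq.
have [t tT yt] := intT_neq0 iT yX y0.
have tS : t \notin S by move: tT; rewrite inE.
have [et bt ct dt] : [/\ e != t, b != t, c != t & d != t].
  by split; apply: contraNneq tS => <-.
have zk k : k != t -> piv y t z' 0 k = z' 0 k - y 0 k.
  by move=> kt; rewrite (@piv_coord _ _ (~: S) y t z' 1) ?scale1r ?mul1r.
apply: (@d5_bound _ _ _ (pimg X y t) e b c d t (piv y t z') (fun i => piv y t (x i))) => //.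
- split.
  + exact: tm_piv.
  + by rewrite SE; apply: odd_piv.
  + by rewrite -[[:: e; b; c; d; t]]/(rcons [:: e; b; c; d] t) rcons_uniq un !inE !negb_or !(eq_sym t) et bt ct dt.
  + exact: square_piv.
  + exact: square_pimg.
  + by rewrite piv_at // (eqTP _ _ _ zy t tT) yt !zk.
  + move=> k; rewrite in_setU SE inE negb_or => /andP[kS kt]; rewrite zk //.
    by rewrite (eqTP _ _ _ zy) ?inE // subrr.
  rewrite SE => h hh h0; exists h; last by rewrite piv_id ?h0.
  by apply: full => //; apply/eqTP=> k; rewrite inE mxE; apply: h0.
- by move=> i iL; exists (x i) => //; apply: xX.
by apply: nonpar_lin np => v; apply: piv_inj0.
Qed.

End Exceptional.

(** * The upper bound *)

Section Assembly.
Variable R : realFieldType.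

Definition lines_le n (X : 'rV[R]_n -> Prop) N := forall (I : finType) (x : I -> 'rV[R]_n) (L : {set I}),
  (forall i, i \in L -> X (x i)) -> nonpar x L -> (#|L| <= N)%N.

Lemma lines_le_chg n (X : 'rV[R]_n -> Prop) g N : `|\det g| = 1 ->
  lines_le (fun v => X (v *m g)) N -> lines_le X N.
Proof.
move=> dg H I x L xX [x0 np].
have ug : g \in unitmx by rewrite unitmxE unitfE -normr_eq0 dg oner_neq0.
apply: (H I (fun i => x i *m invmx g)) => [i iL|]; first by rewrite mulmxKV //; apply: xX.
split=> [i iL|i j iL jL ij c].
  by apply: contra (x0 i iL) => /eqP E; rewrite -[x i](mulmxKV ug) E mul0mx.
apply: contra (np i j iL jL ij c) => /eqP E.
by rewrite -[x i](mulmxKV ug) E -scalemxAl mulmxKV.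
Qed.

Lemma frame_of n (X : 'rV[R]_n -> Prop) w : tm X -> X w -> oddset w != set0 ->
  hmin #|oddset w| X -> frame X (oddset w).
Proof.
move=> tX wX /set0Pn[a]; rewrite inE => wa hX; split=> //; first exact: odd_of tX wX wa.
by exists w => // j; rewrite inE.
Qed.

Lemma frame_oddset n (X : 'rV[R]_n -> Prop) S : frame X S -> exists2 v, X v & oddset v = S.
Proof.
move=> [_ [o1 _] [v vX vh] _]; exists v => //; apply/setP=> j; rewrite inE; apply/idP/idP=> [|/vh//].
by apply: contraLR => jS; apply: ivNhf; apply: o1.
Qed.

(* The minimum exists without choice, as the conclusion is decidable. *)
Lemma minimal_frame n (X : 'rV[R]_n -> Prop) w N : tm X -> X w -> oddset w != set0 ->
  (forall (X' : 'rV[R]_n -> Prop) S, frame X' S -> S != set0 -> (#|S| <= #|oddset w|)%N -> lines_le X' N) -> lines_le X N.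
Proof.
move=> tX wX w0 H I x L xX np; rewrite leqNgt; apply/negP=> ltL.
suff no s : forall g v, (forall i, X (row i g)) -> `|\det g| = 1 -> X (v *m g) -> oddset v != set0 ->
    #|oddset v| = s -> (s <= #|oddset w|)%N -> False.
  apply: (no _ 1%:M w); rewrite ?det1 ?normr1 ?mulmx1 //.
  by move=> i; rewrite row1; have := tmU tX i; congr X; apply/rowP=> k; rewrite !mxE eqxx.
elim/ltn_ind: s => s IH g v gX dg vX v0 vs sw.
have tX' := tm_chg tX gX dg.
have hX : hmin s (fun y => X (y *m g)).
  move=> g' v' g'X dg' v'X v'0; rewrite leqNgt; apply/negP=> lt.
  apply: (IH _ lt (g' *m g) v') => //; last exact: leq_trans (ltnW lt) sw.
  - by move=> i; rewrite row_mul.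
  - by rewrite det_mulmx normrM dg dg' mulr1.
  by rewrite mulmxA.
rewrite -vs in hX sw.
have fr := frame_of tX' vX v0 hX.
by have := lines_le_chg dg (H _ _ fr v0 sw) xX np; rewrite leqNgt ltL.
Qed.

Lemma phi_int n : (0 < n)%N -> ('C(n.+1, 2) <= phi n)%N.
Proof. by move=> n0; have := bin2_double n; have := phiE n; nia. Qed.

(** The budget of a contraction; it fails at n = 0, where [phi] is truncated. *)
Lemma phiS n : (0 < n)%N -> phi n.+1 = (phi n + n.+2)%N.
Proof. by move=> n0; have := phiE n; have := phiE n.+1; nia. Qed.

(** Whether the predicate X has a half-integral entry cannot be decided, but the conclusion can. If
    it fails, every half-integral entry is contradictory, so all entries are integral and Heller's
    bound applies. *)
Lemma odd_or_int n (X : 'rV[R]_n -> Prop) N : (0 < n)%N -> tm X -> (phi n <= N)%N ->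
  (forall w, X w -> oddset w != set0 -> lines_le X N) -> lines_le X N.
Proof.
move=> n0 tX phN H I x L xX np; rewrite leqNgt; apply/negP=> ltL.
have iX : intT [set: 'I_n] X.
  move=> v vX j _; have := tm_entry j tX vX; rewrite /hv => /orP[//|hj].
  have v0 : oddset v != set0 by apply/set0Pn; exists j; rewrite inE.
  by have := H v vX v0 I x L xX np; rewrite leqNgt ltL.
have fullT (v w : 'rV[R]_n) : eqT [set: 'I_n] v w -> v = w.
  by move=> /eqTP E; apply/rowP=> k; apply: E; rewrite inE.
have [x0 np'] := np; move: ltL; rewrite ltnNge => /negP; apply.
apply: leq_trans phN; apply: leq_trans (phi_int n0).
have := heller (T := [set: 'I_n]) tX iX xX; rewrite cardsT card_ord; apply.
  by move=> i iL; apply: contra (x0 i iL) => /fullT->.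
move=> i j iL jL ij; apply/negP=> /simP[s _ /fullT E].
by have := np' i j iL jL ij s; rewrite E eqxx.
Qed.

Lemma odd_le2 n (X : 'rV[R]_n -> Prop) w : tm X -> X w -> oddset w != set0 -> (#|oddset w| <= 2)%N ->
  (500 <= n)%N -> lines_le X (phi n).
Proof.
move=> tX wX w0 w2 n500 I x L xX np; have /set0Pn[a aw] := w0.
have oX : oddon X (oddset w) by rewrite inE in aw; apply: odd_of aw.
have : (#|oddset w| == 1)%N || (#|oddset w| == 2)%N.
  by move: w0 w2; rewrite -card_gt0; case: #|_| => [|[|[|]]].
case/orP=> [/cards1P[u E]|/cards2P[e [b [eb E]]]].
  by rewrite E in oX; apply: odd1_bound oX xX np.
by rewrite E in oX; apply: odd2_large oX eb xX np n500.
Qed.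

Lemma drop_odd n (X : 'rV[R]_n.+1 -> Prop) S e : frame X S -> e \in S -> (1 < #|S|)%N ->
  exists w, [/\ dimg X e w, oddset w != set0 & (#|oddset w| < #|S|)%N].
Proof.
move=> [tX oX [w wX wh] _] eS S1; exists (drop e w); split; first by exists w.
  have /card_gt0P[b] : (0 < #|S :\ e|)%N by move: S1; rewrite (cardsD1 e) eS.
  rewrite !inE => /andP[be bS]; case: (unliftP e b) => [k kE|E]; last by rewrite E eqxx in be.
  by apply/set0Pn; exists k; rewrite inE dropE -kE; apply: wh.
rewrite [ltnRHS](cardsD1 e) eS add1n ltnS -(card_imset _ (@lift_inj _ e)); apply: subset_leq_card.
apply/subsetP=> _ /imsetP[k + ->]; rewrite !inE dropE eq_sym neq_lift /= => hk.
apply: contraLR hk => kS; apply: ivNhf; case: oX => o1 _; exact: o1.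
Qed.

Lemma frame_contract n (X : 'rV[R]_n.+1 -> Prop) S e M (I : finType) (x : I -> 'rV[R]_n.+1) (L : {set I}) :
  frame X S -> e \in S -> (2 < #|S|)%N -> lines_le (dimg X e) M ->
  (forall i, i \in L -> X (x i)) -> nonpar x L ->
  exists (V : {set I}) (y : I -> 'rV[R]_n.+1), [/\ (#|L| <= 1 + M + #|V|)%N,
   (forall q, q \in V -> [/\ X (y q), X (y q + ux R e) & ~~ eqT [set~ e] (y q) 0]) &
   (forall q r, q \in V -> r \in V -> q != r -> forall c, ~~ eqT [set~ e] (y q) (c *: y r))].
Proof.
move=> fr eS S3 lM xX np.
have [P [V [y [[PL VP cL] npP yP yN]]]] := contract (frT fr) (frame_line fr eS S3) xX np.
exists V, y; split=> //; apply: leq_trans cL _; rewrite leq_add2r leq_add2l.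
by apply: lM npP => i /PL/xX iX; exists (x i).
Qed.

(** The contraction has an odd set of at most two columns, so its bound is exact; with at most n + 1
    pairs, 1 + [phi n] + (n + 1) is exactly [phi n.+1]. The rank drops by one, whence 501 after
    500. *)
Lemma odd_le3 n (X : 'rV[R]_n -> Prop) w : tm X -> X w -> oddset w != set0 -> (#|oddset w| <= 3)%N ->
  (501 <= n)%N -> lines_le X (phi n).
Proof.
case: n X w => // n X w tX wX w0 w3 n500.
apply: (minimal_frame tX wX w0) => X' S fr S0 Sw I x L xX np.
have [tX' _ _ hX'] := fr; have [v vX vS] := frame_oddset fr.
have /set0Pn[e eS] := S0.
have [S2|S3] := leqP #|S| 2.
  by apply: (odd_le2 tX' vX) xX np; rewrite ?vS //; apply: ltnW.
have [u [uX u0 uS]] := drop_odd fr eS (ltnW S3).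
have cS : #|S| = 3%N by apply/eqP; rewrite eqn_leq S3 (leq_trans Sw w3).
have lM : lines_le (dimg X' e) (phi n).
  have u2 : (#|oddset u| <= 2)%N by rewrite -ltnS -cS.
  exact: odd_le2 (tm_drop e tX') uX u0 u2 n500.
have [V [y [cL yP yN]]] := frame_contract fr eS S3 lM xX np.
have [cV|[]] := small_lines fr eS (or_introl cS) yP yN; last by rewrite cS.
apply: leq_trans cL _; rewrite phiS ?(leq_trans _ n500) //; lia.
Qed.

(** Every column of S may be contracted. If one of them gives at most n + 1 pairs, the budget
    suffices; otherwise all four are exceptional, which is what [exceptional_bound] needs. *)
Lemma odd_le4 n (X : 'rV[R]_n -> Prop) w : tm X -> X w -> oddset w != set0 -> (#|oddset w| <= 4)%N ->
  (5 ^ 5 + 5 <= n)%N -> lines_le X (phi n).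
Proof.
case: n X w => // n X w tX wX w0 w4 nbig.
have n502 : (501 <= n)%N by apply: leq_trans (_ : 5 ^ 4 <= n)%N => //; lia.
apply: (minimal_frame tX wX w0) => X' S fr S0 Sw I x L xX np.
have [tX' _ _ hX'] := fr; have [v vX vS] := frame_oddset fr.
have [S3|S4] := leqP #|S| 3.
  by apply: (odd_le3 tX' vX) xX np; rewrite ?vS //; apply: leqW.
have cS : #|S| = 4%N by apply/eqP; rewrite eqn_leq S4 (leq_trans Sw w4).
have S3 : (2 < #|S|)%N by rewrite cS.
have step e : e \in S -> (#|L| <= phi n.+1)%N \/
    [/\ #|S| = 4%N, exists b y0, [/\ b \in S, b != e, square X' e b y0 & ~~ eqT (~: S) y0 0]
    & forall h, eqT (~: S) h 0 -> (forall k, k \in S -> hf (h 0 k)) -> X' h].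
  move=> eS; have [u [uX u0 uS]] := drop_odd fr eS (ltnW S3).
  have lM : lines_le (dimg X' e) (phi n).
    have u3 : (#|oddset u| <= 3)%N by rewrite -ltnS -cS.
    exact: odd_le3 (tm_drop e tX') uX u0 u3 n502.
  have [V [y [cL yP yN]]] := frame_contract fr eS S3 lM xX np.
  have [cV|] := small_lines fr eS (or_intror cS) yP yN; last by right.
  left; apply: leq_trans cL _; rewrite phiS ?(leq_trans _ n502) //; lia.
rewrite leqNgt; apply/negP=> ltL.
have step' e : e \in S -> (exists b y0, [/\ b \in S, b != e, square X' e b y0 & ~~ eqT (~: S) y0 0])
    /\ forall h, eqT (~: S) h 0 -> (forall k, k \in S -> hf (h 0 k)) -> X' h.
  by case/step=> [|[]//]; rewrite leqNgt ltL.
have /set0Pn[e0 e0S] := S0; have [_ full] := step' _ e0S.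
have := exceptional_bound fr cS (fun e eS => (step' e eS).1) full xX np nbig.
by rewrite leqNgt ltL.
Qed.

(** For |S| <= 4 there is no excess. For |S| >= 5 there are at most n pairs in rank n + 1, one less
    than the budget admits, hence [k.-1]. *)
Lemma excess_step n k : (5 ^ 5 + 5 <= n)%N ->
  (forall X : 'rV[R]_n -> Prop, tm X -> lines_le X (phi n + k)) ->
  (forall X : 'rV[R]_n.+1 -> Prop, tm X -> lines_le X (phi n.+1 + k.-1)).
Proof.
move=> nbig H X tX.
have n0 : (0 < n)%N by apply: leq_trans nbig; rewrite addn_gt0 orbT.
apply: odd_or_int => // [|w wX w0]; first exact: leq_addr.
apply: (minimal_frame tX wX w0) => X' S fr S0 Sw I x L xX np.
have [tX' _ _ hX'] := fr; have [v vX vS] := frame_oddset fr.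
have [S4|S5] := leqP #|S| 4.
  apply: leq_trans (leq_addr _ _).
  by apply: (odd_le4 tX' vX) xX np; rewrite ?vS //; apply: leqW.
have /set0Pn[e eS] := S0.
have S3 : (2 < #|S|)%N by apply: leq_trans S5.
have [V [y [cL yP yN]]] := frame_contract fr eS S3 (H _ (tm_drop e tX')) xX np.
have cV := indep_lines tX' hX' S5 yP yN.
by apply: leq_trans cL _; rewrite phiS //; lia.
Qed.

Theorem lines_bound N n (X : 'rV[R]_n -> Prop) : (5 ^ 5 + 5 <= N)%N -> (N + 5 ^ N <= n)%N -> tm X ->
  lines_le X (phi n).
Proof.
move=> Nbig le tX.
(* Rank N has the excess 5^N by [crude], and every further rank removes one. *)
have base k (Y : 'rV[R]_(k + N) -> Prop) : tm Y -> lines_le Y (phi (k + N) + (5 ^ N - k)).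
  elim: k Y => [|k IH] Y tY.
    move=> I x L xX [x0 np]; apply: leq_trans (leq_addl _ _); rewrite subn0.
    rewrite -[X in (5 ^ X)%N]card_ord -cardsT; apply: (crude tY xX) => i j iL jL /eqTP E.
    have [//|ij] := eqVneq i j; have /eqP[] := np i j iL jL ij 1; rewrite scale1r.
    by apply/rowP=> m; apply: E; rewrite inE.
  rewrite subnS; have le' : (5 ^ 5 + 5 <= k + N)%N := leq_trans Nbig (leq_addl _ _).
  exact: (excess_step le' IH tY).
have := base (n - N)%N; rewrite subnK; last exact: leq_trans (leq_addr _ _) le.
by move=> /(_ X tX); rewrite (_ : (5 ^ N - (n - N))%N = 0%N) ?addn0 //; lia.
Qed.

End Assembly.

(** * From 2-modular matrices to half-integral minors *)

Lemma hv_ratio (d d' : int) : d' != 0 -> `|d'| <= 2 -> `|d| <= `|d'| ->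
  hv (d%:~R / d'%:~R : rat).
Proof.
move=> d0 d2 dd.
have : d' = 1 \/ d' = -1 \/ d' = 2 \/ d' = -2 by lia.
have : d = 0 \/ d = 1 \/ d = -1 \/ d = 2 \/ d = -2 by lia.
case=> [|[|[|[]]]] dE; case=> [|[|[]]] dE'; rewrite dE dE' in dd *; try (by exfalso; lia); by vm_compute.
Qed.

(** A set [h] of r independent columns loses no information about the rows. With rows [f] of largest
    |det| in these columns as a basis, determinants of coordinate vectors are, up to sign, quotients
    of two such minors of A, the denominator being the larger one and at most 2. *)
Lemma modular_bound N m n (A : 'M[int]_(m, n)) : (5 ^ 5 + 5 <= N)%N -> (N + 5 ^ N <= rankZ A)%N ->
  Delta_modular 2 A -> nonzero_nonparallel_rows A -> (m <= phi (rankZ A))%N.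
Proof.
move=> Nbig le dA [A0 An]; rewrite /rankZ in le dA *.
set B := ratmx A in le dA *; set r := \rank B in le dA *.
have fullT : row_full (row_base B)^T by rewrite /row_full mxrank_tr; apply: row_base_free.
pose h := fullrankfun fullT.
pose Q : 'M[rat]_r := colsub h (row_base B).
have uQ : Q \in unitmx.
  have := fullrowsub_unit fullT; rewrite -unitmx_tr; congr (_ \in unitmx).
  by apply/matrixP=> i j; rewrite !mxE.
pose M : 'M[rat]_(m, r) := colsub h B.
have ME : M = col_base B *m Q.
  apply/matrixP=> i j; have /matrixP/(_ i (h j)) := mulmx_base B; rewrite !mxE => <-.
  by apply: eq_bigr => k _; rewrite [colsub _ _ _ _]mxE.
have BE : B = M *m (invmx Q *m row_base B) by rewrite ME mulmxA mulmxK // mulmx_base.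
have fM : row_full M by rewrite ME /row_full mxrankMfree ?row_free_unit //; apply: col_base_full.
pose dz (f : {ffun 'I_r -> 'I_m}) := \det (\matrix_(i, j) A (f i) (h j)).
have dzE (f : {ffun 'I_r -> 'I_m}) : \det (rowsub f M) = (dz f)%:~R.
  rewrite /dz -det_map_mx; congr (\det _); by apply/matrixP=> i j; rewrite !mxE.
have f0P : dz (fullrankfun fM) != 0.
  by have := fullrowsub_unit fM; rewrite unitmxE unitfE dzE intr_eq0.
have [f _ fm] := arg_maxP (P := predT) (fun f => `|dz f|) (isT : predT (fullrankfun fM)).
have fz : dz f != 0 by have := fm _ (isT : predT (fullrankfun fM)); move: f0P; rewrite -!normr_gt0; apply: lt_le_trans.
pose D := rowsub f M.
have uD : D \in unitmx by rewrite unitmxE unitfE dzE intr_eq0.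
pose x i := row i M *m invmx D.
pose X (v : 'rV[rat]_r) := exists i, v = x i \/ v = - x i.
have tX : tm X.
  split=> [j|v [i [->|->]]|G GX].
  - exists (f j); left; rewrite /x (_ : row (f j) M = row j D); last by apply/rowP=> k; rewrite !mxE.
    by rewrite -row_mul mulmxV // row1; apply/rowP=> k; rewrite !mxE eqxx.
  - by exists i; right.
  - by exists i; left; rewrite opprK.
  have /fin_all_exists[k kP] := GX.
  pose f' := [ffun i => k i].
  have /fin_all_exists[s sP] : forall i, exists s : rat, `|s| = 1 /\ row i G = s *: x (k i).
    by move=> i; case: (kP i) => ->; [exists 1|exists (-1)]; rewrite ?normrN normr1 ?scale1r ?scaleN1r.
  have GE : G = diag_mx (\row_i s i) *m (rowsub f' M *m invmx D).
    have xE i : x (k i) = row i (rowsub f' M *m invmx D).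
      have fE : f' i = k i by rewrite ffunE.
      by rewrite row_mul; congr (_ *m _); apply/rowP=> l; rewrite !mxE fE.
    rewrite mul_diag_mx; apply/matrixP=> i l; have /rowP/(_ l) := (sP i).2.
    by rewrite mxE => ->; rewrite xE mxE [in LHS]mxE [RHS]mxE [in RHS]mxE.
  rewrite GE !det_mulmx det_inv det_diag !dzE.
  have s1 : `|\prod_i (\row_i0 s i0) 0 i| = 1 :> rat.
    by rewrite normr_prod big1 // => i _; rewrite mxE (sP i).1.
  rewrite mulrC; apply: (hv_norm (b := (\prod_i (\row_i0 s i0) 0 i)^-1)); first by rewrite normfV s1 invr1.
  rewrite mulfK; last by rewrite -normr_eq0 s1 oner_neq0.
  apply: hv_ratio => //; last exact: fm.
  exact: dA.
have xp i : row i B = x i *m D *m (invmx Q *m row_base B).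
  by rewrite /x mulmxKV // -row_mul -BE.
have rowB i : ratmx (row i A) = row i B by apply/rowP=> k; rewrite !mxE.
have x0 i : x i != 0.
  apply: contra (A0 i) => /eqP xi; have := xp i; rewrite xi !mul0mx -rowB => E.
  apply/eqP/rowP=> k; have /rowP/(_ k)/eqP := E; rewrite !mxE intr_eq0; exact/eqP.
have np : nonpar x [set: 'I_m].
  split=> [i _|i j _ _ ij c]; first exact: x0.
  apply/negP=> /eqP E; have [[]] := An i j ij; exists c; split.
    by apply: contra (x0 i) => /eqP c0; rewrite E c0 scale0r.
  by rewrite !rowB !xp E -!scalemxAl.
have := lines_bound Nbig le tX (x := x) (L := [set: 'I_m]).
rewrite cardsT card_ord; apply=> // i _; by exists i; left.
Qed.

(** * The extremal matrix *)

Section Network.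

(** Rows of a network matrix: the ends of an arc give 1 and -1, and [None] is a missing end. *)
Definition network n (v : 'rV[int]_n) :=
  exists a b : option 'I_n, forall j, v 0 j = (a == Some j)%:R - (b == Some j)%:R.

Lemma network_drop n (v : 'rV[int]_n.+1) k : network v -> network (col' k v).
Proof.
move=> [a [b vE]]; exists (obind (unlift k) a), (obind (unlift k) b) => j; rewrite mxE vE.
have E (o : option 'I_n.+1) : (o == Some (lift k j)) = (obind (unlift k) o == Some j).
  case: o => [l|//] /=; case: (unliftP k l) => [l' ->|->]; rewrite !(inj_eq Some_inj).
    by rewrite (inj_eq lift_inj).
  by rewrite (negPf (neq_lift _ _)).
by rewrite !E.
Qed.

(** Total unimodularity: expand along a row with a missing end; if no end is missing, the entries of
    each row add up to 0 and the matrix is singular. *)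
Lemma network_det n (A : 'M[int]_n) : (forall i, network (row i A)) -> `|\det A| <= 1.
Proof.
elim: n A => [|n IH] A net; first by rewrite det_mx00 normr1.
have /fin_all_exists[a] := net; case/fin_all_exists=> b ab.
have AE i j : A i j = (a i == Some j)%:R - (b i == Some j)%:R by have := ab i j; rewrite mxE.
have minor i k (s : int) : `|s| <= 1 -> (forall j, A i j = s * (j == k)%:R) -> `|\det A| <= 1.
  move=> s1 Ai; rewrite (expand_det_row _ i) (bigD1 k) //= big1 => [|j /negPf jk]; last first.
    by rewrite Ai jk mulr0 mul0r.
  rewrite addr0 Ai eqxx mulr1 normrM normrM normrX normrN1 expr1n mul1r.
  rewrite -[1]mulr1; apply: ler_pM => //; apply: IH => l.
  have -> : row l (row' i (col' k A)) = col' k (row (lift i l) A).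
    by apply/rowP=> j; rewrite !mxE.
  exact: network_drop.
have [/existsP[i /orP[]/eqP ai]|] := boolP [exists i, (a i == None) || (b i == None)].
- case bi: (b i) => [k|].
    apply: (minor i k (-1)) => // j; rewrite AE ai bi mulN1r /= sub0r.
    by rewrite (inj_eq Some_inj) eq_sym.
  by apply: (minor i 0 0) => // j; rewrite AE ai bi mul0r subrr.
- case ai': (a i) => [k|].
    apply: (minor i k 1) => // j; rewrite AE ai ai' mul1r /= subr0.
    by rewrite (inj_eq Some_inj) eq_sym.
  by apply: (minor i 0 0) => // j; rewrite AE ai ai' mul0r subrr.
rewrite negb_exists => /forallP noN.
suff -> : \det A = 0 by rewrite normr0.
apply/eqP; rewrite -det_tr; apply/det0P; exists (const_mx 1).
  by apply/eqP=> /rowP/(_ 0); rewrite !mxE.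
apply/rowP=> i; rewrite !mxE.
have one (o : option 'I_n.+1) : o != None -> \sum_j (o == Some j)%:R = 1 :> int.
  case: o => // l _; rewrite (bigD1 l) //= eqxx big1 ?addr0 // => j /negPf jl.
  by rewrite (inj_eq Some_inj) eq_sym jl.
have := noN i; rewrite negb_or => /andP[ai bi].
under eq_bigr => j _ do rewrite !mxE mul1r AE.
by rewrite sumrB !one // subrr.
Qed.

End Network.

Section Example.
Variable k : nat.
Local Notation r := k.+1.

(** A pair i <= j encodes e_i - e_j, or e_i when i = j; the index j in ['I_k] encodes e_0 +
    e_(j+1). *)
Definition ex_index : finType := ({p : 'I_r * 'I_r | (p.1 <= p.2)%N} + 'I_k)%type.

Definition ex_i (t : ex_index) : 'I_r := match t with inl p => (val p).1 | inr _ => 0 end.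
Definition ex_j (t : ex_index) : 'I_r := match t with inl p => (val p).2 | inr j => lift 0 j end.
Definition ex_s (t : ex_index) : int :=
  match t with inl p => if (val p).1 == (val p).2 then 0 else -1 | inr _ => 1 end.

Definition ex_row (t : ex_index) : 'rV[int]_r :=
  \row_c ((c == ex_i t)%:R + ex_s t * (c == ex_j t)%:R).

Lemma card_ex_index : #|ex_index| = phi r.
Proof.
rewrite card_sum card_ord card_sig.
have -> : #|[pred p : 'I_r * 'I_r | (p.1 <= p.2)%N]| = 'C(r.+1, 2).
  rewrite -sum1_card (eq_bigl (fun p : 'I_r * 'I_r => true && (p.1 <= p.2)%N)) //.
  rewrite -(pair_big_dep xpredT (fun i j : 'I_r => (i <= j)%N) (fun _ _ => 1%N)) /=.
  rewrite (exchange_big_dep xpredT) //= -bin2_sum big_nat_recl // add0n big_mkord.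
  apply: eq_bigr => j _; rewrite -(big_ord_widen _ (fun _ => 1%N) (ltn_ord j)).
  by rewrite sum1_card card_ord.
by have := bin2_double r; have := phiE r; lia.
Qed.

Lemma ex_le t : (ex_i t <= ex_j t)%N.
Proof. by case: t => [[[i j] /= le]|j]. Qed.

(** Together with [ex_low], the leading entry of a row is a 1 in column [ex_i t], so proportional
    rows are equal. *)
Lemma ex_lead t : ex_row t 0 (ex_i t) = 1.
Proof.
rewrite mxE eqxx; case: t => [[[i j] le]|j] /=; last by rewrite mulr0 addr0.
by case: eqVneq => _; rewrite ?mul0r ?mulr0 addr0.
Qed.

Lemma ex_low t (c : 'I_r) : (c < ex_i t)%N -> ex_row t 0 c = 0.
Proof.
move=> ci; rewrite mxE; have /negPf-> : c != ex_i t by rewrite neq_ltn ci.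
have /negPf-> : c != ex_j t by rewrite neq_ltn (leq_trans ci (ex_le t)).
by rewrite mulr0 addr0.
Qed.

Lemma ex_inj t t' : ex_i t = ex_i t' -> ex_row t = ex_row t' -> t = t'.
Proof.
move=> ii /rowP E.
have {}E c : c != ex_i t -> ex_s t * (c == ex_j t)%:R = ex_s t' * (c == ex_j t')%:R.
  by move=> ci; have := E c; rewrite !mxE -ii (negPf ci) !add0r.
case: t t' ii E => [[[i j] /= le]|j] [[[i' j'] /= le']|j'] /=.
- move=> ii; rewrite -{}ii in le' *; move=> E; congr inl; apply/val_inj; congr (_, _).
  have [ij|ij] := eqVneq i j; have [ij'|ij'] := eqVneq i j'.
  + by rewrite -ij.
  + by have := E j'; rewrite eq_sym ij' -ij !eqxx (negPf ij') mul0r => /(_ isT)/eqP.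
  + by have := E j; rewrite eq_sym ij -ij' !eqxx (negPf ij) mul0r => /(_ isT)/eqP.
  have := E j; rewrite eq_sym ij eqxx (negPf ij) (negPf ij') => /(_ isT)/eqP.
  by case: (eqVneq j j').
- move=> ii E; have /E/eqP : lift 0 j' != i by rewrite ii.
  by rewrite eqxx; case: (_ == j); case: (_ == j).
- move=> ii E; have /E/eqP : lift 0 j != 0 by [].
  by rewrite eqxx; case: (_ == j'); case: (_ == j').
move=> _ E; have /E/eqP : lift 0 j != 0 by [].
by rewrite eqxx; case: (lift 0 j =P lift 0 j') => [/lift_inj->|].
Qed.

Lemma ex_par t t' (c : rat) : c != 0 -> ratmx (ex_row t) = c *: ratmx (ex_row t') -> t = t'.
Proof.
move=> c0 /rowP E.
have {}E l : (ex_row t 0 l)%:~R = c * (ex_row t' 0 l)%:~R by have := E l; rewrite !mxE.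
have ii : ex_i t = ex_i t'.
  apply: val_inj; apply/eqP; rewrite eqn_leq; apply/andP; split; rewrite leqNgt; apply/negP=> lt.
    have := E (ex_i t'); rewrite ex_low // ex_lead mulr1 => /esym/eqP.
    by rewrite (negPf c0).
  by have := E (ex_i t); rewrite ex_lead ex_low // mulr0.
have c1 : c = 1 by have := E (ex_i t); rewrite {2}ii !ex_lead mulr1.
by apply: ex_inj => //; apply/rowP=> l; have := E l; rewrite c1 mul1r => /intr_inj.
Qed.

Definition ex_plus (t : ex_index) := if t is inr _ then true else false.

(* Splitting column 0 gives a difference of two network determinants. *)
Lemma ex_det (f : 'I_r -> ex_index) : `|\det (\matrix_i ex_row (f i))| <= 2.
Proof.
set A := \matrix_i _.
(* A row e_0 + e_j becomes e_j in [A1] and e_j - e_0 in [A2]; the other rows are unchanged in [A1]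
   and lose their entry in column 0 in [A2]. *)
pose A1 : 'M[int]_r := \matrix_(i, c) if (c == 0) && ex_plus (f i) then 0 else A i c.
pose A2 : 'M[int]_r := \matrix_(i, c) if c == 0 then - (ex_plus (f i))%:R else A i c.
have D : \det A^T = 1 * \det A1^T + (-1) * \det A2^T.
  apply: (determinant_multilinear (i0 := 0)).
  - apply/rowP=> i; rewrite !mxE eqxx /=; case: (f i) => [p|j] /=; first by ring.
    by rewrite !mulr0 addr0 add0r mulrNN mulr1.
  - by apply/matrixP=> c i; rewrite !mxE.
  by apply/matrixP=> c i; rewrite !mxE.
have n1 : `|\det A1| <= 1.
  apply: network_det => i.
  case fi: (f i) => [[[a b] le]|j].
    exists (Some a), (if a == b then None else Some b) => c; rewrite !mxE fi /= andbF.
    rewrite (inj_eq Some_inj) (eq_sym a c).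
    by case: (a == b) => /=; rewrite ?mul0r ?subr0 ?addr0 // (inj_eq Some_inj) (eq_sym b c) mulN1r.
  exists (Some (lift 0 j)), None => c; rewrite !mxE fi andbT /= subr0 (inj_eq Some_inj) mul1r eq_sym.
  by case: eqP => [<-|_]; rewrite ?add0r // eq_sym.
have n2 : `|\det A2| <= 1.
  apply: network_det => i.
  case fi: (f i) => [[[a b] /= le]|j].
    exists (if a == 0 then None else Some a), (if a == b then None else Some b) => c.
    rewrite !mxE fi /=; have [->|c0] := eqVneq c 0.
      have b0 : b == 0 -> a == b.
        by move=> /eqP b0; have := le; rewrite b0 leqn0 => h; apply/eqP/val_inj/eqP.
      have -> : ((if a == 0 then None else Some a) == Some 0) = false.
        by case: ifP => //; rewrite (inj_eq Some_inj).
      have -> : ((if a == b then None else Some b) == Some 0) = false.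
        by case: ifP => // ab; rewrite (inj_eq Some_inj); apply/negbTE/negP => /b0; rewrite ab.
      by rewrite subrr oppr0.
    have -> : ((if a == 0 then None else Some a) == Some c) = (c == a).
      by case: ifP => [/eqP->|_]; rewrite ?(negPf c0) // (inj_eq Some_inj) eq_sym.
    case: (a == b) => /=; first by rewrite mul0r oppr0.
    by rewrite (inj_eq Some_inj) (eq_sym b c) mulN1r.
  exists (Some (lift 0 j)), (Some 0) => c; rewrite !mxE fi /= !(inj_eq Some_inj) mul1r.
  rewrite (eq_sym 0 c) (eq_sym _ c); have [->|c0] := eqVneq c 0; first by rewrite sub0r.
  by rewrite add0r subr0.
move: D; rewrite !det_tr mul1r mulN1r => ->; apply: le_trans (ler_normB _ _) _.
exact: lerD n1 n2.
Qed.

Lemma example : exists A : 'M[int]_(phi r, r),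
  rankZ A = r /\ Delta_modular 2 A /\ nonzero_nonparallel_rows A.
Proof.
rewrite -card_ex_index.
pose A : 'M[int]_(#|ex_index|, r) := \matrix_a ex_row (enum_val a).
have rowA a : row a A = ex_row (enum_val a) by rewrite rowK.
have rk : rankZ A = r.
  apply/eqP; rewrite /rankZ -/(row_full _) -sub1mx; apply/row_subP=> i.
  pose t : ex_index := inl (exist _ (i, i) (leqnn i)).
  suff -> : row i 1%:M = row (enum_rank t) (ratmx A) by apply: row_sub.
  by apply/rowP=> c; rewrite !mxE enum_rankK /= eqxx mul0r addr0 eq_sym; case: eqP.
exists A; split=> //; split.
  rewrite /Delta_modular; move: (rankZ A) rk => _ -> f g.
  (* The column selection as a matrix factor; its transpose has unit rows, so [network_det] bounds
     its determinant. *)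
  pose P : 'M[int]_r := \matrix_(c, j) (c == g j)%:R.
  have -> : \matrix_(i, j) A (f i) (g j) = (\matrix_i ex_row (enum_val (f i))) *m P.
    apply/matrixP=> i j; rewrite [LHS]mxE [RHS]mxE (bigD1 (g j)) //= big1 => [|c /negPf cj].
      by rewrite !mxE eqxx mulr1 addr0.
    by rewrite [P _ _]mxE cj mulr0.
  rewrite det_mulmx normrM -[2%:Z]mulr1; apply: ler_pM => //; first exact: ex_det.
  rewrite -det_tr; apply: network_det => j; exists (Some (g j)), None => c.
  by rewrite !mxE subr0 (inj_eq Some_inj) eq_sym.
split=> [a|a b ab].
  rewrite rowA; apply/eqP=> /rowP/(_ (ex_i (enum_val a))); rewrite ex_lead mxE => /eqP.
  by rewrite oner_eq0.
have np a' b' : a' != b' -> ~ parallel (row a' A) (row b' A).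
  move=> /negP ab' [c [c0]]; rewrite !rowA => /(ex_par c0)/enum_val_inj E.
  by apply: ab'; rewrite E.
by split; apply: np; rewrite // eq_sym.
Qed.

End Example.

Theorem theorem1p1 :
  exists r0 : nat, forall r : nat, (r0 <= r)%N ->
    (exists (m n : nat) (A : 'M[int]_(m, n)),
        rankZ A = r /\ Delta_modular 2 A /\ nonzero_nonparallel_rows A /\
        m = ('C(r + 2, 2) - 2)%N) /\
    (forall (m n : nat) (A : 'M[int]_(m, n)),
        rankZ A = r -> Delta_modular 2 A -> nonzero_nonparallel_rows A ->
        (m <= 'C(r + 2, 2) - 2)%N).
Proof.
(* N is kept abstract so that 5 ^ N is never evaluated. *)
have [N NE] : exists N, N = (5 ^ 5 + 5)%N by eexists.
exists (N + 5 ^ N)%N => r le; split; last first.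
  move=> m n A rk dA nA; rewrite -/(phi r) -rk; apply: (@modular_bound N) => //.
    by rewrite NE.
  by rewrite rk.
case: r le => [|k _].
  by rewrite leqn0 addn_eq0 expn_eq0 andbF.
have [A [rk [dA nA]]] := example k.
by exists (phi k.+1), k.+1, A.
Qed.
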